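(* Let $\varphi_\lambda(x):=e^{\lambda|x|^2}$. The evolution operator $G(t,s)$ is ultrabounded if and only if, for every $\lambda>0$ and $t>s$ in $I$, the function $G(t,s)\varphi_\lambda$ belongs to $L^\infty(\mathbb R^d)$ and, for any $\delta,\lambda>0$, there exists a positive constant $K_{\delta,\lambda}$ such that $$\|G(t,s)\varphi_\lambda\|_\infty\le K_{\delta,\lambda},\qquad s,t\in I,\ t-s\ge\delta.$$
   Context: Setting. $I$ is an open right halfline, and for $t\in I$, $(\mathcal A(t)\zeta)(x)=\mathrm{Tr}(Q(t)D^2\zeta(x))+\langle b(t,x),\nabla\zeta(x)\rangle$, $x\in\mathbb R^d$, where $Q=[q_{ij}]$ and $b=(b_1,\dots,b_d)$. Standing assumptions: (i) for some $\theta\in(0,1)$, $q_{ij}\in C^{\theta/2}_{\rm loc}(I)$ and $b_i\in C^{\theta/2,\theta}_{\rm loc}(I\times\mathbb R^d)$ (locally parabolic H\''older); (ii) $Q(t)$ is symmetric and there are $0<\eta_0<\Lambda$ with $\eta_0|\xi|^2\le\langle Q(t)\xi,\xi\rangle\le\Lambda|\xi|^2$ for all $t\in I$, $\xi\in\mathbb R^d$; (iii) there are a positive $\varphi\in C^2(\mathbb R^d)$ with $\varphi(x)\to+\infty$ as $|x|\to+\infty$ and constants $a,\gamma>0$ with $(\mathcal A(t)\varphi)(x)\le a-\gamma\varphi(x)$ for all $(t,x)\in I\times\mathbb R^d$; (iv) the first order spatial derivatives of $b_i$ exist and belong to $C^{\theta/2,\theta}_{\rm loc}(I\times\mathbb R^d)$,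 and there is $r_0<0$ with $\langle\nabla_xb(t,x)\xi,\xi\rangle\le r_0|\xi|^2$ for all $(t,x)\in I\times\mathbb R^d$, $\xi\in\mathbb R^d$. For $s\in I$ and $f\in C_b(\mathbb R^d)$, $G(\cdot,s)f\in C_b([s,+\infty)\times\mathbb R^d)\cap C^{1+\theta/2,2+\theta}_{\rm loc}((s,+\infty)\times\mathbb R^d)$ denotes the unique bounded classical solution of $D_tu=\mathcal A(t)u$ in $(s,+\infty)\times\mathbb R^d$, $u(s,\cdot)=f$. It has the representation $(G(t,s)f)(x)=\int_{\mathbb R^d}g_{t,s}(x,y)f(y)\,dy$ for $t>s$, with $g_{t,s}$ positive and $\|g_{t,s}(x,\cdot)\|_{L^1(\mathbb R^d)}=1$; for the unbounded positive function $\varphi_\lambda$, $G(t,s)\varphi_\lambda$ is defined (with values in $[0,+\infty]$) by this formula. Under these assumptions there is a unique family $\{\mu_t:t\in I\}$ of Borel probability measures which is tight (for every $\varepsilon>0$ there is $R>0$ with $\mu_t(B(0,R))\ge1-\varepsilon$ for all $t\in I$) and satisfies $\int G(t,s)f\,d\mu_t=\int f\,d\mu_s$ for all $t>s$ in $I$, $f\in C_b(\mathbb R^d)$ (the tight evolution system of measures). $G(t,s)$ extends to a contraction from $L^p(\mathbb R^d,\mu_s)$ to $L^p(\mathbb R^d,\mu_t)$ for every $p\in[1,+\infty)$, still denoted $G(t,s)$. $\|G(t,s)\|_{p\to\infty}$ is the operator norm from $L^p(\mathbb R^d,\mu_s)$ to $L^\infty(\mathbb R^d)$. $G(t,s)$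 is called ultrabounded if it maps $L^p(\mathbb R^d,\mu_s)$ into $L^\infty(\mathbb R^d)$ for every $p>1$ and $t>s$ in $I$, and (for each such $p$) there is a decreasing function $C_{p,\infty}:(0,+\infty)\to(0,+\infty)$ with $\lim_{r\to0^+}C_{p,\infty}(r)=+\infty$ and $\|G(t,s)\|_{p\to\infty}\le C_{p,\infty}(t-s)$ for all $s<t$ in $I$. *)

(* Defs.v *)
From HB Require Import structures.
From mathcomp Require Import all_boot all_order all_algebra.
From mathcomp Require Import all_classical all_reals all_analysis.
From mathcomp Require Import measurable_realfun.

Set Implicit Arguments.
Unset Strict Implicit.
Unset Printing Implicit Defensive.

Import Order.TTheory GRing.Theory Num.Theory.
Import numFieldNormedType.Exports.

Local Open Scope classical_set_scope.
Local Open Scope ring_scope.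

(* Borel sets of R^d (and of spaces of matrices). *)
HB.instance Definition _ (R : realType) (m n : nat) :=
  Measurable.copy 'M[R]_(m, n) (g_sigma_algebraType (open : set (set 'M[R]_(m, n)))).

Lemma measurable_of_open (R : realType) (d : measure_display)
    (T : measurableType d) (m : nat) (f : T -> 'rV[R]_m) :
  (forall U : set 'rV[R]_m, open U -> measurable (f @^-1` U)) ->
  measurable_fun setT f.
Proof.
move=> h; apply: (@measurability _ _ T 'rV[R]_m setT f (@open 'rV[R]_m)).
  by [].
by move=> _ [U oU <-]; rewrite setTI; exact: h.
Qed.

Definition cons_rV (R : realType) (n : nat) (p : R * 'rV[R]_n) : 'rV[R]_n.+1 :=
  row_mx p.1%:M p.2.

Lemma measurable_cons_rV (R : realType) (n : nat) :
  measurable_fun setT (@cons_rV R n).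
Proof.
apply: measurable_of_open => U oU.
pose box (z : rat * 'rV[rat]_n * nat) : set (R * 'rV[R]_n) :=
  ball (ratr z.1.1 : R) z.2.+1%:R^-1 `*`
  ball (map_mx (ratr : rat -> R) z.1.2) z.2.+1%:R^-1.
pose S := [set z | box z `<=` @cons_rV R n @^-1` U].
suff -> : @cons_rV R n @^-1` U =
    \bigcup_z (if z \in S then box z else set0).
  apply: countable_bigcupT_measurable; first exact: countableP.
  move=> z; case: ifP => _; last exact: measurable0.
  apply: measurableX; first exact: measurable_ball.
  by apply: sub_sigma_algebra; exact: ball_open.
apply/seteqP; split=> [[x v] /= Uxv|p [z _]]; last first.
  by case: ifPn => // /set_mem; exact.
move: oU; rewrite openE => /(_ _ Uxv) /nbhs_ballP[e /= e0 eU].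
have [k ke] : exists k, (k.+1%:R^-1 : R) < e / 2.
  have /ltr_add_invr[k hk] : (0 : R) < e / 2 by rewrite divr_gt0.
  by exists k; rewrite add0r in hk.
have k0 : 0 < k.+1%:R^-1 :> R by rewrite invr_gt0 ltr0n.
have app (r : R) : exists q : rat, ball (ratr q : R) k.+1%:R^-1 r.
  have /rat_in_itvoo[q /itvP qr] : r < r + k.+1%:R^-1 by rewrite ltrDl.
  exists q; rewrite /ball /= gtr0_norm ?subr_gt0 ?qr//.
  by rewrite ltrBlDl qr.
have [q hq] := app x.
have /choice[w hw] : forall i, exists q : rat, ball (ratr q : R) k.+1%:R^-1 (v 0 i).
  by move=> i; exact: app.
have hwv : ball (map_mx (ratr : rat -> R) (\row_i w i)) k.+1%:R^-1 v.
  by split => // i j; rewrite ord1 !mxE; exact: hw.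
exists (q, \row_i w i, k) => //.
rewrite (_ : _ \in S = true); first by split.
apply/mem_set => -[y u] /= [/= hy [_ hu]]; apply: eU.
have close (a b c : R) : ball a k.+1%:R^-1 b -> ball a k.+1%:R^-1 c -> ball b e c.
  move=> /ball_sym ab ac; apply: (@le_ball _ _ _ (k.+1%:R^-1 + k.+1%:R^-1)).
    by rewrite (splitr e) lerD// ltW.
  exact: ball_triangle ab ac.
split => // i j; rewrite /cons_rV !mxE; case: splitP => l _ /=.
  by rewrite !mxE !ord1 eqxx !mulr1n; exact: close hq hy.
apply: (close (map_mx (ratr : rat -> R) (\row_i w i) i l)); last exact: hu.
by case: hwv => _; exact.
Qed.

Section lebesgue_cons.
Context {R : realType} {n : nat}.
Variable m : {measure set 'rV[R]_n -> \bar R}.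

Definition lebesgue_cons : set 'rV[R]_n.+1 -> \bar R :=
  pushforward (@lebesgue_measure R \x^ m)%E (@cons_rV R n).

Let lebesgue_cons0 : lebesgue_cons set0 = 0%E.
Proof. by rewrite /lebesgue_cons /pushforward preimage_set0 measure0. Qed.

Let lebesgue_cons_ge0 A : (0 <= lebesgue_cons A)%E.
Proof. rewrite /lebesgue_cons /pushforward; exact: measure_ge0. Qed.

Let lebesgue_cons_sigma_additive : semi_sigma_additive lebesgue_cons.
Proof.
apply: measure_semi_sigma_additive; exact: measurable_cons_rV.
Qed.

HB.instance Definition _ := isMeasure.Build _ _ _ lebesgue_cons
  lebesgue_cons0 lebesgue_cons_ge0 lebesgue_cons_sigma_additive.

End lebesgue_cons.

(* On R^(n+1), Lebesgue measure is the image of the product of the measures on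
   R and R^n; on the one-point space R^0 it is the unit mass. *)
Fixpoint lebesgue_rV (R : realType) (n : nat) :
    {measure set 'rV[R]_n -> \bar R} :=
  match n with
  | 0 => @dirac _ 'rV[R]_0 0 R
  | n'.+1 => lebesgue_cons (lebesgue_rV R n')
  end.

Section euclidean.
Context {R : realType} {d : nat}.
Implicit Types (x y xi : 'rV[R]_d) (A : 'M[R]_d).

(* The library norm `|x| on 'rV[R]_d is the sup norm, hence these. *)
Definition dotp x y : R := \sum_(i < d) x 0 i * y 0 i.
Definition enorm x : R := Num.sqrt (dotp x x).

Definition qform A xi : R :=
  \sum_(i < d) \sum_(j < d) A i j * xi 0 j * xi 0 i.

End euclidean.

Section calculus.
Context {R : realType} {d : nat}.
Implicit Types (f zeta : 'rV[R]_d -> R) (u : R -> 'rV[R]_d -> R).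
Implicit Types (x : 'rV[R]_d) (J : set R) (i j : 'I_d).

Definition basis_rV i : 'rV[R]_d := delta_mx 0 i.

Definition pderiv i f x : R := 'D_(basis_rV i) f x.

Definition grad f x : 'rV[R]_d := \row_i pderiv i f x.

Definition hess f x : 'M[R]_d := \matrix_(i, j) pderiv i (pderiv j f) x.

(* The functions below are only relevant for times in the interval J; nothing
   is required of them at other times. *)

Definition holder_time_loc (alpha : R) J (q : R -> R) : Prop :=
  forall t0 t1 : R, `[t0, t1]%classic `<=` J ->
  exists C : R, forall s t : R, s \in `[t0, t1] -> t \in `[t0, t1] ->
    `|q s - q t| <= C * `|s - t| `^ alpha.

(* C^{theta/2,theta}_loc(J x R^d): on each [t0,t1] x B(0,rad), the joint estimate
   is equivalent to separate Hoelder bounds in t and in x, and gives boundedness. *)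
Definition parabolic_holder_loc (theta : R) J u : Prop :=
  forall t0 t1 rad : R, `[t0, t1]%classic `<=` J ->
  exists C : R, forall (s t : R) x y, s \in `[t0, t1] -> t \in `[t0, t1] ->
    enorm x <= rad -> enorm y <= rad ->
    `|u s x - u t y| <= C * (`|s - t| `^ (theta / 2) + enorm (x - y) `^ theta).

Definition jointly_continuous J u : Prop :=
  forall p : R * 'rV[R]_d, J p.1 ->
    {for p, continuous (fun z : R * 'rV[R]_d => u z.1 z.2)}.

Definition parabolic_class (P : (R -> 'rV[R]_d -> R) -> Prop) J u : Prop :=
  [/\ forall t x, J t ->
        [/\ derivable (u^~ x) t 1,
            forall i, derivable (u t) x (basis_rV i) &
            forall i j, derivable (pderiv j (u t)) x (basis_rV i)],
      P u,
      P (fun t x => derive1 (u^~ x) t),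
      (forall i, P (fun t => pderiv i (u t))) &
      forall i j, P (fun t => pderiv i (pderiv j (u t)))].

Definition C12 J u : Prop := parabolic_class (jointly_continuous J) J u.

Definition C12_holder_loc (theta : R) J u : Prop :=
  parabolic_class (parabolic_holder_loc theta J) J u.

Definition C2 f : Prop :=
  [/\ continuous f,
      forall i x, derivable f x (basis_rV i),
      forall i, continuous (pderiv i f),
      forall i j x, derivable (pderiv j f) x (basis_rV i) &
      forall i j, continuous (pderiv i (pderiv j f))].

Definition Cb f : Prop := continuous f /\ exists M : R, forall x, `|f x| <= M.

End calculus.

Definition open_right_halfline {R : realType} (I : set R) : Prop :=
  exists a : R, I = `]a, +oo[%classic.

Section kolmogorov.
Context {R : realType} {d : nat}.
Variables (I : set R) (theta : R).
Variables (Q : R -> 'M[R]_d) (b : R -> 'rV[R]_d -> 'rV[R]_d).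

Definition generator (t : R) (zeta : 'rV[R]_d -> R) (x : 'rV[R]_d) : R :=
  \tr (Q t *m hess zeta x) + dotp (b t x) (grad zeta x).

Definition holder_coefficients : Prop :=
  (forall i j, holder_time_loc (theta / 2) I (fun t => Q t i j)) /\
  (forall i, parabolic_holder_loc theta I (fun t x => b t x 0 i)).

Definition uniformly_elliptic : Prop :=
  (forall t, I t -> (Q t)^T = Q t) /\
  exists eta0 Lam : R, [/\ 0 < eta0, eta0 < Lam &
    forall t xi, I t ->
      eta0 * enorm xi ^+ 2 <= qform (Q t) xi <= Lam * enorm xi ^+ 2].

Definition lyapunov : Prop :=
  exists (phi : 'rV[R]_d -> R) (a gamma : R),
    [/\ C2 phi,
        forall x, 0 < phi x,
        forall M : R, exists rad : R, forall x, rad <= enorm x -> M <= phi x,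
        0 < a /\ 0 < gamma &
        forall t x, I t -> generator t phi x <= a - gamma * phi x].

Definition jacobian_drift (t : R) (x : 'rV[R]_d) : 'M[R]_d :=
  \matrix_(i, j) pderiv j (fun y => b t y 0 i) x.

Definition dissipative_drift : Prop :=
  [/\ forall t (x : 'rV[R]_d) i j, I t ->
        derivable (fun y : 'rV[R]_d => b t y 0 i) x (basis_rV j),
      forall i j, parabolic_holder_loc theta I (fun t x => jacobian_drift t x i j) &
      exists r0 : R, r0 < 0 /\
        forall t x xi, I t -> qform (jacobian_drift t x) xi <= r0 * enorm xi ^+ 2].

Definition bounded_classical_solution (s : R) (f : 'rV[R]_d -> R)
    (u : R -> 'rV[R]_d -> R) : Prop :=
  [/\ {within [set p : R * 'rV[R]_d | s <= p.1],
         continuous (fun p : R * 'rV[R]_d => u p.1 p.2)},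
      exists M : R, forall t x, s <= t -> `|u t x| <= M,
      C12 `]s, +oo[%classic u,
      forall t x, s < t -> derive1 (u^~ x) t = generator t (u t) x &
      u s =1 f].

Variables (G : R -> R -> ('rV[R]_d -> R) -> 'rV[R]_d -> R)
          (g : R -> R -> 'rV[R]_d -> 'rV[R]_d -> R)
          (mu : R -> probability 'rV[R]_d R).

(* G t s is only relevant on C_b(R^d) and for s in I, s <= t. *)
Definition evolution_operator : Prop :=
  forall s f, I s -> Cb f ->
    [/\ bounded_classical_solution s f (fun t => G t s f),
        C12_holder_loc theta `]s, +oo[%classic (fun t => G t s f) &
        forall v, bounded_classical_solution s f v ->
          forall t x, s <= t -> v t x = G t s f x].

Local Open Scope ereal_scope.

Definition kernel_integral (t s : R) (psi : 'rV[R]_d -> R) (x : 'rV[R]_d) :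
    \bar R :=
  \int[lebesgue_rV R d]_y (g t s x y * psi y)%:E.

Definition evolution_kernel : Prop :=
  forall s t x, I s -> I t -> (s < t)%R ->
    [/\ measurable_fun setT (g t s x),
        forall y, (0 < g t s x y)%R,
        \int[lebesgue_rV R d]_y (g t s x y)%:E = 1 &
        forall f, Cb f -> (G t s f x)%:E = kernel_integral t s f x].

Definition tight_evolution_system : Prop :=
  (forall eps : R, (0 < eps)%R -> exists rad : R, (0 < rad)%R /\
     forall t, I t -> (1 - eps)%:E <= mu t [set x | (enorm x < rad)%R]) /\
  (forall s t f, I s -> I t -> (s < t)%R -> Cb f ->
     \int[mu t]_x (G t s f x)%:E = \int[mu s]_x (f x)%:E).

(* u is a representative of the image of f under the continuous extension of
   G(t,s) from C_b(R^d) to L^p(mu_s), with values in L^p(mu_t). *)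
Definition Lp_extension (p t s : R) (f u : 'rV[R]_d -> R) : Prop :=
  [/\ f \in Lfun (mu s) p%:E, u \in Lfun (mu t) p%:E &
      exists fn : nat -> 'rV[R]_d -> R,
        [/\ forall n, Cb (fn n),
            'N[mu s]_(p%:E)[EFin \o (fn n \- f)%R] @[n --> \oo] --> 0 &
            'N[mu t]_(p%:E)[EFin \o (G t s (fn n) \- u)%R] @[n --> \oo] --> 0]].

Definition Linfty_norm (u : 'rV[R]_d -> \bar R) : \bar R :=
  'N[lebesgue_rV R d]_(+oo)[u].

Definition in_Linfty (u : 'rV[R]_d -> \bar R) : Prop :=
  measurable_fun setT u /\ Linfty_norm u < +oo.

Definition maps_Lp_Linfty (p t s : R) : Prop :=
  forall f, f \in Lfun (mu s) p%:E ->
    exists u, Lp_extension p t s f u /\ in_Linfty (EFin \o u).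

Definition norm_Lp_Linfty (p t s : R) : \bar R :=
  ereal_sup [set z | exists f u : 'rV[R]_d -> R,
    [/\ Lp_extension p t s f u, 'N[mu s]_(p%:E)[EFin \o f] <= 1 &
        z = Linfty_norm (EFin \o u)]].

Definition ultrabounded : Prop :=
  forall p : R, (1 < p)%R ->
    (forall s t, I s -> I t -> (s < t)%R -> maps_Lp_Linfty p t s) /\
    exists C : R -> R,
      [/\ forall r : R, (0 < r)%R -> (0 < C r)%R,
          forall r1 r2 : R, (0 < r1)%R -> (r1 < r2)%R -> (C r2 < C r1)%R,
          C r @[r --> (0:R)^'+] --> +oo%R &
          forall s t, I s -> I t -> (s < t)%R ->
            norm_Lp_Linfty p t s <= (C (t - s)%R)%:E].

End kolmogorov.

Definition phi_exp {R : realType} {d : nat} (lam : R) (x : 'rV[R]_d) : R :=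
  expR (lam * enorm x ^+ 2).

(* Main.v *)
Require Import Defs.
From HB Require Import structures.
From mathcomp Require Import all_boot all_order all_algebra.
From mathcomp Require Import all_classical all_reals all_analysis.
From mathcomp Require Import measurable_realfun ess_sup_inf ring lra.

(** Everything rests on a maximum principle in doubled variables
([logarithmic_comparison]). For two positive bounded solutions [u] and [v] of the
equation, consider
  [al ln u(t,x) + be ln v(t,y) - |x-y|^2 / (c0 + c1 (t-s))],
less a small multiple of a logarithmic penalty that confines its maximum to a
compact set. At an interior maximum, moving [x] and [y] by the same vector leaves
[x-y] unchanged, so the second-order condition bounds the diffusion terms by the
quadratic gradient terms that the logarithms produce; the first-order conditions
say that both logarithmic gradients are, up to factors [1/al] and [-1/be], the
vector [2 (x-y) / (c0 + c1 (t-s))], apart from the penalty; and the drifts enter through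
[<b(t,x) - b(t,y), x-y>], which is nonpositive by dissipativity. If [c1] is chosen
against [1/al + 1/be], the time derivative of the quadratic term decides the sign
and there is no such maximum.

Two choices of the weights are used. With [al = p], [be = -1] one obtains the
dimension-free Harnack inequality
  [(G(t,s)F)^p (x) <= (G(t,s)F^p)(y) exp (c |x-y|^2 / (t-s))]
([harnack_inequality]). With [al = be = 1] one obtains that an inequality
[F(x) H(y) <= K exp (lam |x-y|^2)] implies [G(t,s)F * G(t,s)H <= K] for times of
order [1/lam] ([gaussian_concentration]).

Gaussian bounds imply ultraboundedness. By tightness one ball carries half of the
mass of every [mu_r]. Integrating the Harnack inequality in [y] over this ball
against [mu_r], [r = s + tau], and using invariance, [G(r,s)f] is bounded by
[A exp (lam |x|^2)] times the [L^p] norm of [f]; the hypothesis bounds what the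
evolution makes of this Gaussian ([evolution_Lp_sup_bound]). The estimate on
[C_b] passes to [L^p] by density ([Cb_dense_Lp]). The image of an [L^p] function is
defined up to [mu_t]-null sets while the sup norm refers to Lebesgue measure; this
is reconciled by [lebesgue_abs_continuous].

Ultraboundedness implies the Gaussian bounds. By tightness the tail function of a
large ball has small [L^2] norm, uniformly in [s]; the [L^2] to [L^infinity] bound
then says that the transition probabilities, from almost every starting
point, charge this ball with mass at least [3/4]. Concentration turns this into a uniform bound
for Gaussian integrals after a short time ([evolution_phi_trunc_le]), and later
times follow by the evolution law and monotone convergence. *)

Set Implicit Arguments.
Unset Strict Implicit.
Unset Printing Implicit Defensive.

Import Order.TTheory GRing.Theory Num.Theory.
Import numFieldNormedType.Exports.

Local Open Scope classical_set_scope.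
Local Open Scope ring_scope.

(** * Quadratic forms and traces *)

Section linear_algebra.
Context {R : realType} {d : nat}.
Implicit Types (x y z : 'rV[R]_d) (A Q H : 'M[R]_d).

Definition bil A x y : R := (x *m A *m y^T) 0 0.

Lemma bilE A x y : bil A x y = \sum_i \sum_j x 0 j * A j i * y 0 i.
Proof.
rewrite /bil mxE; apply: eq_bigr => i _; rewrite !mxE mulr_suml.
by apply: eq_bigr => j _.
Qed.

Lemma qformE A x : qform A x = bil A x x.
Proof.
rewrite /qform bilE exchange_big /=; apply: eq_bigr => i _.
by apply: eq_bigr => j _; rewrite mulrC mulrA.
Qed.

Lemma bilDl A x y z : bil A (x + y) z = bil A x z + bil A y z.
Proof. by rewrite /bil !mulmxDl mxE. Qed.

Lemma bilDr A x y z : bil A x (y + z) = bil A x y + bil A x z.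
Proof. by rewrite /bil linearD mulmxDr mxE. Qed.

Lemma bilZl A a x y : bil A (a *: x) y = a * bil A x y.
Proof. by rewrite /bil -!scalemxAl mxE. Qed.

Lemma bilZr A a x y : bil A x (a *: y) = a * bil A x y.
Proof. by rewrite /bil linearZ -scalemxAr mxE. Qed.

Lemma bil_trC A x y : A^T = A -> bil A x y = bil A y x.
Proof.
move=> sA; rewrite /bil; transitivity ((x *m A *m y^T)^T 0 0).
  by rewrite [RHS]mxE.
by rewrite !trmx_mul trmxK sA mulmxA.
Qed.

Lemma bilDm A H x y : bil (A + H) x y = bil A x y + bil H x y.
Proof. by rewrite /bil mulmxDr mulmxDl mxE. Qed.

Lemma bilZm a A x y : bil (a *: A) x y = a * bil A x y.
Proof. by rewrite /bil -scalemxAr -scalemxAl mxE. Qed.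

Lemma bilNm A x y : bil (- A) x y = - bil A x y.
Proof. by rewrite -scaleN1r bilZm mulN1r. Qed.

Lemma bil_rank1 z x y : bil (z^T *m z) x y = dotp z x * dotp z y.
Proof.
rewrite /bil mulmxA -mulmxA mxE big_ord1 !mxE; congr (_ * _).
  by apply: eq_bigr => i _; rewrite mxE mulrC.
by apply: eq_bigr => i _; rewrite mxE.
Qed.

Lemma dotpE x y : dotp x y = bil 1%:M x y.
Proof.
by rewrite /bil mulmx1 mxE; apply: eq_bigr => i _; rewrite mxE.
Qed.

Lemma dotpC x y : dotp x y = dotp y x.
Proof. by apply: eq_bigr => i _; rewrite mulrC. Qed.

Lemma dotpDl x y z : dotp (x + y) z = dotp x z + dotp y z.
Proof. by rewrite !dotpE bilDl. Qed.
Lemma dotpDr x y z : dotp x (y + z) = dotp x y + dotp x z.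
Proof. by rewrite !dotpE bilDr. Qed.
Lemma dotpZl a x y : dotp (a *: x) y = a * dotp x y.
Proof. by rewrite !dotpE bilZl. Qed.
Lemma dotpZr a x y : dotp x (a *: y) = a * dotp x y.
Proof. by rewrite !dotpE bilZr. Qed.
Lemma dotpNl x y : dotp (- x) y = - dotp x y.
Proof. by rewrite -scaleN1r dotpZl mulN1r. Qed.
Lemma dotpNr x y : dotp x (- y) = - dotp x y.
Proof. by rewrite -scaleN1r dotpZr mulN1r. Qed.
Lemma dotpBl x y z : dotp (x - y) z = dotp x z - dotp y z.
Proof. by rewrite dotpDl dotpNl. Qed.
Lemma dotpBr x y z : dotp x (y - z) = dotp x y - dotp x z.
Proof. by rewrite dotpDr dotpNr. Qed.
Lemma dotp0l x : dotp 0 x = 0.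
Proof. by rewrite -(scale0r x) dotpZl mul0r. Qed.

Definition dotpDZ := (dotpDl, dotpDr, dotpBl, dotpBr, dotpZl, dotpZr,
  dotpNl, dotpNr).

Lemma dotp_ge0 x : 0 <= dotp x x.
Proof. by apply: sumr_ge0 => i _; rewrite -expr2 sqr_ge0. Qed.

Lemma coord_le_dotp x i : x 0 i ^+ 2 <= dotp x x.
Proof.
rewrite /dotp (bigD1 i)//= -expr2 lerDl sumr_ge0// => j _.
by rewrite -expr2 sqr_ge0.
Qed.

Lemma dotp_basis i x : dotp (basis_rV i) x = x 0 i.
Proof.
rewrite /dotp (bigD1 i)//= big1 ?addr0.
  by rewrite /basis_rV mxE !eqxx mul1r.
by move=> j ji; rewrite /basis_rV mxE eqxx (negbTE ji) mul0r.
Qed.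

Lemma enorm_ge0 x : 0 <= enorm x. Proof. exact: sqrtr_ge0. Qed.

Lemma sqr_enorm x : enorm x ^+ 2 = dotp x x.
Proof. by rewrite sqr_sqrtr// dotp_ge0. Qed.

Lemma dotp_CS x y : dotp x y ^+ 2 <= dotp x x * dotp y y.
Proof.
have [y0|y0] := eqVneq (dotp y y) 0.
  have yi i : y 0 i = 0.
    apply/eqP; rewrite -sqrf_eq0 eq_le sqr_ge0 andbT -y0.
    exact: coord_le_dotp.
  rewrite {1}/dotp big1 ?expr0n ?y0 ?mulr0//= => i _.
  by rewrite yi mulr0.
have yp : 0 < dotp y y by rewrite lt_def y0 dotp_ge0.
have := dotp_ge0 (dotp y y *: x - dotp x y *: y).
rewrite !dotpDZ (dotpC y x) => h.
rewrite -(ler_pM2l yp); nra.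
Qed.

Lemma enormD x y : enorm (x + y) <= enorm x + enorm y.
Proof.
rewrite -(ler_pXn2r (_ : 0 < 2)%N)// ?nnegrE ?addr_ge0 ?enorm_ge0//.
rewrite sqr_enorm !dotpDZ sqrrD !sqr_enorm (dotpC y x).
suff : dotp x y <= enorm x * enorm y by lra.
rewrite (le_trans (ler_norm _))//.
rewrite -(ler_pXn2r (_ : 0 < 2)%N)// ?nnegrE ?mulr_ge0 ?enorm_ge0//.
by rewrite real_normK ?num_real// exprMn !sqr_enorm dotp_CS.
Qed.

Lemma enormN x : enorm (- x) = enorm x.
Proof. by rewrite /enorm dotpNl dotpNr opprK. Qed.

Lemma mxtrace_rank1 z H : \tr (z^T *m z *m H) = qform H z.
Proof.
rewrite qformE /bil -mulmxA mxtrace_mulC /mxtrace big_ord1.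
by [].
Qed.

(** A quadratic form that is nonnegative and affine in the direction [k] has no
linear term in that direction. *)
Lemma psd_row_eq0 Q k : Q^T = Q -> (forall x, 0 <= qform Q x) -> Q k k = 0 ->
  forall i, Q i k = 0.
Proof.
move=> sQ Q0 Qkk i; have h r := Q0 (r *: basis_rV k + basis_rV i).
have E j l : bil Q (basis_rV j) (basis_rV l) = Q j l.
  by rewrite /bil /basis_rV -rowE mxE (bigD1 l)//= big1 => [|m ml];
    rewrite !mxE ?eqxx ?mulr1 ?addr0// (negbTE ml) andbF mulr0.
have sQik : Q k i = Q i k by rewrite -{1}sQ mxE.
have {}h r : 0 <= 2 * r * Q i k + Q i i.
  have := h r; rewrite qformE !(bilDl, bilDr, bilZl, bilZr) !E Qkk sQik; lra.
apply/eqP; apply: contraT => n0.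
have := h (- (Q i i + 1) / 2 / Q i k).
rewrite (_ : 2 * _ * _ = - (Q i i + 1)); first by lra.
by field.
Qed.

(** A positive semidefinite [Q] is a sum of rank-one matrices [z^T *m z], split
off here one pivot at a time, and each of them contributes [qform H z] to the
trace. *)
Lemma mxtrace_psd_nsd Q H : Q^T = Q -> (forall x, 0 <= qform Q x) ->
  (forall x, qform H x <= 0) -> \tr (Q *m H) <= 0.
Proof.
move=> sQ Q0 H0.
suff: forall n k Q, (d - k <= n)%N -> Q^T = Q -> (forall x, 0 <= qform Q x) ->
    (forall i j : 'I_d, (i < k)%N -> Q i j = 0) -> \tr (Q *m H) <= 0.
  by move/(_ d 0%N Q); apply => //; rewrite subn0.
elim=> [|n IH] k {sQ Q0}Q dk sQ Q0 supp.
  rewrite (_ : Q = 0) ?mul0mx ?mxtrace0//; apply/matrixP => i j; rewrite mxE supp//.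
  by move: dk; rewrite leqn0 subn_eq0; exact: leq_trans (ltn_ord i).
have [kd|kd] := ltnP k d; last first.
  apply: (IH k) => //.
  by move: kd; rewrite -subn_eq0 => /eqP ->.
(* The pivot is eliminated by a Schur complement, unless it vanishes and its row with it. *)
pose l := Ordinal kd.
have dk' : (d - k.+1 <= n)%N by rewrite subnS; case: (d - k)%N dk.
have Qsym i j : Q i j = Q j i by rewrite -{1}sQ mxE.
have [q0|q0] := eqVneq (Q l l) 0.
  apply: (IH k.+1) => // i j; rewrite ltnS leq_eqVlt => /orP[/eqP il|]; last exact: supp.
  have -> : i = l by exact: val_inj.
  by rewrite Qsym; apply: psd_row_eq0.
pose c : 'rV[R]_d := row l Q.
pose Q' := Q - (Q l l)^-1 *: (c^T *m c).
have Q'E i j : Q' i j = Q i j - (Q l l)^-1 * (Q l i * Q l j).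
  by rewrite !mxE big_ord1 !mxE.
have cE x : dotp c x = bil Q (basis_rV l) x.
  rewrite /bil /basis_rV -rowE mxE; apply: eq_bigr => i _; by rewrite !mxE.
have qll : bil Q (basis_rV l) (basis_rV l) = Q l l.
  by rewrite -cE dotpC dotp_basis mxE.
have ql0 : 0 < Q l l by rewrite lt_def q0 -qll -qformE Q0.
have -> : Q = Q' + (Q l l)^-1 *: (c^T *m c) by rewrite /Q' subrK.
rewrite mulmxDl mxtraceD -scalemxAl mxtraceZ mxtrace_rank1.
have : (Q l l)^-1 * qform H c <= 0 by rewrite mulr_ge0_le0// invr_ge0 ltW.
suff : \tr (Q' *m H) <= 0 by lra.
apply: (IH k.+1) => //.
- apply/matrixP => i j; rewrite mxE !Q'E Qsym; congr (_ - _ * _).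
  by rewrite mulrC.
- move=> x; have := Q0 (x - ((Q l l)^-1 * dotp c x) *: basis_rV l).
  rewrite !qformE /Q' -scaleN1r !(bilDl, bilDr, bilZl, bilZr, bilDm).
  rewrite -scaleNr bilZm bil_rank1 (bil_trC x) // -cE qll.
  by move=> h; apply: (le_trans h); rewrite le_eqVlt; apply/orP; left; apply/eqP; field.
- move=> i j; rewrite ltnS leq_eqVlt Q'E => /orP[/eqP il|ik].
    have -> : i = l by exact: val_inj.
    by rewrite mulrA mulVf// mul1r subrr.
  by rewrite (supp i)// Qsym (supp i)// mul0r mulr0 subr0.
Qed.

End linear_algebra.

(** * Derivatives along lines and at maxima *)

Section calculus_lemmas.
Context {R : realType}.

Lemma is_derive_line (V : normedModType R) (f : V -> R) (x v : V) (r df : R) :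
  is_derive (r *: v + x) v f df ->
  is_derive r (1 : R) (fun h : R => f (h *: v + x)) df.
Proof.
move=> [cf df_].
have E : (fun h : R => h^-1 *: (f ((h *: (1 : R) + r) *: v + x) - f (r *: v + x))) =
    (fun h : R => h^-1 *: (f (h *: v + (r *: v + x)) - f (r *: v + x))).
  by apply/funext => h; rewrite scalerDl [h *: 1]mulr1 addrA.
by split; rewrite /derivable /derive /= E.
Qed.

Lemma is_derive_of_line (V : normedModType R) (f : V -> R) (x v : V) (df : R) :
  is_derive (0 : R) (1 : R) (fun h : R => f (h *: v + x)) df ->
  is_derive x v f df.
Proof.
move=> [cf df_].
have E : (fun h : R => h^-1 *: (f ((h *: (1 : R) + 0) *: v + x) - f (0 *: v + x))) =
    (fun h : R => h^-1 *: (f (h *: v + x) - f x)).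
  by apply/funext => h; rewrite addr0 [h *: 1]mulr1 scale0r add0r.
by split; move: cf df_; rewrite /derivable /derive /= E.
Qed.

Lemma is_derive_lim (f : R -> R) (x l : R) :
  (fun h => h^-1 * (f (h + x) - f x)) @ 0^' --> l -> is_derive (x : R) (1 : R) f l.
Proof.
move=> cf.
have E : (fun h : R => h^-1 *: (f (h *: (1 : R) + x) - f x)) =
    (fun h : R => h^-1 * (f (h + x) - f x)).
  by apply/funext => h; rewrite [h *: 1]mulr1.
split; first by rewrite /derivable /= E; apply/cvg_ex; exists l.
by rewrite /derive /= E; exact/cvg_lim.
Qed.

Lemma lim_is_derive (f : R -> R) (x l : R) :
  is_derive (x : R) (1 : R) f l -> (fun h => h^-1 * (f (h + x) - f x)) @ 0^' --> l.
Proof.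
move=> [cf <-].
have E : (fun h : R => h^-1 *: (f (h *: (1 : R) + x) - f x)) =
    (fun h : R => h^-1 * (f (h + x) - f x)).
  by apply/funext => h; rewrite [h *: 1]mulr1.
by move: cf; rewrite /derivable /derive /= E.
Qed.

Lemma first_derivative_max (K dK : R -> R) :
  (forall r, is_derive (r : R) (1 : R) K (dK r)) ->
  (forall r, K r <= K 0) -> dK 0 = 0.
Proof.
move=> hK Kmax; have h : is_derive (0 : R) (1 : R) K 0.
  apply: (@derive1_at_max _ K (-1) 1 0) => //.
    by rewrite in_itv/= ltrN10 ltr01.
by rewrite -(@derive_val _ _ _ _ _ _ _ (hK 0)) (@derive_val _ _ _ _ _ _ _ h).
Qed.

(** If the second derivative were positive then, the first one being zero at the
maximum, [K] would increase just after it. *)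
Lemma second_derivative_max (K dK : R -> R) (k2 : R) :
  (forall r, is_derive (r : R) (1 : R) K (dK r)) -> is_derive (0 : R) (1 : R) dK k2 ->
  (forall r, K r <= K 0) -> k2 <= 0.
Proof.
move=> hK hdK Kmax.
have dK0 : dK 0 = 0 := first_derivative_max hK Kmax.
rewrite leNgt; apply/negP => k20.
have /lim_is_derive := hdK; rewrite dK0 => /cvgrPdist_lt /(_ k2 k20).
rewrite near_withinE => /nbhs_ballP[e /= e0 he].
pose r := e / 2; have r0 : 0 < r by rewrite /r; lra.
have pos c : 0 < c <= r -> 0 < dK c.
  move=> /andP[c0 cr]; have := he c.
  rewrite /ball /= sub0r normrN gtr0_norm// (gt_eqF c0) addr0 subr0.
  have ce : c < e by rewrite /r in cr; lra.
  move=> /(_ ce isT); rewrite ltr_norml => /andP[_].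
  have ci : 0 < c^-1 by rewrite invr_gt0.
  by move=> h; rewrite -(pmulr_rgt0 _ ci); lra.
have := @MVT _ K dK 0 r r0 (fun x _ => hK x).
case.
  by apply: derivable_within_continuous => x _; exact: ex_derive.
move=> c; rewrite in_itv/= subr0 => /andP[c0 cr] E.
have := Kmax r; rewrite -subr_le0 E leNgt mulr_gt0//.
by apply: pos; rewrite c0 ltW.
Qed.

(** One-sided: the last instant of a time interval is allowed as maximum. *)
Lemma derive_left_max (K : R -> R) (t0 t1 k : R) : t0 < t1 ->
  is_derive (t1 : R) (1 : R) K k -> (forall t, t0 <= t <= t1 -> K t <= K t1) -> 0 <= k.
Proof.
move=> t01 /lim_is_derive hK Kmax; rewrite leNgt; apply/negP => k0.
move/cvgrPdist_lt : hK => /(_ (- k)); rewrite oppr_gt0 => /(_ k0).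
rewrite near_withinE => /nbhs_ballP[e /= e0 he].
pose h := Num.min (e / 2) (t1 - t0).
have h0 : 0 < h by rewrite /h lt_min; apply/andP; split; lra.
have := he (- h); rewrite /ball /= sub0r !normrN gtr0_norm// oppr_eq0 (gt_eqF h0).
have hle : h <= e / 2 by rewrite /h ge_min lexx.
have hlt : h <= t1 - t0 by rewrite /h ge_min lexx orbT.
have he' : h < e by lra.
move=> /(_ he' isT); rewrite ltr_norml => /andP[+ _].
have : K (- h + t1) <= K t1 by apply: Kmax; apply/andP; split; lra.
rewrite invrN mulNr -mulrN; move=> Kle.
have : 0 <= h^-1 * - (K (- h + t1) - K t1).
  by rewrite mulr_ge0 ?invr_ge0 ?(ltW h0)//; lra.
lra.
Qed.

Context {d : nat}.
Implicit Types (f : 'rV[R]_d -> R) (x xi : 'rV[R]_d).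

(** A directional derivative gains one coordinate direction at a time: moving
along the new direction costs, by the mean value theorem, a value of its partial
derivative near [x], which continuity controls. *)
Lemma is_derive_add_basis f x xi (c : R) k :
  (forall x, derivable f x (basis_rV k)) -> continuous (pderiv k f) ->
  is_derive x xi f (dotp xi (grad f x)) ->
  is_derive x (xi + c *: basis_rV k) f (dotp (xi + c *: basis_rV k) (grad f x)).
Proof.
move=> dfk cfk dxi; apply: is_derive_of_line; apply: is_derive_lim.
rewrite dotpDl dotpZl dotp_basis mxE.
have : is_derive (0 *: xi + x) xi f (dotp xi (grad f x)).
  by rewrite scale0r add0r.
move=> /is_derive_line /lim_is_derive h1.
have -> : (fun h : R => h^-1 * (f ((h + 0) *: (xi + c *: basis_rV k) + x) -
      f (0 *: (xi + c *: basis_rV k) + x))) =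
    (fun h : R => h^-1 * (f ((h + 0) *: xi + x) - f (0 *: xi + x))) \+
    (fun h : R => h^-1 * (f ((h * c) *: basis_rV k + (h *: xi + x)) -
       f (h *: xi + x))).
  apply/funext => h /=; rewrite -mulrDr; congr (_ * _).
  rewrite !addr0 !scale0r add0r.
  have -> : h *: (xi + c *: basis_rV k) + x =
      (h * c) *: basis_rV k + (h *: xi + x).
    by rewrite scalerDr scalerA -addrA addrCA.
  by ring.
apply: cvgD => //; apply/cvgrPdist_le => e e0.
have c1 : 0 < `|c| + 1 by rewrite ltr_wpDl.
have e' : 0 < e / (`|c| + 1) by rewrite divr_gt0.
have /cvgrPdist_le /(_ _ e') /nbhs_ballP[rho /= rho0 hrho] := cfk x.
pose B := `|xi| + `|c| * `|basis_rV k : 'rV[R]_d| + 1.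
have B0 : 0 < B by rewrite /B ltr_wpDl// addr_ge0// mulr_ge0.
rewrite near_withinE; near=> h => h0.
have hB : `|h| < rho / B.
  near: h; apply/nbhs_ballP; exists (rho / B); first by rewrite /= divr_gt0.
  by move=> h; rewrite /ball /= sub0r normrN.
pose K (r : R) := f (r *: basis_rV k + (h *: xi + x)).
have hK r : is_derive (r : R) (1 : R) K (pderiv k f (r *: basis_rV k + (h *: xi + x))).
  by apply: is_derive_line; split => //; exact: dfk.
have key r : `|r| <= `|h * c| ->
    `|pderiv k f x - pderiv k f (r *: basis_rV k + (h *: xi + x))| <=
      e / (`|c| + 1).
  move=> rle; apply: hrho; rewrite -ball_normE /ball_ /=.
  rewrite (_ : x - _ = - (r *: basis_rV k + h *: xi)); last first.
    by rewrite addrA opprD addrCA subrr addr0.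
  rewrite normrN (le_lt_trans (ler_normD _ _))// !normrZ.
  rewrite ltr_pdivlMr// in hB; apply: le_lt_trans hB.
  rewrite /B 2!mulrDr mulr1 addrC -addrA lerD2l.
  apply: ler_wpDr => //; rewrite mulrA -normrM.
  exact: ler_wpM2r.
have MVTK a b : a <= b -> exists2 r, r \in `[a, b] & K b - K a =
    pderiv k f (r *: basis_rV k + (h *: xi + x)) * (b - a).
  move=> ab; apply: MVT_segment => //.
  by apply: derivable_within_continuous => y _; exact: ex_derive.
have [r rle E] : exists2 r, `|r| <= `|h * c| & K (h * c) - K 0 =
    pderiv k f (r *: basis_rV k + (h *: xi + x)) * (h * c).
  have [hc|hc] := leP 0 (h * c).
    have [r] := MVTK _ _ hc; rewrite in_itv/= subr0 => /andP[r0 r1] E.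
    by exists r => //; rewrite !ger0_norm.
  have [r] := MVTK _ _ (ltW hc); rewrite in_itv/= sub0r mulrN => /andP[r0 r1] E.
  exists r; last by rewrite -opprB E opprK.
  by rewrite !ler0_norm ?lerN2// ltW.
have -> : f (h *: xi + x) = K 0 by rewrite /K scale0r add0r.
rewrite -/(K (h * c)) E.
rewrite (_ : _ - _ = c * (pderiv k f x -
    pderiv k f (r *: basis_rV k + (h *: xi + x)))); last by field.
rewrite normrM (le_trans (ler_wpM2l (normr_ge0 c) (key _ rle)))//.
rewrite mulrA ler_pdivrMr// mulrC ler_wpM2l ?(ltW e0)//; lra.
Unshelve. all: by end_near.
Qed.

Lemma is_derive_C1 f x xi :
  (forall i x, derivable f x (basis_rV i)) ->
  (forall i, continuous (pderiv i f)) ->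
  is_derive x xi f (dotp xi (grad f x)).
Proof.
move=> df cf.
have -> : xi = \sum_i xi 0 i *: basis_rV i by exact: row_sum_delta.
elim: (index_enum _) => [|k s IH].
  by rewrite big_nil dotp0l; exact: is_derive0.
rewrite big_cons addrC; exact: is_derive_add_basis.
Qed.

Lemma is_derive_line_C1 f x xi r :
  (forall i x, derivable f x (basis_rV i)) ->
  (forall i, continuous (pderiv i f)) ->
  is_derive (r : R) (1 : R) (fun h : R => f (h *: xi + x)) (dotp xi (grad f (r *: xi + x))).
Proof. by move=> df cf; apply: is_derive_line; exact: is_derive_C1. Qed.

Lemma is_derive2_line_C2 f x xi :
  (forall i j x, derivable (pderiv j f) x (basis_rV i)) ->
  (forall i j, continuous (pderiv i (pderiv j f))) ->
  is_derive (0 : R) (1 : R) (fun h : R => dotp xi (grad f (h *: xi + x)))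
    (qform (hess f x) xi).
Proof.
move=> df cf.
have -> : (fun h : R => dotp xi (grad f (h *: xi + x))) =
    \sum_i (xi 0 i *: (fun h : R => pderiv i f (h *: xi + x))).
  by apply/funext => h; rewrite /dotp fct_sumE; apply: eq_bigr => i _; rewrite mxE.
have -> : qform (hess f x) xi =
    \sum_i (xi 0 i * dotp xi (grad (pderiv i f) (0 *: xi + x))).
  rewrite /qform exchange_big/=; apply: eq_bigr => i _.
  rewrite mulr_sumr; apply: eq_bigr => j _; rewrite !mxE scale0r add0r; ring.
apply: is_derive_sum => i.
by apply: is_deriveZ; exact: is_derive_line_C1.
Qed.

End calculus_lemmas.

(** * Second-order conditions for the doubled logarithmic functional *)

Section interior_maximum.
Context {R : realType}.

Lemma is_derive_ln_comp (F : R -> R) (r dF : R) : 0 < F r ->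
  is_derive r (1 : R) F dF ->
  is_derive r (1 : R) (fun h => ln (F h)) (dF / F r).
Proof.
move=> F0 hF; rewrite mulrC; apply: is_derive1_comp => //.
exact: is_derive1_ln.
Qed.

Lemma is_derive_log_derivative (F dF : R -> R) (r d2F : R) : 0 < F r ->
  is_derive r (1 : R) F (dF r) -> is_derive r (1 : R) dF d2F ->
  is_derive r (1 : R) (fun h => dF h / F h) (d2F / F r - (dF r / F r) ^+ 2).
Proof.
move=> F0 hF hdF.
have hV := is_deriveV (lt0r_neq0 F0) hF.
apply: (is_derive_eq (is_deriveM hdF hV)).
rewrite /GRing.scale /=; field; exact: lt0r_neq0.
Qed.

Context {d : nat}.
Implicit Types (U V : 'rV[R]_d -> R) (x y xi : 'rV[R]_d) (Q : 'M[R]_d).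

Lemma is_derive_sqnorm x xi r :
  is_derive r (1 : R) (fun h : R => dotp (h *: xi + x) (h *: xi + x))
    (2 * dotp xi (r *: xi + x)).
Proof.
apply/is_derive1_caratheodory.
exists (fun h => 2 * dotp xi (r *: xi + x) + dotp xi xi * (h - r)); split.
- by move=> h; rewrite !dotpDZ (dotpC x xi); ring.
- by apply: cvgD; [|apply: cvgM; [|apply: cvgB; [exact: cvg_id|]]]; exact: cvg_cst.
- by rewrite subrr mulr0 addr0.
Qed.

Lemma is_derive_dsqnorm x xi r :
  is_derive r (1 : R) (fun h : R => 2 * dotp xi (h *: xi + x))
    (2 * dotp xi xi).
Proof.
apply/is_derive1_caratheodory.
exists (fun=> 2 * dotp xi xi); split => //; last exact: cvg_cst.
by move=> h; rewrite !dotpDZ; ring.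
Qed.

(** It grows to infinity, so that penalized functions attain their maximum, while
its gradient is bounded and its product with a dissipative drift is bounded
above, so that a small multiple of it is harmless in the equation. *)
Definition penalty x : R := ln (1 + dotp x x).

Definition dpenalty x : 'rV[R]_d := (2 / (1 + dotp x x)) *: x.

Lemma one_sqnorm_gt0 x : 0 < 1 + dotp x x.
Proof. by rewrite ltr_wpDr// dotp_ge0. Qed.

Lemma penalty_factor_le2 x : 2 / (1 + dotp x x) <= 2.
Proof. by rewrite ler_pdivrMr ?one_sqnorm_gt0//; have := dotp_ge0 x; lra. Qed.

Lemma is_derive_penalty x xi r :
  is_derive r (1 : R) (fun h : R => penalty (h *: xi + x))
    (2 * dotp xi (r *: xi + x) / (1 + dotp (r *: xi + x) (r *: xi + x))).
Proof.
apply: is_derive_ln_comp; first exact: one_sqnorm_gt0.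
apply: is_derive_eq; last exact: add0r.
by apply: is_deriveD; exact: is_derive_sqnorm.
Qed.

Lemma is_derive2_penalty x xi :
  is_derive (0 : R) (1 : R) (fun h : R =>
     2 * dotp xi (h *: xi + x) / (1 + dotp (h *: xi + x) (h *: xi + x)))
    (2 * dotp xi xi / (1 + dotp x x) - dotp xi (dpenalty x) ^+ 2).
Proof.
have -> : dotp xi (dpenalty x) = 2 * dotp xi (0 *: xi + x) /
    (1 + dotp (0 *: xi + x) (0 *: xi + x)).
  by rewrite scale0r add0r dotpZr mulrAC.
rewrite -[x in 1 + dotp x _]add0r -[x in 1 + dotp _ x]add0r -(scale0r xi).
apply: (@is_derive_log_derivative
    (fun h => 1 + dotp (h *: xi + x) (h *: xi + x))
    (fun h => 2 * dotp xi (h *: xi + x))).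
- exact: one_sqnorm_gt0.
- apply: is_derive_eq; last exact: add0r.
  by apply: is_deriveD; exact: is_derive_sqnorm.
- exact: is_derive_dsqnorm.
Qed.

Lemma is_derive_ln_line U x xi r : C2 U -> (forall x, 0 < U x) ->
  is_derive r (1 : R) (fun h : R => ln (U (h *: xi + x)))
    (dotp xi (grad U (r *: xi + x)) / U (r *: xi + x)).
Proof.
move=> [_ dU cU _ _] U0; apply: is_derive_ln_comp => //.
exact: is_derive_line_C1.
Qed.

Lemma is_derive2_ln_line U x xi : C2 U -> (forall x, 0 < U x) ->
  is_derive (0 : R) (1 : R) (fun h : R =>
    dotp xi (grad U (h *: xi + x)) / U (h *: xi + x))
    (qform (hess U x) xi / U x - (dotp xi (grad U x) / U x) ^+ 2).
Proof.
move=> [_ dU cU ddU cdU] U0.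
have := @is_derive_log_derivative (fun h : R => U (h *: xi + x))
  (fun h : R => dotp xi (grad U (h *: xi + x))) 0 (qform (hess U x) xi).
rewrite !scale0r !add0r; apply => //.
  have := is_derive_line_C1 x xi 0 dU cU; by rewrite scale0r add0r.
exact: is_derive2_line_C2.
Qed.

Definition logsum (al be psi del : R) U V x y : R :=
  al * ln (U x) + be * ln (V y) - psi * dotp (x - y) (x - y) -
  del * (penalty x + penalty y).

(** The matrix is the Hessian of the functional along equal increments of both
variables; [P] and [S] stand for the logarithmic gradients. *)
Lemma logsum_hess_qform (A B : 'M[R]_d) (al be u v del n1 n2 : R) P S e1 e2 xi :
  qform (al *: (u^-1 *: A - P^T *m P) + be *: (v^-1 *: B - S^T *m S) -
    del *: (n1 *: 1%:M - e1^T *m e1) - del *: (n2 *: 1%:M - e2^T *m e2)) xi =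
  al * (qform A xi / u - dotp xi P ^+ 2) +
    be * (qform B xi / v - dotp xi S ^+ 2) -
    del * (n1 * dotp xi xi - dotp xi e1 ^+ 2) -
    del * (n2 * dotp xi xi - dotp xi e2 ^+ 2).
Proof.
rewrite !qformE !(bilDm, bilNm, bilZm) !bil_rank1 -!(dotpE xi).
by rewrite !(dotpC P) !(dotpC S) !(dotpC e1) !(dotpC e2) -!expr2 ![_^-1 * _]mulrC.
Qed.

Lemma logsum_hess_trace (A B Q : 'M[R]_d) (al be u v del n1 n2 : R) P S e1 e2 :
  \tr (Q *m (al *: (u^-1 *: A - P^T *m P) + be *: (v^-1 *: B - S^T *m S) -
    del *: (n1 *: 1%:M - e1^T *m e1) - del *: (n2 *: 1%:M - e2^T *m e2))) =
  al * (\tr (Q *m A) / u - qform Q P) + be * (\tr (Q *m B) / v - qform Q S) -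
    del * (n1 * \tr Q - qform Q e1) - del * (n2 * \tr Q - qform Q e2).
Proof.
have TR z : \tr (Q *m (z^T *m z)) = qform Q z.
  by rewrite mxtrace_mulC mxtrace_rank1.
rewrite !(mulmxDr, mulmxN) -!scalemxAr !(mulmxDr, mulmxN) -!scalemxAr mulmx1.
have trN (M : 'M[R]_d) : \tr (- M) = - \tr M.
  by rewrite -scaleN1r mxtraceZ mulN1r.
by rewrite !mxtraceD !trN !mxtraceZ !mxtraceD !trN !mxtraceZ !TR
  ![_^-1 * _]mulrC.
Qed.

Lemma hess_arith (al be del A B p s t n n' q q' : R) :
  al * (A - p) + be * (B - s) - del * (n * t - q) - del * (n' * t - q') <= 0 ->
  0 <= del * q -> 0 <= del * q' -> del * (n * t) <= del * (2 * t) ->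
  del * (n' * t) <= del * (2 * t) ->
  al * A + be * B <= al * p + be * s + del * (4 * t).
Proof. by lra. Qed.

Section at_maximum.
Variables (al be psi del : R) (U V : 'rV[R]_d -> R) (x0 y0 : 'rV[R]_d).
Hypotheses (U2 : C2 U) (V2 : C2 V).
Hypotheses (U0 : forall x, 0 < U x) (V0 : forall x, 0 < V x).
Hypothesis maxK : forall x y,
  logsum al be psi del U V x y <= logsum al be psi del U V x0 y0.

Lemma logsum_max_gradl :
  al *: ((U x0)^-1 *: grad U x0) =
  (2 * psi) *: (x0 - y0) + del *: dpenalty x0.
Proof.
suff h xi : al * (dotp xi (grad U x0) / U x0) - psi * (2 * dotp xi (x0 - y0)) -
    del * (2 * dotp xi x0 / (1 + dotp x0 x0)) = 0.
  apply/rowP => i; have := h (basis_rV i); rewrite !dotp_basis !mxE => hi.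
  by apply/eqP; rewrite -subr_eq0 -[X in _ == X]hi; apply/eqP; ring.
pose K (r : R) := al * ln (U (r *: xi + x0)) -
  psi * dotp (r *: xi + (x0 - y0)) (r *: xi + (x0 - y0)) -
  del * penalty (r *: xi + x0).
have dK r : is_derive r (1 : R) K
   (al * (dotp xi (grad U (r *: xi + x0)) / U (r *: xi + x0)) -
   psi * (2 * dotp xi (r *: xi + (x0 - y0))) -
   del * (2 * dotp xi (r *: xi + x0) /
     (1 + dotp (r *: xi + x0) (r *: xi + x0)))).
  apply: is_deriveB; last by apply: is_deriveZ; exact: is_derive_penalty.
  apply: is_deriveB; last by apply: is_deriveZ; exact: is_derive_sqnorm.
  by apply: is_deriveZ; exact: is_derive_ln_line.
have := first_derivative_max dK; rewrite !scale0r !add0r; apply => r.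
have := maxK (r *: xi + x0) y0; rewrite /logsum /K scale0r !add0r addrA; lra.
Qed.

Lemma logsum_max_gradr :
  be *: ((V y0)^-1 *: grad V y0) =
  - ((2 * psi) *: (x0 - y0)) + del *: dpenalty y0.
Proof.
suff h xi : be * (dotp xi (grad V y0) / V y0) - psi * (2 * dotp xi (y0 - x0)) -
    del * (2 * dotp xi y0 / (1 + dotp y0 y0)) = 0.
  apply/rowP => i; have := h (basis_rV i); rewrite !dotp_basis !mxE => hi.
  by apply/eqP; rewrite -subr_eq0 -[X in _ == X]hi; apply/eqP; ring.
pose K (r : R) := be * ln (V (r *: xi + y0)) -
  psi * dotp (r *: xi + (y0 - x0)) (r *: xi + (y0 - x0)) -
  del * penalty (r *: xi + y0).
have dK r : is_derive r (1 : R) K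
   (be * (dotp xi (grad V (r *: xi + y0)) / V (r *: xi + y0)) -
   psi * (2 * dotp xi (r *: xi + (y0 - x0))) -
   del * (2 * dotp xi (r *: xi + y0) /
     (1 + dotp (r *: xi + y0) (r *: xi + y0)))).
  apply: is_deriveB; last by apply: is_deriveZ; exact: is_derive_penalty.
  apply: is_deriveB; last by apply: is_deriveZ; exact: is_derive_sqnorm.
  by apply: is_deriveZ; exact: is_derive_ln_line.
have := first_derivative_max dK; rewrite !scale0r !add0r; apply => r.
have N x y : dotp (x - y) (x - y) = dotp (y - x) (y - x).
  by rewrite -opprB dotpNl dotpNr opprK.
have := maxK x0 (r *: xi + y0); rewrite /logsum /K scale0r !add0r addrA.
rewrite (N x0) (N x0 y0); lra.
Qed.

(** The increments of both variables are the same vector [xi]: along this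
diagonal the term in [x - y] is constant, so its second derivative vanishes. *)
Lemma logsum_max_hess Q : Q^T = Q -> (forall xi, 0 <= qform Q xi) ->
  0 <= del ->
  al * (\tr (Q *m hess U x0) / U x0) + be * (\tr (Q *m hess V y0) / V y0) <=
  al * qform Q ((U x0)^-1 *: grad U x0) + be * qform Q ((V y0)^-1 *: grad V y0)
  + del * (4 * \tr Q).
Proof.
move=> sQ Q0 del0.
pose P := (U x0)^-1 *: grad U x0; pose S := (V y0)^-1 *: grad V y0.
pose e1 := dpenalty x0; pose e2 := dpenalty y0.
pose n1 := 2 / (1 + dotp x0 x0); pose n2 := 2 / (1 + dotp y0 y0).
pose H : 'M[R]_d := al *: ((U x0)^-1 *: hess U x0 - P^T *m P) +
  be *: ((V y0)^-1 *: hess V y0 - S^T *m S) -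
  del *: (n1 *: 1%:M - e1^T *m e1) - del *: (n2 *: 1%:M - e2^T *m e2).
have QH : \tr (Q *m H) <= 0.
  apply: mxtrace_psd_nsd => // xi.
  pose K (r : R) := al * ln (U (r *: xi + x0)) + be * ln (V (r *: xi + y0)) -
    del * penalty (r *: xi + x0) - del * penalty (r *: xi + y0).
  pose L U x (r : R) := dotp xi (grad U (r *: xi + x)) / U (r *: xi + x).
  pose M x (r : R) := 2 * dotp xi (r *: xi + x) /
     (1 + dotp (r *: xi + x) (r *: xi + x)).
  pose dK (r : R) := al * L U x0 r + be * L V y0 r - del * M x0 r - del * M y0 r.
  have hK r : is_derive r (1 : R) K (dK r).
    apply: is_deriveB; last by apply: is_deriveZ; exact: is_derive_penalty.
    apply: is_deriveB; last by apply: is_deriveZ; exact: is_derive_penalty.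
    by apply: is_deriveD; apply: is_deriveZ; exact: is_derive_ln_line.
  have hdK : is_derive (0 : R) (1 : R) dK (
     al * (qform (hess U x0) xi / U x0 - (dotp xi (grad U x0) / U x0) ^+ 2) +
     be * (qform (hess V y0) xi / V y0 - (dotp xi (grad V y0) / V y0) ^+ 2) -
     del * (2 * dotp xi xi / (1 + dotp x0 x0) - dotp xi (dpenalty x0) ^+ 2) -
     del * (2 * dotp xi xi / (1 + dotp y0 y0) - dotp xi (dpenalty y0) ^+ 2)).
    apply: is_deriveB; last by apply: is_deriveZ; exact: is_derive2_penalty.
    apply: is_deriveB; last by apply: is_deriveZ; exact: is_derive2_penalty.
    by apply: is_deriveD; apply: is_deriveZ; exact: is_derive2_ln_line.
  have Kmax r : K r <= K 0.
    have := maxK (r *: xi + x0) (r *: xi + y0).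
    rewrite /logsum /K !scale0r !add0r.
    by rewrite opprD addrACA subrr add0r; lra.
  have := second_derivative_max hK hdK Kmax.
  have EP : dotp xi P = dotp xi (grad U x0) / U x0 by rewrite dotpZr mulrC.
  have ES : dotp xi S = dotp xi (grad V y0) / V y0 by rewrite dotpZr mulrC.
  by rewrite /H logsum_hess_qform EP ES /n1 /n2 ![2 / _ * _]mulrAC.
rewrite /H logsum_hess_trace in QH.
have q1 := mulr_ge0 del0 (Q0 e1); have q2 := mulr_ge0 del0 (Q0 e2).
(* The Hessians of the penalties contribute at most their leading parts, whose
   factors are at most [2]. *)
have trQ : 0 <= \tr Q.
  apply: sumr_ge0 => i _; have := Q0 (basis_rV i).
  rewrite qformE /bil /basis_rV -rowE mxE (bigD1 i)//= big1 => [|m ml];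
    rewrite !mxE ?eqxx ?mulr1 ?addr0//.
  by rewrite (negbTE ml) andbF mulr0.
have h1 : del * (n1 * \tr Q) <= del * (2 * \tr Q).
  by rewrite ler_wpM2l// ler_wpM2r// penalty_factor_le2.
have h2 : del * (n2 * \tr Q) <= del * (2 * \tr Q).
  by rewrite ler_wpM2l// ler_wpM2r// penalty_factor_le2.
exact: (hess_arith QH q1 q2 h1 h2).
Qed.

End at_maximum.

End interior_maximum.

(** * Continuity, monotonicity of the drift *)

Section continuity_on_rV.
Context {R : realType} {d : nat}.
Implicit Types (x y : 'rV[R]_d).

Lemma dotp_continuous (T : topologicalType) (f h : T -> 'rV[R]_d) (F : set_system T)
    {FF : Filter F} (a c : 'rV[R]_d) :
  f @ F --> a -> h @ F --> c -> (fun z : T => dotp (f z) (h z)) @ F --> dotp a c.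
Proof.
move=> fa hc; rewrite /dotp.
have -> : (fun z : T => \sum_i f z 0 i * h z 0 i) =
    \sum_i (fun z : T => f z 0 i * h z 0 i).
  by apply/funext => z; rewrite fct_sumE.
elim/big_rec2 : _ => [|i y1 y2 _ IH]; first exact: cvg_cst.
apply: cvgD => //; apply: cvgM.
  exact: (cvg_comp _ _ fa (@coord_continuous _ _ _ 0 i a)).
exact: (cvg_comp _ _ hc (@coord_continuous _ _ _ 0 i c)).
Qed.

Lemma sqnorm_continuous : continuous (fun x => dotp x x).
Proof.
move=> x; have h : (fun y : 'rV[R]_d => y) @ nbhs x --> x by exact: cvg_id.
exact: (dotp_continuous h h).
Qed.

Lemma penalty_continuous : continuous (@penalty R d).
Proof.
move=> x; have h : (fun y => 1 + dotp y y) @ nbhs x --> 1 + dotp x x.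
  by apply: cvgD; [exact: cvg_cst|exact: sqnorm_continuous].
exact: (cvg_comp _ _ h (continuous_ln (one_sqnorm_gt0 x))).
Qed.

Lemma enorm_continuous : continuous (@enorm R d).
Proof.
have -> : @enorm R d = Num.sqrt \o (fun x => dotp x x) by [].
move=> x; apply: continuous_comp; first exact: sqnorm_continuous.
exact: sqrt_continuous.
Qed.

Lemma penalty_ge0 x : 0 <= penalty x.
Proof. by rewrite ln_ge0// lerDl dotp_ge0. Qed.

Definition box (M : R) : set 'rV[R]_d :=
  [set v : 'rV[R]_d | forall i, v ord0 i \in `[- M, M]].

Lemma box_compact M : compact (box M).
Proof.
by apply: (@rV_compact R d (fun=> `[- M, M]%classic)) => i; exact: segment_compact.
Qed.

Lemma box0 M : 0 <= M -> box M 0.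
Proof. by move=> M0 i; rewrite mxE in_itv/= M0 oppr_le0 M0. Qed.

(** [1 + |x|^2] exceeds the square of every coordinate, so one coordinate above
[expR B] suffices. *)
Lemma penalty_ge (B : R) x : 0 <= B -> ~ box (expR B) x -> B <= penalty x.
Proof.
move=> B0 /existsNP[i] /negP; rewrite in_itv/= -ler_norml -ltNge => hi.
rewrite -(expRK B) /penalty ler_ln ?posrE ?expR_gt0 ?one_sqnorm_gt0//.
have h1 : 1 <= expR B by rewrite -(expR0 R) ler_expR.
have := coord_le_dotp x i; rewrite -real_normK ?num_real//.
move: hi h1; set a := `|_|; move=> *; nra.
Qed.

Lemma parabolic_holder_continuous (theta : R) (J : set R) (w : R -> 'rV[R]_d -> R) t :
  0 < theta -> J t -> parabolic_holder_loc theta J w -> continuous (w t).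
Proof.
move=> th0 Jt hw x.
have sub : `[t, t]%classic `<=` J.
  by move=> r /=; rewrite in_itv/= andbC -eq_le => /eqP ->.
have [C hC] := hw t t (enorm x + 1) sub.
suff : w t @ nbhs (x : 'rV[R]_d) --> w t x by [].
apply/cvgrPdist_le => e e0.
have c1 : 0 < `|C| + 1 by rewrite ltr_wpDl.
pose rho := Num.min 1 ((e / (`|C| + 1)) `^ theta^-1).
have rho0 : 0 < rho by rewrite lt_min ltr01 powR_gt0// divr_gt0.
have /cvgrPdist_lt /(_ _ rho0) : (fun y => enorm (x - y)) @ nbhs (x : 'rV[R]_d) --> enorm (x - x).
  have hs : (fun y => x - y) @ nbhs (x : 'rV[R]_d) --> x - x.
    by apply: cvgB; [exact: cvg_cst|exact: cvg_id].
  exact: (cvg_comp _ _ hs (@enorm_continuous _)).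
rewrite subrr (_ : enorm 0 = 0); last by rewrite /enorm dotp0l sqrtr0.
apply: filterS => y; rewrite sub0r normrN ger0_norm ?enorm_ge0// => hy.
have tt : t \in `[t, t] by rewrite in_itv/= lexx.
have xr : enorm x <= enorm x + 1 by rewrite lerDl.
have yr : enorm y <= enorm x + 1.
  rewrite (_ : y = x + - (x - y)); last by rewrite opprB addrC subrK.
  rewrite (le_trans (enormD _ _))// enormN lerD2l.
  by rewrite (le_trans (ltW hy))// ge_min lexx.
have := hC t t x y tt tt xr yr.
rewrite subrr normr0 powR0 ?add0r; last by rewrite mulf_neq0 ?invr_neq0// gt_eqF.
move=> h; apply: (le_trans h).
have h2 : enorm (x - y) `^ theta <= e / (`|C| + 1).
  have -> : e / (`|C| + 1) = ((e / (`|C| + 1)) `^ theta^-1) `^ theta.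
    by rewrite -powRrM mulVf ?lt0r_neq0// powRr1 ?divr_ge0 ?(ltW e0).
  rewrite ge0_ler_powR ?nnegrE ?powR_ge0 ?enorm_ge0 ?(ltW th0)//.
  by rewrite (le_trans (ltW hy))// ge_min lexx orbT.
rewrite (le_trans (ler_wpM2r (powR_ge0 _ _) (ler_norm C)))//.
rewrite (le_trans (ler_wpM2l (normr_ge0 C) h2))//.
by rewrite mulrA ler_pdivrMr// mulrC ler_wpM2l ?(ltW e0)// lerDl.
Qed.

End continuity_on_rV.

Section coefficients.
Context {R : realType} {d : nat}.
Variables (I : set R) (theta : R) (Q : R -> 'M[R]_d) (b : R -> 'rV[R]_d -> 'rV[R]_d).
Hypothesis theta0 : 0 < theta.
Hypothesis I_up : forall s t, I s -> s <= t -> I t.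
Hypothesis bdis : dissipative_drift I theta b.
Hypothesis hcoef : holder_coefficients I theta Q b.

(** The mean value theorem along the segment from [y] to [x] reduces
monotonicity to the sign of the Jacobian. *)
Lemma drift_monotone t x y : I t -> dotp (b t x - b t y) (x - y) <= 0.
Proof.
move=> It; case: bdis => db cb [r0 [r00 hr0]].
pose xi := x - y.
pose K (r : R) := dotp (b t (r *: xi + y)) xi.
have hK r : is_derive (r : R) (1 : R) K
    (qform (jacobian_drift b t (r *: xi + y)) xi).
  have -> : K = \sum_i (xi 0 i *: (fun r : R => b t (r *: xi + y) 0 i)).
    apply/funext => h; rewrite /K /dotp fct_sumE; apply: eq_bigr => i _.
    by rewrite mulrC.
  have -> : qform (jacobian_drift b t (r *: xi + y)) xi =
      \sum_i (xi 0 i * dotp xi (grad (fun y => b t y 0 i) (r *: xi + y))).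
    apply: eq_bigr => i _; rewrite mulr_sumr; apply: eq_bigr => j _.
    by rewrite !mxE mulrC [pderiv _ _ _ * _]mulrC.
  apply: is_derive_sum => i; apply: is_deriveZ.
  apply: is_derive_line_C1 => [j z|j]; first exact: db.
  have -> : pderiv j (fun y => b t y 0 i) = (fun x => jacobian_drift b t x i j).
    by apply/funext => z; rewrite mxE.
  exact: (parabolic_holder_continuous theta0 It (cb i j)).
have [|c _] := @MVT_segment _ K _ 0 1 ler01 (fun x _ => hK x).
  by apply: derivable_within_continuous => z _; exact: ex_derive.
rewrite subr0 mulr1 /K scale1r scale0r add0r subrK -dotpBl => ->.
rewrite (le_trans (hr0 _ _ _ It))// mulr_le0_ge0 ?sqr_ge0//; exact: ltW.
Qed.

Lemma drift0_bound s T : I s -> exists B : R, 0 <= B /\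
  forall t, s <= t <= T -> dotp (b t 0) (b t 0) <= B.
Proof.
move=> Is; case: hcoef => _ hb.
have sub : `[s, T]%classic `<=` I.
  by move=> r /=; rewrite in_itv/= => /andP[sr _]; exact: I_up sr.
have /choice[C hC] i := hb i s T 0 sub.
pose D i := (`|b s 0 0 i| + `|C i| * (T - s) `^ (theta / 2)) ^+ 2.
exists (\sum_i D i); split; first by apply: sumr_ge0 => i _; exact: sqr_ge0.
move=> t /andP[st tT]; apply: ler_sum => i _; rewrite -expr2 /D.
rewrite -real_normK ?num_real// lerXn2r ?nnegrE ?addr_ge0 ?mulr_ge0 ?powR_ge0//.
have e0 : enorm (0 : 'rV[R]_d) = 0 by rewrite /enorm dotp0l sqrtr0.
have := hC i s t 0 0; rewrite !in_itv/= !lexx st tT (le_trans st tT) e0 lexx.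
move=> /(_ isT isT isT isT); rewrite subrr e0 (powR0 (lt0r_neq0 theta0)) addr0.
move=> h; rewrite -[b t 0 0 i](subKr (b s 0 0 i)).
rewrite (le_trans (ler_normB _ _))// lerD2l (le_trans h)//.
rewrite (le_trans (ler_wpM2r (powR_ge0 _ _) (ler_norm _)))// ler_wpM2l//.
rewrite ge0_ler_powR ?nnegrE ?divr_ge0 ?(ltW theta0) ?subr_ge0 ?(le_trans st tT)//.
by rewrite distrC ger0_norm ?subr_ge0// lerB.
Qed.

End coefficients.

(** * No interior maximum of the doubled functional *)

Section comparison.
Context {R : realType} {d : nat}.
Variables (I : set R) (theta : R) (Q : R -> 'M[R]_d) (b : R -> 'rV[R]_d -> 'rV[R]_d).
Hypothesis theta0 : 0 < theta.
Hypothesis I_up : forall s t, I s -> s <= t -> I t.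
Hypothesis bdis : dissipative_drift I theta b.
Hypothesis hcoef : holder_coefficients I theta Q b.
Hypothesis Qell : uniformly_elliptic I Q.

Lemma jointly_continuous_slice (J : set R) (u : R -> 'rV[R]_d -> R) t :
  J t -> jointly_continuous J u -> continuous (u t).
Proof.
move=> Jt cu x; have h : (fun y : 'rV[R]_d => (t, y)) @ nbhs x --> (t, x).
  exact: (cvg_pair (cvg_cst t) cvg_id).
exact: (cvg_comp _ _ h (cu (t, x) Jt)).
Qed.

Lemma C12_slice (J : set R) (u : R -> 'rV[R]_d -> R) t :
  J t -> C12 J u -> C2 (u t).
Proof.
move=> Jt [dU cu _ cDu cDDu]; split.
- exact: jointly_continuous_slice cu.
- by move=> i x; have [_ + _] := dU t x Jt; exact.
- by move=> i; exact: (jointly_continuous_slice Jt (cDu i)).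
- by move=> i j x; have [_ _] := dU t x Jt; exact.
- by move=> i j; exact: (jointly_continuous_slice Jt (cDDu i j)).
Qed.

(** Young's inequality for the cross term, with a weight [kap] that leaves an
arbitrarily small multiple of [qform A z]. It bounds [a] times the form from
above for [a] of either sign. *)
Lemma qform_addZ_le (A : 'M[R]_d) (z e : 'rV[R]_d) (a del kap : R) :
  A^T = A -> (forall x, 0 <= qform A x) -> 0 < kap ->
  a * qform A (z + del *: e) <=
  a * qform A z + `|a| * (kap * qform A z + del ^+ 2 * ((1 + kap^-1) * qform A e)).
Proof.
move=> sA A0 kap0.
have E : qform A (z + del *: e) =
    qform A z + (2 * del * bil A z e + del ^+ 2 * qform A e).
  by rewrite !qformE !(bilDl, bilDr, bilZl, bilZr) (bil_trC e z sA); ring.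
have hp (c : R) : 0 <= kap * qform A z + c * (2 * del * bil A z e) +
    c ^+ 2 * (del ^+ 2 / kap * qform A e).
  have := mulr_ge0 (ltW kap0) (A0 (z + (c * del / kap) *: e)).
  rewrite !qformE !(bilDl, bilDr, bilZl, bilZr) (bil_trC e z sA).
  by move=> h; apply: (le_trans h); rewrite le_eqVlt; apply/orP; left;
    apply/eqP; field; exact: lt0r_neq0.
have h1 := hp 1; have h2 := hp (-1); have qe := mulr_ge0 (sqr_ge0 del) (A0 e).
rewrite E mulrDr lerD2l.
rewrite (le_trans (ler_norm _))// normrM ler_wpM2l// ler_norml.
have -> : del ^+ 2 * ((1 + kap^-1) * qform A e) =
   del ^+ 2 * qform A e + del ^+ 2 / kap * qform A e by ring.
move: h1 h2 qe; rewrite mul1r expr1n mul1r sqrrN expr1n mul1r mulN1r => *.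
by apply/andP; split; lra.
Qed.

Lemma mxtrace_le_elliptic (A : 'M[R]_d) (Lam : R) :
  (forall xi, qform A xi <= Lam * dotp xi xi) -> \tr A <= d%:R * Lam.
Proof.
move=> hA; rewrite mulr_natl -[X in _ *+ X]card_ord -sumr_const.
apply: ler_sum => i _; have := hA (basis_rV i).
rewrite dotp_basis mxE !eqxx mulr1 qformE /bil /basis_rV -rowE mxE.
rewrite (bigD1 i)//= big1 => [|m ml]; rewrite !mxE ?eqxx ?mulr1 ?addr0//.
by rewrite (negbTE ml) andbF mulr0.
Qed.

Lemma dpenalty_sqnorm_le1 (x : 'rV[R]_d) : dotp (dpenalty x) (dpenalty x) <= 1.
Proof.
rewrite /dpenalty dotpZl dotpZr mulrA -expr2 expr_div_n mulrAC.
have := one_sqnorm_gt0 x; have := dotp_ge0 x; move: (dotp x x) => n n0 n1.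
rewrite ler_pdivrMr ?exprn_gt0// mul1r; have := sqr_ge0 (1 - n); lra.
Qed.

(** Dissipativity bounds the radial part of the drift by its value at the origin. *)
Lemma drift_dpenalty_le t (x : 'rV[R]_d) (B : R) : I t ->
  dotp (b t 0) (b t 0) <= B -> 0 <= B -> dotp (b t x) (dpenalty x) <= B + 1.
Proof.
move=> It hB B0; rewrite /dpenalty dotpZr mulrAC.
rewrite ler_pdivrMr ?one_sqnorm_gt0//.
have := drift_monotone theta0 bdis x 0 It; rewrite subr0 dotpBl => h1.
have := dotp_ge0 (b t 0 - x); rewrite !dotpDZ (dotpC x (b t 0)) => h2.
have := dotp_ge0 x; move: hB h1 h2.
move: (dotp (b t x) x) (dotp (b t 0) x) (dotp (b t 0) (b t 0)) (dotp x x).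
by move=> p q r n ? ? ? ?; nra.
Qed.

(** The doubled functional less the bound to be proved for it, in which the term
[del C (t - s)] pays for the penalty. *)
Definition comparison_fun (u v : R -> 'rV[R]_d -> R) (al be c0 c1 del C m s : R)
    (t : R) (x y : 'rV[R]_d) : R :=
  logsum al be (c0 + c1 * (t - s))^-1 del (u t) (v t) x y -
  (del * C * (t - s) + m).

(** The bookkeeping at the maximum. Up to terms of size [del], the trace terms are
at most the quadratic form of [z = 2 psi (x - y)], which the derivative of the
coefficient [psi] compensates with the margin [4 sg X], where
[X = psi^2 |x - y|^2]; all terms of size [del] are below [del C]. *)
Lemma comparison_arith (tU tV pU pV bxz byz bx1 by2 c1 X del C trQ ia ib qz kap
    q1 q2 Lam dn B sg : R) :
  0 <= tU + (bxz + del * bx1) + (tV + (- byz + del * by2)) + c1 * X - del * C ->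
  tU + tV <= pU + pV + del * (4 * trQ) ->
  pU <= ia * qz + `|ia| * (kap * qz + del ^+ 2 * ((1 + kap^-1) * q1)) ->
  pV <= ib * qz + `|ib| * (kap * qz + del ^+ 2 * ((1 + kap^-1) * q2)) ->
  q1 <= Lam -> q2 <= Lam -> trQ <= dn -> bx1 <= B + 1 -> by2 <= B + 1 ->
  bxz - byz <= 0 -> (ia + ib) * qz <= - (c1 + 4 * sg) * X ->
  (`|ia| + `|ib|) * kap * qz <= 4 * sg * X ->
  (`|ia| + `|ib|) * (1 + kap^-1) * Lam + 4 * dn + 2 * (B + 1) < C ->
  0 < del -> del <= 1 -> 0 < kap -> 0 <= Lam -> False.
Proof.
move=> hdt hh hpU hpV hq1 hq2 htr hb1 hb2 hbz hz hk hC del0 del1 kap0 Lam0.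
have K0 : 0 <= 1 + kap^-1 by rewrite addr_ge0// invr_ge0 ltW.
have d2 : del ^+ 2 <= del by rewrite expr2 ger_pMl.
have sq q : q <= Lam -> del ^+ 2 * ((1 + kap^-1) * q) <= del * ((1 + kap^-1) * Lam).
  move=> qL; rewrite (@le_trans _ _ (del ^+ 2 * ((1 + kap^-1) * Lam)))//.
    by rewrite ler_wpM2l ?sqr_ge0// ler_wpM2l.
  by rewrite ler_wpM2r// mulr_ge0.
have s1 := ler_wpM2l (normr_ge0 ia) (sq _ hq1).
have s2 := ler_wpM2l (normr_ge0 ib) (sq _ hq2).
have s3 := ler_wpM2l (ltW del0) htr.
have s4 := ler_wpM2l (ltW del0) hb1; have s5 := ler_wpM2l (ltW del0) hb2.
have s6 : del * ((`|ia| + `|ib|) * (1 + kap^-1) * Lam + 4 * dn + 2 * (B + 1)) <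
  del * C by rewrite ltr_pM2l.
clear sq d2 K0 hq1 hq2 htr hb1 hb2 hC del1 kap0 Lam0.
move: s1 s2 s3 s4 s5 s6 hdt hh hpU hpV hbz hz hk.
move: `|ia| `|ib| => n1 n2.
rewrite !mulrDr !mulrDl.
move: (del ^+ 2 * (1 * q1 + _)) => *.
lra.
Qed.

(** The contradiction at an interior maximum: there the time derivative is
nonnegative, whereas the equations, the first-order conditions and the
second-order condition along the diagonal make it negative once [C] is large.
The bound on [C] does not involve [c0], [m], nor the solutions. *)
Lemma comparison_no_interior_max s T (al be c1 sg Lam B C : R)
    (u v : R -> 'rV[R]_d -> R) (f h : 'rV[R]_d -> R) (c0 del m t0 : R)
    (x0 y0 : 'rV[R]_d) :
  I s -> al != 0 -> be != 0 -> 0 < sg -> 0 < Lam -> 0 <= B ->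
  (forall t x, I t -> 0 <= qform (Q t) x <= Lam * dotp x x) ->
  (forall t, s <= t <= T -> dotp (b t 0) (b t 0) <= B) ->
  (forall t w, I t ->
     (al^-1 + be^-1) * (4 * qform (Q t) w) <= - (c1 + 4 * sg) * dotp w w) ->
  let A := `|al^-1| + `|be^-1| in
  A * (1 + (sg / (Lam * A))^-1) * Lam + 4 * (d%:R * Lam) + 2 * (B + 1) < C ->
  bounded_classical_solution Q b s f u -> bounded_classical_solution Q b s h v ->
  (forall t x, s <= t -> 0 < u t x) -> (forall t x, s <= t -> 0 < v t x) ->
  0 < c0 + c1 * (t0 - s) -> 0 < del <= 1 -> s < t0 <= T ->
  (forall t x y, s <= t <= T ->
     comparison_fun u v al be c0 c1 del C m s t x y <=
     comparison_fun u v al be c0 c1 del C m s t0 x0 y0) -> False.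
Proof.
move=> Is al0 be0 sg0 Lam0 B0 hQ hB hab A hC hu hv u0 v0 cc0 /andP[del0 del1].
move=> /andP[st0 t0T] hmax.
have It0 : I t0 by exact: I_up Is (ltW st0).
case: hu => _ _ C12u equ _; case: hv => _ _ C12v eqv _.
have Jt0 : `]s, +oo[%classic t0 by rewrite /= in_itv/= st0.
have U2 := C12_slice Jt0 C12u; have V2 := C12_slice Jt0 C12v.
have U0 x : 0 < u t0 x by exact: u0 (ltW st0).
have V0 x : 0 < v t0 x by exact: v0 (ltW st0).
pose psi := (c0 + c1 * (t0 - s))^-1.
have maxK x y : logsum al be psi del (u t0) (v t0) x y <=
    logsum al be psi del (u t0) (v t0) x0 y0.
  have := hmax t0 x y; rewrite (ltW st0) t0T => /(_ isT).
  by rewrite /comparison_fun lerD2r.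
have gl := logsum_max_gradl U2 U0 maxK.
have gr := logsum_max_gradr V2 V0 maxK.
have [sQ _] := Qell.
have Q0 xi : 0 <= qform (Q t0) xi by case/andP: (hQ t0 xi It0).
have QL xi : qform (Q t0) xi <= Lam * dotp xi xi by case/andP: (hQ t0 xi It0).
have hh := logsum_max_hess U2 V2 U0 V0 maxK (sQ t0 It0) Q0 (ltW del0).
pose w := x0 - y0.
have dt : 0 <= al * (generator Q b t0 (u t0) x0 / u t0 x0) +
    be * (generator Q b t0 (v t0) y0 / v t0 y0) +
    c1 * psi ^+ 2 * dotp w w - del * C.
  pose K t := comparison_fun u v al be c0 c1 del C m s t x0 y0.
  suff : is_derive t0 (1 : R) K (al * (generator Q b t0 (u t0) x0 / u t0 x0) +
      be * (generator Q b t0 (v t0) y0 / v t0 y0) +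
      c1 * psi ^+ 2 * dotp w w - del * C).
    move=> KD; apply: (derive_left_max st0 KD).
    by move=> t /andP[st tt]; apply: hmax; rewrite st (le_trans tt).
  have Du : is_derive t0 (1 : R) (fun t => u t x0) (generator Q b t0 (u t0) x0).
    by rewrite -(equ _ _ st0) derive1E; apply: derivableP; case: C12u => h1 _ _ _ _;
      case: (h1 t0 x0 Jt0).
  have Dv : is_derive t0 (1 : R) (fun t => v t y0) (generator Q b t0 (v t0) y0).
    by rewrite -(eqv _ _ st0) derive1E; apply: derivableP; case: C12v => h1 _ _ _ _;
      case: (h1 t0 y0 Jt0).
  have Dp : is_derive t0 (1 : R) (fun t => c0 + c1 * (t - s)) c1.
    apply/is_derive1_caratheodory; exists (fun=> c1); split => //.
      by move=> z; ring.
    exact: cvg_cst.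
  have Dl : is_derive t0 (1 : R)
      (fun t => - del * (penalty x0 + penalty y0) - (del * C * (t - s) + m)) (- (del * C)).
    apply/is_derive1_caratheodory; exists (fun=> - (del * C)); split => //.
      by move=> z; ring.
    exact: cvg_cst.
  have -> : K = (al *: (fun t => ln (u t x0)) + be *: (fun t => ln (v t y0)) -
      dotp w w *: (fun t => (c0 + c1 * (t - s))^-1)) +
      (fun t => - del * (penalty x0 + penalty y0) - (del * C * (t - s) + m)).
    apply/funext => t; rewrite /K /comparison_fun /logsum !fctE /GRing.scale/=.
    by rewrite -/w; ring.
  have cn0 := lt0r_neq0 cc0.
  have D := is_deriveD (is_deriveB (is_deriveD
     (is_deriveZ al (is_derive_ln_comp (U0 x0) Du))
     (is_deriveZ be (is_derive_ln_comp (V0 y0) Dv)))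
     (is_deriveZ (dotp w w) (@is_deriveV _ (fun t => c0 + c1 * (t - s)) t0 c1 1 cn0 Dp))) Dl.
  apply: (is_derive_eq D); rewrite /GRing.scale/= /psi; field.
  by rewrite cn0 (lt0r_neq0 (U0 x0)) (lt0r_neq0 (V0 y0)).
pose P := (u t0 x0)^-1 *: grad (u t0) x0.
pose S := (v t0 y0)^-1 *: grad (v t0) y0.
pose z := (2 * psi) *: w; pose e1 := dpenalty x0; pose e2 := dpenalty y0.
have gen (U : 'rV[R]_d -> R) x : generator Q b t0 U x / U x =
    \tr (Q t0 *m hess U x) / U x + dotp (b t0 x) ((U x)^-1 *: grad U x).
  by rewrite /generator mulrDl dotpZr; congr (_ + _); exact: mulrC.
move: dt; rewrite !gen -/P -/S !mulrDr -(dotpZr al) -(dotpZr be).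
rewrite -/P in gl; rewrite -/S in gr; rewrite gl gr -/w -/z -/e1 -/e2 => dt.
move: hh; rewrite -/P -/S => hh; clearbody P S.
have qP : al * qform (Q t0) P = al^-1 * qform (Q t0) (z + del *: e1).
  by rewrite -gl !qformE bilZl bilZr mulKf.
have qS : be * qform (Q t0) S = be^-1 * qform (Q t0) (- z + del *: e2).
  by rewrite -gr !qformE bilZl bilZr mulKf.
have A0 : 0 < A by rewrite /A ltr_wpDr// normr_gt0 invr_eq0.
(* With this weight the remainder in Young's inequality is within
   the margin [4 sg psi^2 |w|^2]. *)
pose kap := sg / (Lam * A).
have kap0 : 0 < kap by rewrite divr_gt0 ?mulr_gt0.
have qE1 := qform_addZ_le z e1 al^-1 del (sQ t0 It0) Q0 kap0.
have qE2 := qform_addZ_le (- z) e2 be^-1 del (sQ t0 It0) Q0 kap0.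
have qN : qform (Q t0) (- z) = qform (Q t0) z.
  by rewrite !qformE -scaleN1r bilZl bilZr !mulN1r opprK.
rewrite qN in qE2.
have qe x : qform (Q t0) (dpenalty x) <= Lam.
  rewrite (le_trans (QL _))// -[leRHS]mulr1 ler_wpM2l ?(ltW Lam0)//.
  exact: dpenalty_sqnorm_le1.
have trQ := mxtrace_le_elliptic QL.
have st0T : s <= t0 <= T by rewrite ltW.
have b1 := drift_dpenalty_le x0 It0 (hB _ st0T) B0.
have b2 := drift_dpenalty_le y0 It0 (hB _ st0T) B0.
have psi0 : 0 < psi by rewrite invr_gt0.
have bw : dotp (b t0 x0) z - dotp (b t0 y0) z <= 0.
  rewrite -dotpBl dotpZr mulr_ge0_le0//; last exact: (drift_monotone theta0 bdis _ _ It0).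
  by rewrite mulr_ge0// ltW.
have qz : (al^-1 + be^-1) * qform (Q t0) z <=
    - (c1 + 4 * sg) * (psi ^+ 2 * dotp w w).
  have hw := ler_wpM2l (sqr_ge0 psi) (hab t0 w It0).
  rewrite [leRHS]mulrCA; apply: le_trans hw; rewrite le_eqVlt; apply/orP; left.
  by apply/eqP; rewrite !qformE bilZl bilZr; ring.
have qzL : qform (Q t0) z <= Lam * (4 * (psi ^+ 2 * dotp w w)).
  rewrite (le_trans (QL _))// dotpZl dotpZr le_eqVlt.
  by apply/orP; left; apply/eqP; ring.
have hk : A * kap * qform (Q t0) z <= 4 * sg * (psi ^+ 2 * dotp w w).
  have -> : A * kap = sg / Lam by rewrite /kap; field; rewrite !lt0r_neq0.
  rewrite mulrAC ler_pdivrMr// (le_trans (ler_wpM2l (ltW sg0) qzL))//.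
  by rewrite le_eqVlt; apply/orP; left; apply/eqP; ring.
rewrite !(dotpDr (b _ _)) !(dotpZr del) (dotpNr _ z) -mulrA in dt.
rewrite qP qS in hh.
exact: (comparison_arith dt hh qE1 qE2 (qe _) (qe _) trQ b1 b2 bw qz hk hC
  del0 del1 kap0 (ltW Lam0)).
Qed.

End comparison.

(** * The maximum principle in doubled variables *)

Section maximum_principle.
Context {R : realType} {d : nat}.
Variables (I : set R) (theta : R) (Q : R -> 'M[R]_d) (b : R -> 'rV[R]_d -> 'rV[R]_d).
Hypothesis theta0 : 0 < theta.
Hypothesis I_up : forall s t, I s -> s <= t -> I t.
Hypothesis bdis : dissipative_drift I theta b.
Hypothesis hcoef : holder_coefficients I theta Q b.
Hypothesis Qell : uniformly_elliptic I Q.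

Let space := (R * ('rV[R]_d * 'rV[R]_d))%type.

Lemma cvg_comparison_fun (u v : R -> 'rV[R]_d -> R) (al be c0 c1 del C m s : R)
    (F : set_system space) {FF : Filter F} (t : R) (x y : 'rV[R]_d) :
  0 < u t x -> 0 < v t y -> 0 < c0 + c1 * (t - s) ->
  (fun p : space => p.1) @ F --> t ->
  (fun p : space => p.2.1) @ F --> x -> (fun p : space => p.2.2) @ F --> y ->
  (fun p : space => u p.1 p.2.1) @ F --> u t x ->
  (fun p : space => v p.1 p.2.2) @ F --> v t y ->
  (fun p : space => comparison_fun u v al be c0 c1 del C m s p.1 p.2.1 p.2.2) @ F
    --> comparison_fun u v al be c0 c1 del C m s t x y.
Proof.
move=> u0 v0 cc0 ct cx cy cu cv; rewrite /comparison_fun /logsum.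
have cts : (fun p : space => p.1 - s) @ F --> t - s.
  by apply: cvgB => //; exact: cvg_cst.
have cxy : (fun p : space => p.2.1 - p.2.2) @ F --> x - y by exact: cvgB.
apply: cvgB; last first.
  by apply: cvgD; [apply: cvgM => //|]; exact: cvg_cst.
apply: cvgB; last first.
  apply: cvgM; first exact: cvg_cst.
  apply: cvgD.
    exact: (cvg_comp _ _ cx (@penalty_continuous R d x)).
  exact: (cvg_comp _ _ cy (@penalty_continuous R d y)).
apply: cvgB; last first.
  apply: cvgM; last exact: dotp_continuous.
  apply: cvgV; first exact: lt0r_neq0.
  by apply: cvgD; [|apply: cvgM => //]; exact: cvg_cst.
apply: cvgD; (apply: cvgM; first exact: cvg_cst).
  exact: (cvg_comp _ _ cu (continuous_ln u0)).
exact: (cvg_comp _ _ cv (continuous_ln v0)).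
Qed.

Lemma solution_within_cvg (s : R) (f : 'rV[R]_d -> R) (u : R -> 'rV[R]_d -> R)
    (F : set_system space) {FF : Filter F} (g : space -> 'rV[R]_d)
    (t : R) (x : 'rV[R]_d) :
  bounded_classical_solution Q b s f u -> s <= t ->
  F [set p | s <= p.1] -> (fun p : space => p.1) @ F --> t -> g @ F --> x ->
  (fun p : space => u p.1 (g p)) @ F --> u t x.
Proof.
move=> [/subspace_continuousP cu _ _ _ _] st Fs ct cx.
have /= h := cu (t, x) st; apply: cvg_trans h => /= A /= hA.
have hp : (fun p : space => (p.1, g p)) @ F --> (t, x).
    exact: (cvg_pair ct cx).
apply: (@filterS2 _ F FF _ _ _ _ Fs (hp _ hA)) => p /= sp; exact.
Qed.

Lemma ln_bound (eps M r : R) : 0 < eps -> eps <= r <= M ->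
  `|ln r| <= `|ln eps| + `|ln M|.
Proof.
move=> eps0 /andP[er rM]; have r0 : 0 < r by exact: lt_le_trans er.
have M0 : 0 < M by exact: lt_le_trans rM.
have h1 : ln eps <= ln r by rewrite ler_ln.
have h2 : ln r <= ln M by rewrite ler_ln.
have h3 : - ln eps <= `|ln eps| by rewrite -normrN ler_norm.
have h4 := ler_norm (ln M); have h5 := normr_ge0 (ln eps).
have h6 := normr_ge0 (ln M); rewrite ler_norml.
by apply/andP; split; lra.
Qed.

Lemma sum_bound_arith (r r' c e p m A B M : R) :
  r <= A -> r' <= B -> 0 <= c -> 0 <= e -> - m <= M ->
  r + r' - c - p - (e + m) <= A + B + M - p.
Proof. by lra. Qed.

Lemma comparison_fun_le0E (u v : R -> 'rV[R]_d -> R) (al be c0 c1 del C m s : R)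
    (t : R) (x y : 'rV[R]_d) :
  (comparison_fun u v al be c0 c1 del C m s t x y <= 0) =
  (al * ln (u t x) + be * ln (v t y) <=
    dotp (x - y) (x - y) / (c0 + c1 * (t - s)) +
    del * (penalty x + penalty y + C * (t - s)) + m).
Proof.
rewrite -[RHS]subr_le0 /comparison_fun /logsum; congr (_ <= 0); ring.
Qed.

(** Comparison in doubled variables. The function
[al ln u(t,x) + be ln v(t,y) - |x-y|^2 / (c0 + c1 (t-s))] stays below its
initial bound provided [c1] compensates the quadratic gradient terms of the
logarithms; the slack [sg] absorbs the gradient of the penalty. *)
Theorem logarithmic_comparison s T (al be c1 sg : R) :
  I s -> al != 0 -> be != 0 -> 0 < sg ->
  (forall t w, I t ->
     (al^-1 + be^-1) * (4 * qform (Q t) w) <= - (c1 + 4 * sg) * dotp w w) ->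
  exists C : R, 0 < C /\
  forall (u v : R -> 'rV[R]_d -> R) (f h : 'rV[R]_d -> R) (eps M c0 del m : R),
  bounded_classical_solution Q b s f u -> bounded_classical_solution Q b s h v ->
  0 < eps -> (forall t x, s <= t -> eps <= u t x <= M) ->
  (forall t x, s <= t -> eps <= v t x <= M) ->
  (forall t, s <= t <= T -> 0 < c0 + c1 * (t - s)) -> 0 < del <= 1 ->
  (forall x y, al * ln (f x) + be * ln (h y) <=
     dotp (x - y) (x - y) / c0 + del * (penalty x + penalty y) + m) ->
  forall t x y, s <= t <= T ->
    al * ln (u t x) + be * ln (v t y) <=
    dotp (x - y) (x - y) / (c0 + c1 * (t - s)) +
    del * (penalty x + penalty y + C * (t - s)) + m.
Proof.
move=> Is al0 be0 sg0 hab.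
have [_ [eta0 [Lam [eta00 etaL hell]]]] := Qell.
have Lam0 : 0 < Lam := lt_trans eta00 etaL.
have hQ t x : I t -> 0 <= qform (Q t) x <= Lam * dotp x x.
  move=> It; have := hell t x It; rewrite sqr_enorm => /andP[h1 ->].
  by rewrite (le_trans _ h1)// mulr_ge0 ?dotp_ge0// ltW.
have [B [B0 hB]] := drift0_bound theta0 I_up hcoef T Is.
pose A := `|al^-1| + `|be^-1|.
have A0 : 0 < A by rewrite /A ltr_wpDr// normr_gt0 invr_eq0.
pose C0 := A * (1 + (sg / (Lam * A))^-1) * Lam + 4 * (d%:R * Lam) + 2 * (B + 1).
have C00 : 0 <= C0.
  rewrite /C0 !addr_ge0 ?mulr_ge0 ?(ltW A0) ?(ltW Lam0) ?addr_ge0//.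
  by rewrite invr_ge0 divr_ge0 ?mulr_ge0 ?(ltW A0) ?(ltW Lam0)// ltW.
exists (C0 + 1); split; first by rewrite ltr_wpDl.
move=> u v f h eps M c0 del m hu hv eps0 hub hvb hc del01 init t1 x1 y1 st1.
pose W t x y := comparison_fun u v al be c0 c1 del (C0 + 1) m s t x y.
suff WP : W t1 x1 y1 <= 0.
  by move: WP; rewrite comparison_fun_le0E.
have del0 : 0 < del by case/andP: del01.
have u0 t x : s <= t -> 0 < u t x.
  by move=> st; case/andP: (hub t x st) => + _; exact: lt_le_trans.
have v0 t x : s <= t -> 0 < v t x.
  by move=> st; case/andP: (hvb t x st) => + _; exact: lt_le_trans.
have Winit x y : W s x y <= 0.
  rewrite comparison_fun_le0E subrr !mulr0 !addr0.
  by case: (hu) => _ _ _ _ ->; case: (hv) => _ _ _ _ ->.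
rewrite leNgt; apply/negP => W1.
pose L := `|ln eps| + `|ln M|.
pose D := `|al| * L + `|be| * L + `|m|.
have L0 : 0 <= L by rewrite addr_ge0.
have D0 : 0 <= D by rewrite !addr_ge0// mulr_ge0.
(* Off this box the penalty alone dominates the logarithms. *)
pose K : set 'rV[R]_d := box (expR (D / del)).
have Dd0 : 0 <= D / del by rewrite divr_ge0// ltW.
have Wle t x y : s <= t <= T -> W t x y <= D - del * (penalty x + penalty y).
  move=> /andP[st tT]; have ctp : 0 < c0 + c1 * (t - s) by apply: hc; rewrite st.
  have h1 : al * ln (u t x) <= `|al| * L.
    by rewrite (le_trans (ler_norm _))// normrM ler_wpM2l// ln_bound// hub.
  have h2 : be * ln (v t y) <= `|be| * L.
    by rewrite (le_trans (ler_norm _))// normrM ler_wpM2l// ln_bound// hvb.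
  have h3 : 0 <= (c0 + c1 * (t - s))^-1 * dotp (x - y) (x - y).
    by rewrite mulr_ge0 ?dotp_ge0// invr_ge0 ltW.
  have h4 : 0 <= del * (C0 + 1) * (t - s).
    apply: mulr_ge0; last by rewrite subr_ge0.
    by apply: mulr_ge0; [exact: ltW|exact: addr_ge0].
  have h5 : - m <= `|m| by rewrite -normrN ler_norm.
  exact: (sum_bound_arith _ h1 h2 h3 h4 h5).
have Wout t x y : s <= t <= T -> ~ K x \/ ~ K y -> W t x y <= 0.
  move=> sT xyK; apply: (le_trans (Wle t x y sT)).
  rewrite subr_le0 -ler_pdivrMl// mulrC.
  case: xyK => [/penalty_ge|/penalty_ge] /(_ Dd0) hp.
    by rewrite (le_trans hp)// lerDl penalty_ge0.
  by rewrite (le_trans hp)// lerDr penalty_ge0.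
pose S : set space := `[s, T]%classic `*` (K `*` K).
have cS : compact S.
  apply: compact_setX; first exact: segment_compact.
  by apply: compact_setX; exact: box_compact.
have W1in : S (t1, (x1, y1)).
  split; first by rewrite /= in_itv/=.
  by split => /=; apply: contrapT => nK; move: W1; rewrite ltNge Wout//; [left|right].
have cW : {within S, continuous (fun p : space => W p.1 p.2.1 p.2.2)}.
  apply/subspace_continuousP => -[t [x y]] [/= + _]; rewrite in_itv/= => tT.
  have st : s <= t by case/andP: tT.
  pose F := within S (nbhs ((t, (x, y)) : space)).
  have cid : (fun p : space => p) @ F --> (t, (x, y)) by exact: cvg_within.
  have c1' : (fun p : space => p.1) @ F --> t by exact: (cvg_comp _ _ cid cvg_fst).
  have c2 : (fun p : space => p.2) @ F --> (x, y) by exact: (cvg_comp _ _ cid cvg_snd).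
  have cx : (fun p : space => p.2.1) @ F --> x by exact: (cvg_comp _ _ c2 cvg_fst).
  have cy : (fun p : space => p.2.2) @ F --> y by exact: (cvg_comp _ _ c2 cvg_snd).
  have Fs : F [set p | s <= p.1].
    apply: filterS (withinT _ _) => p [/= + _].
    by rewrite in_itv/= => /andP[].
  apply: cvg_comparison_fun => //.
  - exact: u0.
  - exact: v0.
  - exact: hc.
  - exact: (solution_within_cvg hu).
  - exact: (solution_within_cvg hv).
have Sn0 : S !=set0 by exists (t1, (x1, y1)).
have [[t0 [x0 y0]] /set_mem[/= t0T _] hmax] := compact_EVT_max Sn0 cS cW.
rewrite in_itv/= in t0T.
have W0 : 0 < W t0 x0 y0.
  by apply: lt_le_trans W1 _; apply: (hmax (t1, (x1, y1))); exact: mem_set.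
(* Initially the function is nonpositive, whereas its maximum is positive. *)
have st0 : s < t0.
  rewrite lt_neqAle; case/andP: (t0T) => -> _; rewrite andbT.
  by apply/eqP => st0; move: W0; rewrite ltNge -st0 Winit.
have gmax t x y : s <= t <= T -> W t x y <= W t0 x0 y0.
  move=> tT; have [Kxy|nK] := pselect (K x /\ K y).
    apply: (hmax (t, (x, y))); apply/mem_set.
    by split; [rewrite /= in_itv/=|].
  by apply: le_trans (ltW W0); apply: Wout => //; exact/not_andP.
apply: (@comparison_no_interior_max _ _ I theta Q b theta0 I_up bdis Qell s T
  al be c1 sg Lam B (C0 + 1) u v f h c0 del m t0 x0 y0) => //.
- by rewrite -/A -/C0 ltrDl.
- by apply: hc.
- by rewrite st0; case/andP: t0T.
Qed.

End maximum_principle.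

(** * Bounded continuous functions and the evolution operator *)

Section continuous_bounded.
Context {R : realType} {d : nat}.
Implicit Types (f h : 'rV[R]_d -> R).

Lemma continuous_measurable_rV f : continuous f -> measurable_fun setT f.
Proof.
move=> cf; apply: (measurability _ (RGenOpens.measurableE R)).
move=> _ [_ [a [c ->] <-]]; rewrite setTI; apply: sub_sigma_algebra.
by move/continuousP: cf; apply; exact: interval_open.
Qed.

Lemma Cb_cst c : Cb (fun _ : 'rV[R]_d => c).
Proof. by split; [exact: cst_continuous|exists `|c|]. Qed.

Lemma CbD f h : Cb f -> Cb h -> Cb (fun x => f x + h x).
Proof.
move=> [cf [M fM]] [ch [N hN]]; split.
  by move=> x; exact: (cvgD (cf x) (ch x)).
by exists (M + N) => x; rewrite (le_trans (ler_normD _ _))// lerD.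
Qed.

Lemma CbZ c f : Cb f -> Cb (fun x => c * f x).
Proof.
move=> [cf [M fM]]; split; first by move=> x; exact: (cvgM (cvg_cst c) (cf x)).
by exists (`|c| * M) => x; rewrite normrM ler_wpM2l.
Qed.

Lemma CbB f h : Cb f -> Cb h -> Cb (fun x => f x - h x).
Proof.
move=> cf ch; have := CbD cf (CbZ (-1) ch).
by under [X in Cb X -> _]eq_fun do rewrite mulN1r.
Qed.

Lemma Cb_norm f : Cb f -> Cb (fun x => `|f x|).
Proof.
move=> [cf [M fM]]; split; first by move=> x; exact: (cvg_norm (cf x)).
by exists M => x; rewrite normr_id.
Qed.

Lemma Cb_min f h : Cb f -> Cb h -> Cb (fun x => Num.min (f x) (h x)).
Proof.
move=> cf ch; have := CbZ 2^-1 (CbB (CbD cf ch) (Cb_norm (CbB cf ch))).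
by congr Cb; apply/funext => x; rewrite minr_absE mulrC.
Qed.

Lemma Cb_comp (k : R -> R) f (a c : R) : (forall r, a <= r <= c -> {for r, continuous k}) ->
  (exists N, forall r, a <= r <= c -> `|k r| <= N) ->
  Cb f -> (forall x, a <= f x <= c) -> Cb (fun x => k (f x)).
Proof.
move=> ck [N kN] [cf _] fac; split; last by exists N => x; exact: kN.
move=> x; exact: (cvg_comp _ _ (cf x) (ck _ (fac x))).
Qed.

Lemma Cb_powR (p eps : R) f : 0 < p -> 0 < eps -> Cb f -> (forall x, eps <= f x) ->
  Cb (fun x => f x `^ p).
Proof.
move=> p0 eps0 cf epsf; have [_ [M fM]] := cf.
have fM' z : eps <= f z <= M by rewrite epsf (le_trans (ler_norm _)).
apply: (@Cb_comp (fun r => r `^ p) f eps M) => //.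
  move=> r /andP[er _]; have r0 : 0 < r by exact: lt_le_trans er.
  by apply/differentiable_continuous/derivable1_diffP; apply: derivable_powR;
    rewrite in_itv/= andbT.
exists (M `^ p) => r /andP[er rM]; rewrite ger0_norm ?powR_ge0//.
have r0 : 0 <= r by rewrite (le_trans (ltW eps0)).
by rewrite ge0_ler_powR ?nnegrE ?(ltW p0)// (le_trans r0).
Qed.

Lemma Cb_measurable f : Cb f -> measurable_fun setT f.
Proof. by case=> cf _; exact: continuous_measurable_rV. Qed.

End continuous_bounded.

Section evolution.
Context {R : realType} {d : nat}.
Variables (I : set R) (theta : R) (Q : R -> 'M[R]_d) (b : R -> 'rV[R]_d -> 'rV[R]_d).
Variables (G : R -> R -> ('rV[R]_d -> R) -> 'rV[R]_d -> R)
          (g : R -> R -> 'rV[R]_d -> 'rV[R]_d -> R).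
Hypothesis I_up : forall s t, I s -> s <= t -> I t.
Hypothesis G_evol : evolution_operator I theta Q b G.
Hypothesis g_kernel : evolution_kernel I G g.

Let leb := lebesgue_rV R d.

Lemma evolution_diag s f x : I s -> Cb f -> G s s f x = f x.
Proof. by move=> Is cf; case: (G_evol Is cf) => -[_ _ _ _ ->]. Qed.

Lemma evolution_Cb s t f : I s -> s <= t -> Cb f -> Cb (G t s f).
Proof.
move=> Is st cf; case: (G_evol Is cf) => -[_ [M hM] C12u _ us] _ _.
move: st; rewrite le_eqVlt => /orP[/eqP <-|st].
  by rewrite (funext us).
have Jt : `]s, +oo[%classic t by rewrite /= in_itv/= st.
split; first by case: (C12_slice Jt C12u).
by exists M => x; apply: hM; exact: ltW.
Qed.

Lemma parabolic_classW (P : (R -> 'rV[R]_d -> R) -> Prop)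
    (P' : (R -> 'rV[R]_d -> R) -> Prop) (J J' : set R) u :
  J' `<=` J -> (forall v, P v -> P' v) -> parabolic_class P J u ->
  parabolic_class P' J' u.
Proof.
move=> JJ PP [h1 h2 h3 h4 h5]; split => [t x /JJ|||i|i j]; first exact: h1.
all: by apply: PP; auto.
Qed.

Lemma evolution_solution_restart s r f : I s -> s <= r -> Cb f ->
  bounded_classical_solution Q b r (G r s f) (fun t => G t s f).
Proof.
move=> Is sr cf; case: (G_evol Is cf) => -[cu [M hM] C12u eu us] _ _; split => //.
- apply: continuous_subspaceW cu => p /=; exact: le_trans.
- by exists M => t x rt; apply: hM; exact: le_trans rt.
- apply: parabolic_classW C12u.
    by move=> t /=; rewrite !in_itv/= !andbT; exact: le_lt_trans.
  move=> v cv p pr; apply: cv.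
  by move: pr => /=; rewrite !in_itv/= !andbT; exact: le_lt_trans.
- by move=> t x rt; apply: eu; exact: le_lt_trans rt.
Qed.

(** By uniqueness: [G t s f], restarted at [r], is a bounded classical solution
with initial value [G r s f]. *)
Lemma evolution_comp s r t f x : I s -> s <= r -> r <= t -> Cb f ->
  G t s f x = G t r (G r s f) x.
Proof.
move=> Is sr rt cf; have Ir := I_up Is sr.
case: (G_evol Ir (evolution_Cb Is sr cf)) => _ _ uniq.
exact: (uniq _ (evolution_solution_restart Is sr cf) t x rt).
Qed.

Lemma kernel_integrable s t x f : I s -> I t -> s < t -> Cb f ->
  leb.-integrable setT (fun y => (g t s x y * f y)%:E).
Proof.
move=> Is It st cf; have [mg g0 g1 _] := g_kernel x Is It st.
have ig : leb.-integrable setT (fun y => (g t s x y)%:E).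
  apply/integrableP; split; first exact/measurable_EFinP.
  rewrite (eq_integral (fun y => (g t s x y)%:E)) ?g1 ?ltry// => y _.
  by rewrite gee0_abs// lee_fin ltW.
case: (cf) => _ [M fM].
apply: (@le_integrable _ _ _ _ _ measurableT _ (fun y => M%:E * (g t s x y)%:E)%E).
- apply/measurable_EFinP; apply: measurable_funM => //.
  exact: Cb_measurable.
- move=> y _; rewrite -EFinM !abse_EFin lee_fin !normrM mulrC.
  by rewrite ler_wpM2r// (le_trans (fM y))// ler_norm.
- exact: integrableZl.
Qed.

Lemma evolution_kernelE s t x f : I s -> I t -> s < t -> Cb f ->
  (G t s f x)%:E = kernel_integral g t s f x.
Proof. by move=> Is It st; have [_ _ _] := g_kernel x Is It st; exact. Qed.

Lemma evolution_le s t f h x : I s -> s <= t -> Cb f -> Cb h ->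
  (forall y, f y <= h y) -> G t s f x <= G t s h x.
Proof.
move=> Is st cf ch fh; have It := I_up Is st.
move: st; rewrite le_eqVlt => /orP[/eqP <-|st].
  by rewrite !evolution_diag.
rewrite -lee_fin !evolution_kernelE//; apply: le_integral => //.
- exact: kernel_integrable.
- exact: kernel_integrable.
- move=> y _; rewrite lee_fin ler_wpM2l// ltW//.
  by have [_ + _ _] := g_kernel x Is It st; exact.
Qed.

Lemma evolutionB s t f h x : I s -> s <= t -> Cb f -> Cb h ->
  G t s (fun y => f y - h y) x = G t s f x - G t s h x.
Proof.
move=> Is st cf ch; have It := I_up Is st.
move: st; rewrite le_eqVlt => /orP[/eqP <-|st].
  by rewrite !evolution_diag//; exact: CbB.
apply: EFin_inj; rewrite EFinB !evolution_kernelE//; last exact: CbB.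
rewrite -integralB_EFin//; [|exact: kernel_integrable|exact: kernel_integrable].
by apply: eq_integral => y _; rewrite -EFinB mulrBr.
Qed.

Lemma evolutionZ s t c f x : I s -> s <= t -> Cb f ->
  G t s (fun y => c * f y) x = c * G t s f x.
Proof.
move=> Is st cf; have It := I_up Is st.
move: st; rewrite le_eqVlt => /orP[/eqP <-|st].
  by rewrite !evolution_diag//; exact: CbZ.
apply: EFin_inj; rewrite EFinM !evolution_kernelE//; last exact: CbZ.
rewrite -integralZl//; last exact: kernel_integrable.
by apply: eq_integral => y _; rewrite -EFinM mulrCA.
Qed.

Lemma evolution_cst s t c x : I s -> s <= t -> G t s (fun=> c) x = c.
Proof.
move=> Is st; have It := I_up Is st; have cc := @Cb_cst R d c.
move: st; rewrite le_eqVlt => /orP[/eqP <-|st].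
  by rewrite !evolution_diag.
apply: EFin_inj; rewrite evolution_kernelE// /kernel_integral.
have [mg g0 g1 _] := g_kernel x Is It st.
under eq_integral do rewrite mulrC EFinM.
rewrite integralZl// ?g1 ?mule1//.
have := @kernel_integrable s t x _ Is It st (@Cb_cst R d 1).
by under [X in integrable _ _ X -> _]eq_fun do rewrite mulr1.
Qed.

Lemma evolution_bounds s t f m M x : I s -> s <= t -> Cb f ->
  (forall y, m <= f y <= M) -> m <= G t s f x <= M.
Proof.
move=> Is st cf fmM; apply/andP; split.
  rewrite -[leLHS](@evolution_cst s t m x Is st); apply: evolution_le => //.
    exact: Cb_cst.
  by move=> y; case/andP: (fmM y).
rewrite -[leRHS](@evolution_cst s t M x Is st); apply: evolution_le => //.
  exact: Cb_cst.
by move=> y; case/andP: (fmM y).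
Qed.

Lemma evolution_ge0 s t f x : I s -> s <= t -> Cb f -> (forall y, 0 <= f y) ->
  0 <= G t s f x.
Proof.
move=> Is st cf f0; rewrite -(@evolution_cst s t 0 x Is st).
by apply: evolution_le => //; exact: Cb_cst.
Qed.

Lemma evolution_norm_le s t f x : I s -> s <= t -> Cb f ->
  `|G t s f x| <= G t s (fun y => `|f y|) x.
Proof.
move=> Is st cf; have cn := Cb_norm cf; rewrite ler_norml -mulN1r -evolutionZ//.
apply/andP; split; apply: evolution_le => //; first exact: CbZ.
  by move=> y; rewrite mulN1r lerNl -normrN ler_norm.
by move=> y; exact: ler_norm.
Qed.

End evolution.

(** * Harnack inequality and Gaussian concentration *)

Section harnack.
Context {R : realType} {d : nat}.
Variables (I : set R) (theta : R) (Q : R -> 'M[R]_d) (b : R -> 'rV[R]_d -> 'rV[R]_d).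
Variables (G : R -> R -> ('rV[R]_d -> R) -> 'rV[R]_d -> R)
          (g : R -> R -> 'rV[R]_d -> 'rV[R]_d -> R).
Hypothesis theta0 : 0 < theta.
Hypothesis I_up : forall s t, I s -> s <= t -> I t.
Hypothesis bdis : dissipative_drift I theta b.
Hypothesis hcoef : holder_coefficients I theta Q b.
Hypothesis Qell : uniformly_elliptic I Q.
Hypothesis G_evol : evolution_operator I theta Q b G.
Hypothesis g_kernel : evolution_kernel I G g.

(** Used to let the weight of the penalty tend to zero. *)
Lemma le_vanishing_slope (r q c : R) :
  (forall del, 0 < del <= 1 -> r <= q + del * c) -> r <= q.
Proof.
move=> h; rewrite leNgt; apply/negP => qr.
have c0 : 0 < `|c| + 1 by rewrite ltr_wpDl.
pose del := Num.min 1 ((r - q) / 2 / (`|c| + 1)).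
have del0 : 0 < del <= 1.
  by rewrite lt_min ltr01 divr_gt0 ?divr_gt0 ?subr_gt0//= ge_min lexx.
have := h _ del0; case/andP: del0 => del0 _.
have h1 : del * c <= (r - q) / 2.
  rewrite (le_trans (ler_wpM2l (ltW del0) (ler_norm c)))//.
  rewrite (@le_trans _ _ (del * (`|c| + 1)))//.
    by rewrite ler_wpM2l ?(ltW del0)// lerDl.
  by rewrite -ler_pdivlMr// ge_min lexx orbT.
lra.
Qed.

(** Near the diagonal the oscillation is below [del] by continuity; far from it
the quadratic term wins, and off a compact set the penalty wins. *)
Lemma oscillation_le (k : 'rV[R]_d -> R) (D del : R) : 0 < del -> 0 <= D ->
  continuous k -> (forall x, `|k x| <= D) ->
  exists c0 : R, 0 < c0 /\ forall x y, k x - k y <=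
    dotp (x - y) (x - y) / c0 + del * (penalty x + penalty y) + del.
Proof.
move=> del0 D0 ck kD.
pose K : set 'rV[R]_d := box (expR (2 * D / del)).
have Dd0 : 0 <= 2 * D / del by rewrite divr_ge0 ?mulr_ge0// ltW.
pose psi (p : 'rV[R]_d * 'rV[R]_d) := dotp (p.1 - p.2) (p.1 - p.2) +
  Num.max 0 (del - (k p.1 - k p.2)).
have K0 : K `*` K !=set0.
  by exists (0, 0); split; apply: box0; exact: expR_ge0.
have cK : compact (K `*` K) by apply: compact_setX; exact: box_compact.
have cpsi (p : 'rV[R]_d * 'rV[R]_d) : psi @ nbhs p --> psi p.
  have c1 : (fun q : 'rV[R]_d * 'rV[R]_d => q.1) @ nbhs p --> p.1 by exact: cvg_fst.
  have c2 : (fun q : 'rV[R]_d * 'rV[R]_d => q.2) @ nbhs p --> p.2 by exact: cvg_snd.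
  have c12 : (fun q : 'rV[R]_d * 'rV[R]_d => q.1 - q.2) @ nbhs p --> p.1 - p.2.
    exact: cvgB.
  have k1 := cvg_comp _ _ c1 (ck p.1); have k2 := cvg_comp _ _ c2 (ck p.2).
  have h2 : (fun q : 'rV[R]_d * 'rV[R]_d => del - (k q.1 - k q.2)) @ nbhs p -->
      del - (k p.1 - k p.2).
    exact: (cvgB (cvg_cst del) (cvgB k1 k2)).
  have h3 : (fun q : 'rV[R]_d * 'rV[R]_d => Num.max 0 (del - (k q.1 - k q.2)))
      @ nbhs p --> Num.max 0 (del - (k p.1 - k p.2)).
    exact: (continuous_max (cvg_cst 0) h2).
  by apply: cvgD h3; exact: dotp_continuous.
have [p /set_mem pK pmin] := compact_EVT_min K0 cK (continuous_subspaceT (cpsi : continuous psi)).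
have psi0 : 0 < psi p.
  rewrite /psi; have := dotp_ge0 (p.1 - p.2); rewrite le_eqVlt => /orP[|h].
    rewrite eq_sym => /eqP h; rewrite h add0r lt_max; apply/orP; right.
    have -> : p.1 = p.2.
      apply/rowP => i; apply/eqP; rewrite -subr_eq0 -sqrf_eq0 eq_le sqr_ge0 andbT.
      by have := coord_le_dotp (p.1 - p.2) i; rewrite h !mxE.
    by rewrite subrr subr0.
  by rewrite ltr_pwDl// le_max lexx.
(* The extra [1] makes the denominator positive when [D = 0]. *)
exists (psi p / (2 * D + 1)); split; first by rewrite divr_gt0// ltr_wpDl ?mulr_ge0.
move=> x y.
have kxy : k x - k y <= 2 * D.
  by have := kD x; have := kD y; rewrite !ler_norml => /andP[? ?] /andP[? ?]; lra.
have q0 : 0 <= dotp (x - y) (x - y) / (psi p / (2 * D + 1)).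
  by rewrite divr_ge0 ?dotp_ge0// divr_ge0 ?(ltW psi0)// addr_ge0 ?mulr_ge0.
have [Kxy|nK] := pselect (K x /\ K y); last first.
  have hp : 2 * D <= del * (penalty x + penalty y).
    rewrite -ler_pdivrMl// mulrC; case/not_andP: nK => /(penalty_ge Dd0) hp.
      by rewrite (le_trans hp)// lerDl penalty_ge0.
    by rewrite (le_trans hp)// lerDr penalty_ge0.
  lra.
have pen0 : 0 <= del * (penalty x + penalty y).
  by rewrite mulr_ge0 ?(ltW del0)// addr_ge0// penalty_ge0.
have [small|big] := leP (k x - k y) del; first lra.
have := pmin (x, y) (mem_set Kxy); rewrite {2}/psi/=.
rewrite max_l ?addr0; last by rewrite subr_le0 ltW.
move=> hpsi; suff : 2 * D <= dotp (x - y) (x - y) / (psi p / (2 * D + 1)) by lra.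
rewrite ler_pdivlMr; last by rewrite divr_gt0// ltr_wpDl ?mulr_ge0.
apply: le_trans hpsi; rewrite mulrA ler_pdivrMr; last by rewrite ltr_wpDl ?mulr_ge0.
by rewrite mulrC ler_wpM2l ?(ltW psi0)// lerDl.
Qed.

(** Dimension-free Harnack inequality: the case [al = p], [be = -1], where
[1/al + 1/be < 0] allows the coefficient [1 / (c1 (t-s))] of [|x-y|^2], which
is infinite at the initial time. *)
Theorem harnack_inequality (p : R) : 1 < p -> exists c : R, 0 < c /\
  forall s t F (eps : R), I s -> s < t -> Cb F -> 0 < eps -> (forall x, eps <= F x) ->
  forall x y, G t s F x `^ p <=
    G t s (fun z => F z `^ p) y * expR (c * dotp (x - y) (x - y) / (t - s)).
Proof.
move=> p1; have p0 : 0 < p by exact: lt_trans p1.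
have [_ [eta0 [Lam [eta00 etaL hell]]]] := Qell.
have pp : 0 < 1 - p^-1 by rewrite subr_gt0 invf_lt1.
(* The condition on the coefficients is [c1 + 4 sg <= 4 eta0 (1 - 1/p)], shared
   equally between [c1] and the slack. *)
pose c1 := 2 * eta0 * (1 - p^-1); pose sg := eta0 * (1 - p^-1) / 2.
have c10 : 0 < c1 by rewrite !mulr_gt0.
have sg0 : 0 < sg by rewrite divr_gt0 ?mulr_gt0.
exists c1^-1; split; first by rewrite invr_gt0.
move=> s t F eps Is st cF eps0 epsF x y.
have N1 : -1 != 0 :> R by rewrite oppr_eq0 oner_eq0.
have hab t' w : I t' -> (p^-1 + (-1)^-1) * (4 * qform (Q t') w) <=
    - (c1 + 4 * sg) * dotp w w.
  move=> It; have := hell t' w It; rewrite sqr_enorm => /andP[h _].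
  rewrite (_ : - (c1 + 4 * sg) * _ = - (1 - p^-1) * 4 * (eta0 * dotp w w)); last first.
    rewrite /c1 /sg; field; exact: lt0r_neq0.
  rewrite invrN1 (_ : (p^-1 - 1) * _ = - (1 - p^-1) * 4 * qform (Q t') w); last by ring.
  rewrite ler_wnM2l// mulr_le0_ge0// oppr_le0 ltW//.
have [C [C0 comp]] := logarithmic_comparison theta0 I_up bdis hcoef Qell t Is
  (lt0r_neq0 p0) N1 sg0 hab.
have [M0 FM0] := cF.2.
pose M := Num.max M0 eps.
have FM z : eps <= F z <= M.
  by rewrite epsF/= le_max (le_trans (ler_norm _) (FM0 z)).
have M1 : 0 < M by rewrite lt_max eps0 orbT.
have F0 z : 0 < F z by exact: lt_le_trans eps0 (epsF z).
pose P (z : 'rV[R]_d) := F z `^ p.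
have PM z : eps `^ p <= P z <= M `^ p.
  have /andP[h1 h2] := FM z.
  by rewrite !ge0_ler_powR ?nnegrE ?(ltW p0) ?(ltW eps0) ?(ltW M1) ?(ltW (F0 z)).
have cP : Cb P by exact: (Cb_powR p0 eps0 cF epsF).
pose e' := Num.min eps (eps `^ p); pose M' := Num.max M (M `^ p).
have e'0 : 0 < e' by rewrite lt_min eps0 powR_gt0.
have bu r z : s <= r -> e' <= G r s F z <= M'.
  move=> sr; have /andP[h1 h2] := evolution_bounds I_up G_evol g_kernel z Is sr cF FM.
  by rewrite ge_min h1 le_max h2.
have bv r z : s <= r -> e' <= G r s P z <= M'.
  move=> sr; have /andP[h1 h2] := evolution_bounds I_up G_evol g_kernel z Is sr cP PM.
  by rewrite ge_min h1 le_max h2 !orbT.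
have [su _ _] := G_evol Is cF; have [sv _ _] := G_evol Is cP.
pose k z := p * ln (F z).
have cln : Cb (fun z => ln (F z)).
  apply: (@Cb_comp _ _ (@ln R) F eps M) => //.
    by move=> r /andP[er _]; apply: continuous_ln; exact: lt_le_trans er.
  by exists (`|ln eps| + `|ln M|) => r; exact: ln_bound.
have ck : continuous k := (CbZ p cln).1.
pose D := `|p| * (`|ln eps| + `|ln M|).
have kD z : `|k z| <= D by rewrite normrM ler_wpM2l// ln_bound.
have D0 : 0 <= D by rewrite mulr_ge0// addr_ge0.
have Gu0 : 0 < G t s F x by have /andP[+ _] := bu t x (ltW st); exact: lt_le_trans.
have Gv0 : 0 < G t s P y by have /andP[+ _] := bv t y (ltW st); exact: lt_le_trans.
have key : p * ln (G t s F x) - ln (G t s P y) <= c1^-1 * dotp (x - y) (x - y) / (t - s).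
  apply: (@le_vanishing_slope _ _ (penalty x + penalty y + C * (t - s) + 1)).
  move=> del del01; have del0 : 0 < del by case/andP: del01.
  (* At the initial time any coefficient of [|x - y|^2] is allowed, so that the
     oscillation of [ln F] is absorbed by a large one. *)
  have [c0 [c00 hc0]] := oscillation_le del0 D0 ck kD.
  have hc r : s <= r <= t -> 0 < c0 + c1 * (r - s).
    by move=> /andP[sr _]; rewrite ltr_pwDl// mulr_ge0 ?(ltW c10)// subr_ge0.
  have init x' y' : p * ln (F x') + -1 * ln (P y') <=
      dotp (x' - y') (x' - y') / c0 + del * (penalty x' + penalty y') + del.
    by rewrite mulN1r /P ln_powR; exact: hc0.
  have stt : s <= t <= t by rewrite (ltW st) lexx.
  have := comp _ _ _ _ e' M' c0 del del su sv e'0 bu bv hc del01 init t x y stt.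
  rewrite mulN1r; set X := dotp _ _ / _ => h.
  have hX : X <= c1^-1 * dotp (x - y) (x - y) / (t - s).
    have -> : c1^-1 * dotp (x - y) (x - y) / (t - s) =
        dotp (x - y) (x - y) * (c1 * (t - s))^-1 by rewrite (invfM c1); ring.
    rewrite /X ler_wpM2l ?dotp_ge0//.
    have P1 : 0 < c1 * (t - s) by rewrite mulr_gt0// subr_gt0.
    by rewrite lef_pV2 ?posrE ?addr_gt0// lerDr ltW.
  apply: (le_trans h); rewrite [del * (_ + 1)]mulrDr mulr1 addrA lerD2r lerD2r//.
rewrite -ler_ln ?posrE ?powR_gt0 ?mulr_gt0 ?expR_gt0//.
by rewrite ln_powR lnM ?posrE ?expR_gt0// expRK; rewrite lerBlDl in key.
Qed.

(** The case [al = be = 1]: a Gaussian cost between two functions is transported,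
with a rate that blows up only after a time of order [1 / lam]. On the diagonal
[x = y] this is concentration of the transition kernel. *)
Theorem gaussian_concentration : exists kap : R, 0 < kap /\
  forall s t F H (lam K eps : R), I s -> s < t -> 0 < lam -> kap * lam * (t - s) < 1 ->
  Cb F -> Cb H -> 0 < eps -> (forall x, eps <= F x) -> (forall x, eps <= H x) ->
  (forall x y, F x * H y <= K * expR (lam * dotp (x - y) (x - y))) ->
  forall x, G t s F x * G t s H x <= K.
Proof.
have [_ [eta0 [Lam [eta00 etaL hell]]]] := Qell.
have Lam0 : 0 < Lam := lt_trans eta00 etaL.
exists (16 * Lam); split; first by rewrite mulr_gt0.
move=> s t F H lam K eps Is st lam0 small cF cH eps0 epsF epsH FH x.
(* Here [1/al + 1/be = 2], so [c1 + 4 sg] must be at most [- 8 Lam]: the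
   coefficient of [|x - y|^2] increases in time. *)
pose c1 := - (16 * Lam); pose sg := 2 * Lam.
have sg0 : 0 < sg by rewrite mulr_gt0.
have hab t' w : I t' -> (1^-1 + 1^-1) * (4 * qform (Q t') w) <=
    - (c1 + 4 * sg) * dotp w w.
  move=> It; have := hell t' w It; rewrite sqr_enorm => /andP[_ h].
  rewrite invr1 (_ : - (c1 + 4 * sg) * _ = 8 * (Lam * dotp w w)); last first.
    by rewrite /c1 /sg; ring.
  by rewrite (_ : (1 + 1) * _ = 8 * qform (Q t') w) ?ler_pM2l//; ring.
have n1 : 1 != 0 :> R by exact: oner_neq0.
have [C [C0 comp]] := logarithmic_comparison theta0 I_up bdis hcoef Qell t Is
  n1 n1 sg0 hab.
have [MF FM0] := cF.2; have [MH HM0] := cH.2.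
pose M := Num.max MF MH.
have FM z : eps <= F z <= M.
  by rewrite epsF/= le_max (le_trans (ler_norm _) (FM0 z)).
have HM z : eps <= H z <= M.
  by rewrite epsH/= le_max (le_trans (ler_norm _) (HM0 z)) orbT.
have F0 z : 0 < F z by exact: lt_le_trans eps0 (epsF z).
have H0 z : 0 < H z by exact: lt_le_trans eps0 (epsH z).
have bu r z : s <= r -> eps <= G r s F z <= M.
  by move=> sr; exact: (evolution_bounds I_up G_evol g_kernel z Is sr cF FM).
have bv r z : s <= r -> eps <= G r s H z <= M.
  by move=> sr; exact: (evolution_bounds I_up G_evol g_kernel z Is sr cH HM).
have [su _ _] := G_evol Is cF; have [sv _ _] := G_evol Is cH.
have K0 : 0 < K.
  have := FH 0 0; have := mulr_gt0 (F0 0) (H0 0) => h1 h2.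
  by have := lt_le_trans h1 h2; rewrite pmulr_lgt0// expR_gt0.
have Gu0 : 0 < G t s F x by have /andP[+ _] := bu t x (ltW st); exact: lt_le_trans.
have Gv0 : 0 < G t s H x by have /andP[+ _] := bv t x (ltW st); exact: lt_le_trans.
rewrite -ler_ln ?posrE ?mulr_gt0// lnM ?posrE//.
apply: (@le_vanishing_slope _ _ (penalty x + penalty x + C * (t - s))).
move=> del del01; have del0 : 0 < del by case/andP: del01.
have hc r : s <= r <= t -> 0 < lam^-1 + c1 * (r - s).
  move=> /andP[sr rt]; rewrite /c1 mulNr subr_gt0 -[ltRHS]mul1r ltr_pdivlMr//.
  apply: le_lt_trans small; rewrite mulrAC.
  by rewrite ler_wpM2l ?mulr_ge0 ?(ltW Lam0) ?(ltW lam0)// lerB.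
have init x' y' : 1 * ln (F x') + 1 * ln (H y') <=
    dotp (x' - y') (x' - y') / lam^-1 + del * (penalty x' + penalty y') + ln K.
  rewrite !mul1r invrK -lnM ?posrE//.
  have := FH x' y'; rewrite -ler_ln ?posrE ?mulr_gt0 ?expR_gt0//.
  rewrite (lnM K0)  ?posrE ?expR_gt0// expRK => h.
  have pen : 0 <= del * (penalty x' + penalty y').
    by rewrite mulr_ge0 ?(ltW del0)// addr_ge0// penalty_ge0.
  rewrite (le_trans h)// addrC lerD2r [lam * _]mulrC lerDl//.
have stt : s <= t <= t by rewrite (ltW st) lexx.
have := comp _ _ _ _ eps M _ del (ln K) su sv eps0 bu bv hc del01 init t x x stt.
rewrite !mul1r subrr dotp0l mul0r add0r => h.
by rewrite [leRHS]addrC.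
Qed.

End harnack.

(** * Regularity of Borel probability measures *)

Section regularity.
Context {R : realType} {d : nat}.
Implicit Types (A F U V : set 'rV[R]_d) (x y : 'rV[R]_d).

(** The distance to [F] cut off at [1], so that it is defined for empty [F]. *)
Definition cutdist F x : R :=
  inf [set r | r = 1 \/ exists2 y, F y & r = `|x - y|].

Lemma cutdist_has_inf F x :
  has_inf [set r : R | r = 1 \/ exists2 y, F y & r = `|x - y|].
Proof.
split; first by exists 1; left.
by exists 0 => r [->|[y _ ->]].
Qed.

Lemma cutdist_ge0 F x : 0 <= cutdist F x.
Proof.
apply: lb_le_inf; first by case: (cutdist_has_inf F x).
by move=> r [->|[y _ ->]].
Qed.

Lemma cutdist_le1 F x : cutdist F x <= 1.
Proof. by apply: ge_inf; [case: (cutdist_has_inf F x)|left]. Qed.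

Lemma cutdist_eq0 F x : F x -> cutdist F x = 0.
Proof.
move=> Fx; apply/eqP; rewrite eq_le cutdist_ge0 andbT.
apply: ge_inf; first by case: (cutdist_has_inf F x).
by right; exists x => //; rewrite subrr normr0.
Qed.

Lemma cutdist_gt0 F x : closed F -> ~ F x -> 0 < cutdist F x.
Proof.
move=> cF Fx; have oF : open (~` F) by exact: closed_openC.
have /nbhs_ballP[e /= e0 he] : nbhs x (~` F) by exact: open_nbhs_nbhs.
apply: (@lt_le_trans _ _ (Num.min 1 e)); first by rewrite lt_min ltr01.
apply: lb_le_inf; first by case: (cutdist_has_inf F x).
move=> r [->|[y Fy ->]]; first by rewrite ge_min lexx.
rewrite ge_min; apply/orP; right; rewrite leNgt; apply/negP => xy.
by apply: (he y) => //; rewrite -ball_normE.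
Qed.

Lemma cutdist_lipschitz F x y : cutdist F x <= cutdist F y + `|x - y|.
Proof.
rewrite -lerBlDr; apply: lb_le_inf; first by case: (cutdist_has_inf F y).
move=> r [->|[z Fz ->]]; rewrite lerBlDr.
  by rewrite (le_trans (cutdist_le1 F x))// lerDl.
apply: (@le_trans _ _ `|x - z|).
  by apply: ge_inf; [case: (cutdist_has_inf F x)|right; exists z].
by rewrite -(subrKA y) [leRHS]addrC; exact: ler_normD.
Qed.

Lemma cutdist_continuous F : continuous (cutdist F).
Proof.
move=> x; suff : cutdist F @ nbhs (x : 'rV[R]_d) --> cutdist F x by [].
apply/cvgrPdist_le => e e0; apply/nbhs_ballP; exists e => //= y.
rewrite -ball_normE /= => xy.
have h1 := cutdist_lipschitz F x y; have h2 := cutdist_lipschitz F y x.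
rewrite distrC in h2; rewrite ler_norml; apply/andP; split; lra.
Qed.

Lemma Cb_cutdist F : Cb (cutdist F).
Proof.
split; first exact: cutdist_continuous.
by exists 1 => x; rewrite ger0_norm ?cutdist_ge0// cutdist_le1.
Qed.

Lemma open_measurable_rV U : open U -> measurable U.
Proof. by move=> oU; exact: sub_sigma_algebra. Qed.

(** Continuous functions increasing to the indicator of an open set. *)
Definition cutoff U (n : nat) x : R := Num.min 1 (n%:R * cutdist (~` U) x).

Lemma cutoff_ge0 U n x : 0 <= cutoff U n x.
Proof. by rewrite le_min ler01 mulr_ge0// cutdist_ge0. Qed.

Lemma cutoff_le1 U n x : cutoff U n x <= 1.
Proof. by rewrite ge_min lexx. Qed.

Lemma cutoff_out U n x : ~ U x -> cutoff U n x = 0.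
Proof. by move=> nU; rewrite /cutoff cutdist_eq0// mulr0 min_r. Qed.

Lemma Cb_cutoff U n : Cb (cutoff U n).
Proof.
exact: (Cb_min (Cb_cst 1) (CbZ n%:R (Cb_cutdist (~` U)))).
Qed.

Lemma cutoff_nondecreasing U x : nondecreasing_seq (cutoff U ^~ x).
Proof.
move=> m n mn; rewrite /cutoff le_min ge_min lexx/= ge_min; apply/orP; right.
by rewrite ler_wpM2r ?cutdist_ge0// ler_nat.
Qed.

Lemma cutoff_eventually U x : open U -> U x -> exists n, cutoff U n x = 1.
Proof.
move=> oU Ux; have cU : 0 < cutdist (~` U) x.
  by apply: cutdist_gt0; [exact: open_closedC|apply].
pose n := Num.bound (cutdist (~` U) x)^-1; exists n.
rewrite /cutoff min_l// -ler_pdivrMr// mul1r ltW//.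
by rewrite /n archi_boundP// invr_ge0 ltW.
Qed.

Lemma cutoff_cvg U x : open U -> cutoff U ^~ x @ \oo --> (\1_U x : R).
Proof.
move=> oU; rewrite indicE; have [Ux|nU] := boolP (x \in U); last first.
  apply: cvg_near_cst; apply: nearW => n; rewrite cutoff_out//.
  by move=> Ux; move: nU; rewrite mem_set.
have [n hn] := cutoff_eventually oU (set_mem Ux).
apply: cvg_near_cst; exists n => //= m nm; apply/eqP.
by rewrite eq_le cutoff_le1 -hn cutoff_nondecreasing.
Qed.

Variable P : probability 'rV[R]_d R.

(** [V] is a neighbourhood of the complement, which makes the notion symmetric in
[A] and its complement. *)
Definition regular A := forall e : R, 0 < e -> exists U V,
  [/\ open U, open V, A `<=` U, ~` A `<=` V & (P (U `&` V) <= e%:E)%E].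

Lemma nonincreasing_small (F : (set 'rV[R]_d)^nat) (e : R) : 0 < e ->
  (forall n, measurable (F n)) -> nonincreasing_seq F -> \bigcap_n F n = set0 ->
  exists n, (P (F n) <= e%:E)%E.
Proof.
move=> e0 mF nF F0.
have F0oo : (P (F 0%N) < +oo)%E by rewrite ltey_eq fin_num_measure.
have mI : measurable (\bigcap_n F n) by rewrite F0.
have := nonincreasing_cvg_mu F0oo mF mI nF; rewrite F0 measure0.
move=> /fine_cvgP[_ /cvgrPdist_le /(_ e e0)[n _ /(_ n (leqnn n))]].
rewrite /= sub0r normrN ger0_norm ?fine_ge0// => h; exists n.
by rewrite -(@fineK _ (P (F n))) ?lee_fin// fin_num_measure.
Qed.

Lemma open_cutoff_lt1 U n : open [set x | cutoff U n x < 1].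
Proof.
by have [c _] := Cb_cutoff U n; move/continuousP: c => /(_ _ (@open_lt R 1)).
Qed.

Lemma cutoff_small U e : open U -> 0 < e ->
  exists n, (P (U `&` [set x | cutoff U n x < 1]%R) <= e%:E)%E.
Proof.
move=> oU e0.
apply: (@nonincreasing_small (fun n => U `&` [set x | cutoff U n x < 1])) => //.
- move=> n; apply: open_measurable_rV; apply: openI; first exact: oU.
  exact: open_cutoff_lt1.
- move=> m n mn; apply/subsetPset => x [Ux] /= h; split => //.
  by apply: le_lt_trans h; exact: cutoff_nondecreasing.
- rewrite -subset0 => x /= h; have [Ux _] := h 0%N I.
  have [n hn] := cutoff_eventually oU Ux.
  by have [_] := h n I; rewrite /= hn ltxx.
Qed.

(** The sets where the cutoffs are below [1] decrease to the complement of [U]. *)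
Lemma open_regular U : open U -> regular U.
Proof.
move=> oU e e0; have [n hn] := cutoff_small oU e0.
exists U, [set x | cutoff U n x < 1]; split => //; first exact: open_cutoff_lt1.
by move=> x nU; rewrite /= cutoff_out.
Qed.

Lemma regular_setC A : regular A -> regular (~` A).
Proof.
move=> rA e e0; have [U [V [oU oV AU AV UV]]] := rA e e0.
by exists V, U; split => //; [rewrite setCK|rewrite setIC].
Qed.

(** Finitely many of the open sets carry almost all of the mass of their union,
so a finite intersection suffices around the complement. *)
Lemma regular_bigcup (A : (set 'rV[R]_d)^nat) :
  (forall n, regular (A n)) -> regular (\bigcup_n A n).
Proof.
move=> rA e e0.
have e2 n : 0 < e / 2 / (2 ^ n.+1)%:R by rewrite !divr_gt0// ltr0n expn_gt0.
have /choice[UV hUV] n : exists W : set 'rV[R]_d * set 'rV[R]_d,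
    [/\ open W.1, open W.2, A n `<=` W.1, ~` A n `<=` W.2 &
        (P (W.1 `&` W.2) <= (e / 2 / (2 ^ n.+1)%:R)%:E)%E].
  by have [U [V h]] := rA n _ (e2 n); exists (U, V).
pose U n := (UV n).1; pose V n := (UV n).2.
have oU n : open (U n) by case: (hUV n).
have oV n : open (V n) by case: (hUV n).
pose W N := \bigcap_(i < N) V i.
have oW N : open (W N).
  by rewrite /W bigcap_mkord; apply: big_ind => //; [exact: openT|exact: openI].
pose UU := \bigcup_n U n.
have oUU : open UU by apply: bigcup_open => n _.
pose F N := UU `\` \bigcup_(i < N) U i.
have mU n : measurable (U n) by exact: open_measurable_rV.
have [N hN] : exists N, (P (F N) <= (e / 2)%:E)%E.
  apply: nonincreasing_small; first by rewrite divr_gt0.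
  - move=> N; apply: measurableD; first exact: open_measurable_rV.
    exact: bigcup_measurable.
  - move=> m n mn; apply/subsetPset => x [Ux nx]; split => // -[i im Uix].
    by apply: nx; exists i => //=; exact: leq_trans im mn.
  - rewrite -subset0 => x h; have [[n _ Unx] _] := h 0%N I.
    by have [_] := h n.+1 I; apply; exists n => /=.
exists UU, (W N); split => //.
- by move=> x [n _ Ax]; exists n => //; case: (hUV n) => _ _ + _ _; exact.
- move=> x nA i /= _; case: (hUV i) => _ _ _ + _; apply.
  by move=> Aix; apply: nA; exists i.
- have sub : UU `&` W N `<=` F N `|` \bigcup_n (U n `&` V n).
    move=> x [UUx Wx]; have [[i iN Ux]|nU] := pselect ((\bigcup_(i < N) U i) x).
      by right; exists i => //; split => //; exact: Wx.
    by left.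
  have mF : measurable (F N).
    apply: measurableD; first exact: open_measurable_rV.
    exact: bigcup_measurable.
  have mUV : measurable (\bigcup_n (U n `&` V n)).
    by apply: bigcup_measurable => n _; apply: open_measurable_rV; exact: openI.
  apply: (@le_trans _ _ (P (F N `|` \bigcup_n (U n `&` V n)))).
    apply: le_measure => //; rewrite inE; last exact: measurableU.
    by apply: open_measurable_rV; exact: openI.
  apply: (le_trans (measureU2 _ mF mUV)).
  rewrite [e]splitr EFinD leeD//.
  apply: (@le_trans _ _ (\sum_(n <oo) P (U n `&` V n))%E).
    apply: generalized_Boole_inequality => // n.
    by apply: open_measurable_rV; exact: openI.
  have e20 : 0 <= e / 2 by rewrite divr_ge0// ltW.
  apply: le_trans (epsilon_trick0 xpredT e20).
  by apply: lee_nneseries => // n _; have [_ _ _ _ h] := hUV n; exact: h.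
Qed.

(** The regular sets form a sigma-algebra that contains the open sets. *)
Theorem measurable_regular A : measurable A -> regular A.
Proof.
move=> mA; suff : <<s open >> `<=` [set A | regular A] by apply.
apply: smallest_sub; last by move=> U; exact: open_regular.
split => /=.
- by apply: open_regular; exact: open0.
- by move=> B; rewrite setTD; exact: regular_setC.
- by move=> B; exact: regular_bigcup.
Qed.

End regularity.

(** * Norms and density of bounded continuous functions in Lp *)

Section Lnorm_lemmas.
Context dT (T : measurableType dT) (R : realType) (mu : {measure set T -> \bar R}).
Variable p : R.
Hypothesis p1 : 1 <= p.
Local Open Scope ereal_scope.
Implicit Types (f h : T -> R).

Let p0 : (0 < p)%R. Proof. exact: lt_le_trans ltr01 p1. Qed.
Let pV0 : (0 <= p^-1)%R. Proof. by rewrite invr_ge0 ltW. Qed.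

Lemma measurable_powR_norm f : measurable_fun setT f ->
  measurable_fun setT (fun x => (`|f x| `^ p)%:E).
Proof.
move=> mf; apply/measurable_EFinP.
apply: (measurableT_comp (measurable_powR p)); exact: measurableT_comp.
Qed.

Lemma LnormE f : 'N[mu]_p%:E[EFin \o f] = (\int[mu]_x (`|f x| `^ p)%:E) `^ p^-1.
Proof. by rewrite unlock /Lnorm. Qed.

Lemma integral_powR_ge0 f : 0 <= \int[mu]_x (`|f x| `^ p)%:E.
Proof. by apply: integral_ge0 => x _; rewrite lee_fin powR_ge0. Qed.

Lemma Lnorm_le_root f (c : R) : (0 <= c)%R ->
  \int[mu]_x (`|f x| `^ p)%:E <= (c `^ p)%:E -> 'N[mu]_p%:E[EFin \o f] <= c%:E.
Proof.
move=> c0 h; rewrite LnormE.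
have -> : c%:E = (c `^ p)%:E `^ p^-1.
  by rewrite poweR_EFin -powRrM divff ?lt0r_neq0// powRr1.
apply: (gt0_ler_poweR pV0) => //.
  by rewrite in_itv/= leey integral_powR_ge0.
by rewrite in_itv/= leey lee_fin powR_ge0.
Qed.

Lemma Lnorm_le f h : measurable_fun setT f -> measurable_fun setT h ->
  (forall x, `|f x| <= `|h x|)%R ->
  'N[mu]_p%:E[EFin \o f] <= 'N[mu]_p%:E[EFin \o h].
Proof.
move=> mf mh fh; rewrite !LnormE.
apply: (gt0_ler_poweR pV0); first by rewrite in_itv/= leey integral_powR_ge0.
  by rewrite in_itv/= leey integral_powR_ge0.
apply: ge0_le_integral => //.
- exact: measurable_powR_norm.
- exact: measurable_powR_norm.
- by move=> x _; rewrite lee_fin ge0_ler_powR ?nnegrE// ltW.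
Qed.

Lemma Lnorm_norm f : 'N[mu]_p%:E[EFin \o (fun x => `|f x|%R)] = 'N[mu]_p%:E[EFin \o f].
Proof. by rewrite !LnormE; under eq_integral do rewrite normr_id. Qed.

Lemma Lnorm_scale (c : R) f : measurable_fun setT f ->
  'N[mu]_p%:E[EFin \o (fun x => (c * f x)%R)] = `|c|%:E * 'N[mu]_p%:E[EFin \o f].
Proof.
move=> mf; rewrite !LnormE.
under eq_integral do rewrite normrM powRM// EFinM.
rewrite ge0_integralZl_EFin ?powR_ge0//.
- rewrite poweRM ?lee_fin ?powR_ge0 ?integral_powR_ge0//.
  by rewrite poweR_EFin -powRrM divff ?lt0r_neq0// powRr1.
- exact: measurable_powR_norm.
Qed.

Lemma Lfun_normP f : f \in Lfun mu p%:E <->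
  measurable_fun setT f /\ 'N[mu]_p%:E[EFin \o f] < +oo.
Proof.
split; last by move=> [mf Nf]; rewrite inE; apply/andP; split; rewrite inE.
by rewrite inE => /andP[/[!inE]/= mf Nf]; split => //; move: Nf; rewrite inE.
Qed.

Lemma Lnorm_add_le f h : measurable_fun setT f -> measurable_fun setT h ->
  'N[mu]_p%:E[EFin \o (fun x => (f x + h x)%R)] <=
  'N[mu]_p%:E[EFin \o f] + 'N[mu]_p%:E[EFin \o h].
Proof. by move=> mf mh; exact: (minkowski_EFin _ mf mh p1). Qed.

End Lnorm_lemmas.

Section probability_Lnorm.
Context dT (T : measurableType dT) (R : realType) (P : probability T R).
Variable p : R.
Hypothesis p1 : 1 <= p.
Local Open Scope ereal_scope.

Let p0 : (0 < p)%R. Proof. exact: lt_le_trans ltr01 p1. Qed.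

Lemma Lnorm_bounded_le (f : T -> R) (M : R) : measurable_fun setT f ->
  (forall x, `|f x| <= M)%R -> 'N[P]_p%:E[EFin \o f] <= M%:E.
Proof.
move=> mf fM.
have M0 : (0 <= M)%R by exact: le_trans (normr_ge0 _) (fM point).
apply: Lnorm_le_root => //.
apply: (@le_trans _ _ (\int[P]_x (M `^ p)%:E)).
  apply: ge0_le_integral => //.
  - exact: measurable_powR_norm.
  - by move=> x _; rewrite lee_fin ge0_ler_powR ?nnegrE// ltW.
rewrite integral_cst// -[leRHS]mule1 lee_wpmul2l ?lee_fin ?powR_ge0//.
exact: probability_le1.
Qed.

Lemma Lnorm_indic_le (f : T -> R) (A : set T) (e : R) : measurable_fun setT f ->
  measurable A -> (forall x, `|f x| <= \1_A x)%R -> (0 <= e)%R ->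
  P A <= (e `^ p)%:E -> 'N[P]_p%:E[EFin \o f] <= e%:E.
Proof.
move=> mf mA fA e0 PA; apply: Lnorm_le_root => //; apply: le_trans PA.
have <- : \int[P]_x (\1_A x)%:E = P A by rewrite integral_indic// setIT.
apply: ge0_le_integral => //.
- exact: measurable_powR_norm.
- by apply/measurable_EFinP; exact: measurable_indic.
- move=> x _; rewrite lee_fin; have := fA x; rewrite indicE.
  case: (x \in A) => /= h.
    have -> : (1 = 1 `^ p :> R)%R by rewrite powR1.
    by rewrite ge0_ler_powR ?nnegrE// ltW.
  have -> : (`|f x| = 0)%R by apply/eqP; rewrite eq_le h normr_ge0.
  by rewrite powR0// lt0r_neq0.
Qed.

End probability_Lnorm.

Section density.
Context {R : realType} {d : nat} (P : probability 'rV[R]_d R).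
Variable p : R.
Hypothesis p1 : 1 <= p.
Implicit Types (f h : 'rV[R]_d -> R).

Let p0 : 0 < p. Proof. exact: lt_le_trans ltr01 p1. Qed.

Definition Cb_approximable f := forall e : R, 0 < e ->
  exists2 h, Cb h & ('N[P]_p%:E[EFin \o (h \- f)%R] <= e%:E)%E.

Lemma approximable_add f h : measurable_fun setT f -> measurable_fun setT h ->
  Cb_approximable f -> Cb_approximable h -> Cb_approximable (f \+ h).
Proof.
move=> mf mh af ah e e0; have e2 : 0 < e / 2 by rewrite divr_gt0.
have [f1 cf1 hf1] := af _ e2; have [h1 ch1 hh1] := ah _ e2.
exists (fun x => f1 x + h1 x); first exact: CbD.
have -> : (fun x => f1 x + h1 x) \- (f \+ h) = (fun x => (f1 \- f) x + (h1 \- h) x).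
  by apply/funext => x /=; ring.
have m1 : measurable_fun setT (f1 \- f).
  by apply: measurable_funB => //; exact: Cb_measurable.
have m2 : measurable_fun setT (h1 \- h).
  by apply: measurable_funB => //; exact: Cb_measurable.
apply: (le_trans (Lnorm_add_le P p1 m1 m2)).
by rewrite [e]splitr EFinD leeD.
Qed.

Lemma approximable_scale c f : measurable_fun setT f ->
  Cb_approximable f -> Cb_approximable (fun x => c * f x).
Proof.
move=> mf af e e0; have c1 : 0 < `|c| + 1 by rewrite ltr_wpDl.
have [h ch hh] := af _ (divr_gt0 e0 c1).
exists (fun x => c * h x); first exact: CbZ.
have -> : (fun x => c * h x) \- (fun x => c * f x) = (fun x => c * (h \- f) x).
  by apply/funext => x /=; rewrite mulrBr.
rewrite Lnorm_scale//; last by apply: measurable_funB => //; exact: Cb_measurable.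
apply: (le_trans (lee_wpmul2l _ hh)) => //.
rewrite -EFinM lee_fin mulrA ler_pdivrMr// mulrC ler_wpM2l ?(ltW e0)//.
by rewrite lerDl.
Qed.

Lemma approximable_indic (A : set 'rV[R]_d) : measurable A ->
  Cb_approximable (\1_A).
Proof.
move=> mA e e0; have e2 : 0 < e `^ p / 2 by rewrite divr_gt0// powR_gt0.
have [U [V [oU oV AU AV hUV]]] := measurable_regular P mA e2.
have [n hn] := cutoff_small P oU e2; exists (cutoff U n); first exact: Cb_cutoff.
(* Off [W] the cutoff and the indicator of [A] agree. *)
pose W := (U `&` V) `|` (U `&` [set x | cutoff U n x < 1]).
have mUV : measurable (U `&` V) by apply: open_measurable_rV; exact: openI.
have mUn : measurable (U `&` [set x | cutoff U n x < 1]).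
  apply: open_measurable_rV; apply: openI; first exact: oU.
  exact: open_cutoff_lt1.
apply: (@Lnorm_indic_le _ _ _ P p p1 _ W) => //.
- apply: measurable_funB; first by apply: Cb_measurable; exact: Cb_cutoff.
  exact: measurable_indic.
- exact: measurableU.
- move=> x /=; rewrite !indicE.
  have [xW|xW] := boolP (x \in W).
    have := cutoff_ge0 U n x; have := cutoff_le1 U n x.
    by case: (x \in A) => /= ? ?; rewrite ler_norml; apply/andP; split; lra.
  have nW : ~ W x by move=> Wx; move: xW; rewrite mem_set.
  have [Ux|nU] := pselect (U x).
    have Ax : A x by apply: contrapT => nA; apply: nW; left; split => //; exact: AV.
    have b1 : cutoff U n x = 1.
      apply/eqP; rewrite eq_le cutoff_le1/= leNgt; apply/negP => b1.
      by apply: nW; right.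
    by rewrite b1 mem_set// subrr normr0.
  by rewrite cutoff_out// memNset ?subrr ?normr0// => /AU.
- exact: ltW.
- apply: (le_trans (measureU2 _ mUV mUn)).
  by rewrite [X in (X%:E)%E]splitr EFinD leeD.
Qed.

Import HBNNSimple.

Lemma approximable_simple (s : {nnsfun 'rV[R]_d >-> R}) : Cb_approximable s.
Proof.
have [k [S hS]] : exists (k : nat) (S : seq R), forall x,
    s x = \sum_(i < k) S`_i * \1_(s @^-1` [set S`_i]) x.
  by eexists; eexists; exact: fimfunEord.
rewrite (funext hS).
have m1 (i : 'I_k) : measurable_fun setT
    (fun x => S`_i * \1_(s @^-1` [set S`_i]) x : R).
  by apply: measurable_funM => //; exact: measurable_indic.
suff h (r : seq 'I_k) : Cb_approximable
    (fun x => \sum_(i <- r) S`_i * \1_(s @^-1` [set S`_i]) x) /\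
    measurable_fun setT (fun x => \sum_(i <- r) S`_i * \1_(s @^-1` [set S`_i]) x : R).
  by have [] := h (index_enum 'I_k).
elim: r => [|i r [IH1 IH2]].
  under eq_fun do rewrite big_nil.
  split => // e e0; exists (fun=> 0); first exact: Cb_cst.
  apply: (@Lnorm_bounded_le _ _ _ P p p1) => [|x /=].
    exact: measurable_funB.
  by rewrite subrr normr0 ltW.
under eq_fun do rewrite big_cons; split; last exact: measurable_funD.
apply: (approximable_add (m1 i) IH2) => //.
by apply: approximable_scale => //; exact: approximable_indic.
Qed.

Lemma powR_cvg_norm0 (r_ : R^nat) : (forall n, 0 <= r_ n) ->
  r_ @ \oo --> 0 -> (fun n => r_ n `^ p) @ \oo --> 0.
Proof.
move=> r0 /cvgrPdist_le h; apply/cvgrPdist_le => e e0.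
have e1 : 0 < e `^ p^-1 by exact: powR_gt0.
apply: filterS (h _ e1) => n; rewrite !sub0r !normrN !ger0_norm ?powR_ge0// => hn.
have -> : e = (e `^ p^-1) `^ p.
  by rewrite -powRrM mulVf ?lt0r_neq0// powRr1// ltW.
by rewrite ge0_ler_powR ?nnegrE ?powR_ge0// ltW.
Qed.

Lemma approximable_ge0 f : f \in Lfun P p%:E -> (forall x, 0 <= f x) ->
  Cb_approximable f.
Proof.
move=> Lf f0; have [mf Nf] := (Lfun_normP P p f).1 Lf.
have mfE : measurable_fun setT (EFin \o f) by exact/measurable_EFinP.
have fE0 x : setT x -> (0 <= (EFin \o f) x)%E by move=> _; rewrite lee_fin.
pose s := nnsfun_approx measurableT mfE.
have sle n x : s n x <= f x.
  by rewrite -lee_fin /s nnsfun_approxE; exact: (le_approx n fE0).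
have scvg x : (fun n => `|s n x - f x|) @ \oo --> 0.
  have h : (fun n => s n x) @ \oo --> f x.
    have /fine_cvgP[_] := cvg_nnsfun_approx measurableT mfE fE0 (x := x) Logic.I.
    by [].
  rewrite -[X in _ --> X](normr0 R) -(subrr (f x)).
  by apply: cvg_norm; apply: cvgB => //; exact: cvg_cst.
have mabs n : measurable_fun setT (fun x => s n x - f x).
  by apply: measurable_funB.
have cv x : (fun n => (`|s n x - f x| `^ p)%:E) @ \oo --> 0%E.
  have h := powR_cvg_norm0 (fun n => normr_ge0 (s n x - f x)) (scvg x).
  by apply: cvg_EFin h; apply: nearW.
have dom x n : (`| (`|s n x - f x| `^ p)%:E | <= (`|f x| `^ p)%:E)%E.
  rewrite gee0_abs ?lee_fin ?powR_ge0// ge0_ler_powR ?nnegrE ?(ltW p0)//.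
  rewrite distrC !ger0_norm ?subr_ge0//.
  by rewrite lerBlDr lerDl.
have [_ _] := @dominated_convergence _ _ _ P setT measurableT
  (fun n x => (`|s n x - f x| `^ p)%:E) (fun=> 0%E) (fun x => (`|f x| `^ p)%:E)
  (fun n => measurable_powR_norm p (mabs n)) (@measurable_cst _ _ _ _ _ _)
  (aeW P (fun x _ => cv x)) (Lfun_integrable p1 Lf)
  (aeW P (fun x n _ => dom x n)).
rewrite integral0 => /fine_cvgP[[m _ fin_m] /cvgrPdist_le lim] e e0.
have e2 : 0 < (e / 2) `^ p by rewrite powR_gt0// divr_gt0.
have [N _ hN] := lim _ e2.
pose n := maxn m N; have hn := hN n (leq_maxr _ _).
have fn : (\int[P]_x (`|s n x - f x| `^ p)%:E)%E \is a fin_num.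
  exact: fin_m n (leq_maxl _ _).
have [h ch hh] := approximable_simple (s n) (divr_gt0 e0 (ltr0Sn R 1)).
exists h => //.
have -> : h \- f = (fun x => (h \- s n) x + (s n \- f) x).
  by apply/funext => x /=; rewrite subrKA.
have mh : measurable_fun setT (h \- s n).
  by apply: measurable_funB => //; exact: Cb_measurable.
apply: (le_trans (Lnorm_add_le P p1 mh (mabs n))).
rewrite [e]splitr EFinD leeD//.
apply: (Lnorm_le_root p1); first by rewrite divr_ge0// ltW.
rewrite -[leLHS](fineK fn) lee_fin.
by move: hn; rewrite /= sub0r normrN; apply: le_trans; exact: ler_norm.
Qed.

(** Indicators are approximated by regularity of the measure, simple functions by
linearity, and nonnegative functions by dominated convergence. *)
Theorem Cb_dense_Lp f : f \in Lfun P p%:E -> Cb_approximable f.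
Proof.
move=> Lf; have [mf Nf] := (Lfun_normP P p f).1 Lf.
pose f1 x := Num.max (f x) 0; pose f2 x := Num.max (- f x) 0.
have m1 : measurable_fun setT f1 by exact: measurable_maxr.
have m2 : measurable_fun setT f2.
  by apply: measurable_maxr => //; exact: measurableT_comp.
have L1 : f1 \in Lfun P p%:E.
  apply/Lfun_normP; split => //; apply: le_lt_trans Nf; apply: Lnorm_le => // x.
  rewrite /f1; case: (leP (f x) 0) => h; last by [].
  by rewrite normr0.
have L2 : f2 \in Lfun P p%:E.
  apply/Lfun_normP; split => //; apply: le_lt_trans Nf; apply: Lnorm_le => // x.
  by rewrite /f2; case: (leP (- f x) 0) => h; rewrite ?normr0// normrN.
have -> : f = f1 \+ (fun x => -1 * f2 x).
  apply/funext => x /=; rewrite /f1 /f2 mulN1r.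
  by case: (leP (f x) 0) => h; case: (leP (- f x) 0) => h'; lra.
apply: approximable_add => //; first exact: measurable_funM.
- by apply: approximable_ge0 => // x; rewrite le_max lexx orbT.
- apply: approximable_scale => //.
  by apply: approximable_ge0 => // x; rewrite le_max lexx orbT.
Qed.

End density.

(** * Gaussian growth of the evolution of an Lp function *)

Section smoothing.
Context {R : realType} {d : nat}.
Variables (I : set R) (theta : R) (Q : R -> 'M[R]_d) (b : R -> 'rV[R]_d -> 'rV[R]_d).
Variables (G : R -> R -> ('rV[R]_d -> R) -> 'rV[R]_d -> R)
          (g : R -> R -> 'rV[R]_d -> 'rV[R]_d -> R)
          (mu : R -> probability 'rV[R]_d R).
Hypothesis theta0 : 0 < theta.
Hypothesis I_up : forall s t, I s -> s <= t -> I t.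
Hypothesis bdis : dissipative_drift I theta b.
Hypothesis hcoef : holder_coefficients I theta Q b.
Hypothesis Qell : uniformly_elliptic I Q.
Hypothesis G_evol : evolution_operator I theta Q b G.
Hypothesis g_kernel : evolution_kernel I G g.
Hypothesis mu_tight : tight_evolution_system I G mu.

Let leb := lebesgue_rV R d.

Lemma uniform_mass_radius (eps : R) : 0 < eps -> exists rad : R, 0 < rad /\
  forall t, I t -> ((1 - eps)%:E <= mu t [set x | (enorm x < rad)%R])%E.
Proof. by case: mu_tight => h _; exact: h. Qed.

Lemma enorm_ball_measurable (rad : R) : measurable [set x : 'rV[R]_d | enorm x < rad].
Proof.
apply: open_measurable_rV.
by have /continuousP := @enorm_continuous R d; move/(_ _ (@open_lt R rad)).
Qed.

Lemma sqnormB_le (x y : 'rV[R]_d) :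
  dotp (x - y) (x - y) <= 2 * (dotp x x + dotp y y).
Proof. by have := dotp_ge0 (x + y); rewrite !dotpDZ (dotpC y x); lra. Qed.

(** The Harnack inequality bounds the value at [x] by the evolution of [F ^ p] at
any point of a ball of mass at least [1/2]; by invariance the integral of the
latter is that of [F ^ p]. *)
Lemma evolution_powR_mass (p : R) : 1 < p -> exists c : R, 0 < c /\
  forall rad s r F (eps : R), (forall t, I t ->
    ((1 / 2)%:E <= mu t [set x | (enorm x < rad)%R])%E) ->
  0 < rad -> I s -> s < r -> Cb F -> 0 < eps -> (forall x, eps <= F x) -> forall x,
  ((G r s F x `^ p * expR (- (c / (r - s) * (2 * (dotp x x + rad ^+ 2)))) / 2)%:E <=
    \int[mu s]_y (F y `^ p)%:E)%E.
Proof.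
move=> p1; have p0 : 0 < p by exact: lt_trans p1.
have [c [c0 har]] := harnack_inequality theta0 I_up bdis hcoef Qell G_evol g_kernel p1.
exists c; split => // rad s r F eps half rad0 Is sr cF eps0 epsF x.
have Ir := I_up Is (ltW sr).
have cP := Cb_powR p0 eps0 cF epsF.
set k := G r s F x `^ p * _; pose B := [set x : 'rV[R]_d | enorm x < rad].
have k0 : 0 <= k by rewrite mulr_ge0 ?powR_ge0 ?expR_ge0.
have mB : measurable B by exact: enorm_ball_measurable.
have [_ inv] := mu_tight; rewrite -(inv s r _ Is Ir sr cP).
have cGP := evolution_Cb G_evol Is (ltW sr) cP.
have GP0 y : 0 <= G r s (fun z => F z `^ p) y.
  by apply: (evolution_ge0 I_up G_evol g_kernel _ Is (ltW sr) cP) => z; exact: powR_ge0.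
apply: (@le_trans _ _ (\int[mu r]_y (k%:E * (\1_B y)%:E))%E).
  rewrite ge0_integralZl_EFin//; last first.
    by apply/measurable_EFinP; exact: measurable_indic.
  rewrite integral_indic// setIT EFinM lee_wpmul2l ?lee_fin//.
  by have := half r Ir; rewrite mul1r.
apply: ge0_le_integral => //.
- by move=> y _; rewrite -EFinM lee_fin mulr_ge0.
- apply: measurable_funeM; apply/measurable_EFinP; exact: measurable_indic.
- by apply/measurable_EFinP; exact: Cb_measurable.
move=> y _; rewrite -EFinM lee_fin indicE.
have [yB|nyB] := boolP (y \in B); last by rewrite mulr0 GP0.
rewrite mulr1 /k expRN ler_pdivrMr ?expR_gt0//.
apply: (le_trans (har s r F eps Is sr cF eps0 epsF x y)).
rewrite ler_wpM2l ?GP0// ler_expR mulrAC ler_wpM2l//.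
  by rewrite divr_ge0 ?(ltW c0)// subr_ge0 ltW.
apply: (le_trans (sqnormB_le x y)); rewrite ler_wpM2l// lerD2l -sqr_enorm.
by rewrite lerXn2r ?nnegrE ?enorm_ge0 ?(ltW rad0)//; move/set_mem: yB => /ltW.
Qed.

(** The [p]-th root of the preceding bound, with one ball for all times by
tightness. *)
Lemma evolution_gaussian_growth (p tau : R) : 1 < p -> 0 < tau ->
  exists lam A : R, [/\ 0 < lam, 0 < A & forall s F (eps : R), I s -> Cb F ->
  0 < eps -> (forall x, eps <= F x) -> forall x,
  ((G (s + tau) s F x)%:E <=
    (A * phi_exp lam x)%:E * 'N[mu s]_p%:E[EFin \o F])%E].
Proof.
move=> p1 tau0; have p0 : 0 < p by exact: lt_trans p1.
have [c [c0 h]] := evolution_powR_mass p1.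
have [rad [rad0 half]] := @uniform_mass_radius (1 / 2) (divr_gt0 ltr01 (ltr0Sn R 1)).
have half' t : I t -> ((1 / 2)%:E <= mu t [set x | (enorm x < rad)%R])%E.
  by move=> It; have := half t It; congr (_ <= _)%E; congr EFin; lra.
pose k := 2 * c / tau; have k0 : 0 < k by rewrite divr_gt0// mulr_gt0.
exists (k / p), (2 `^ p^-1 * expR (k / p * rad ^+ 2)); split.
- by rewrite divr_gt0.
- by rewrite mulr_gt0 ?powR_gt0 ?expR_gt0.
move=> s F eps Is cF eps0 epsF x.
have sr : s < s + tau by rewrite ltrDl.
have F0 y : 0 <= F y by rewrite (le_trans (ltW eps0)).
have := h rad s (s + tau) F eps half' rad0 Is sr cF eps0 epsF x.
rewrite (_ : s + tau - s = tau); last by rewrite addrC addKr.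
rewrite (_ : c / tau * _ = k * (dotp x x + rad ^+ 2)); last by rewrite /k; ring.
set E := expR _; set J := (\int[mu s]_y _)%E => hJ.
have JE : J = (\int[mu s]_y (`|F y| `^ p)%:E)%E.
  by apply: eq_integral => y _; rewrite ger0_norm.
rewrite LnormE -JE.
have G0 : 0 <= G (s + tau) s F x.
  exact: (evolution_ge0 I_up G_evol g_kernel _ Is (ltW sr) cF).
have E0 : 0 < E by exact: expR_gt0.
have root : G (s + tau) s F x = (2 / E) `^ p^-1 *
    (G (s + tau) s F x `^ p * E / 2) `^ p^-1.
  rewrite -powRM ?divr_ge0 ?mulr_ge0 ?powR_ge0 ?(ltW E0)//.
  rewrite (_ : _ * _ = G (s + tau) s F x `^ p); last by field; rewrite lt0r_neq0.
  by rewrite -powRrM divff ?lt0r_neq0// powRr1.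
rewrite [leLHS](congr1 EFin root) EFinM.
have -> : (2 / E) `^ p^-1 = 2 `^ p^-1 * expR (k / p * rad ^+ 2) * phi_exp (k / p) x.
  rewrite powRM ?invr_ge0 ?(ltW E0)// -mulrA -expRD /E -expRN opprK; congr (_ * _).
  rewrite -expRM sqr_enorm; congr expR; rewrite -mulrA [_ * p^-1]mulrC; ring.
rewrite lee_wpmul2l ?lee_fin ?mulr_ge0 ?powR_ge0 ?expR_ge0//.
rewrite -poweR_EFin; apply: gt0_ler_poweR => //.
- by rewrite invr_ge0 ltW.
- by rewrite in_itv/= leey lee_fin divr_ge0 ?mulr_ge0 ?powR_ge0 ?(ltW E0).
- by rewrite in_itv/= leey andbT integral_ge0// => y _; rewrite lee_fin powR_ge0.
Qed.

End smoothing.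

(** * From Gaussian bounds to a uniform bound by the Lp norm *)

Section ultrabounded_estimate.
Context {R : realType} {d : nat}.
Variables (I : set R) (theta : R) (Q : R -> 'M[R]_d) (b : R -> 'rV[R]_d -> 'rV[R]_d).
Variables (G : R -> R -> ('rV[R]_d -> R) -> 'rV[R]_d -> R)
          (g : R -> R -> 'rV[R]_d -> 'rV[R]_d -> R)
          (mu : R -> probability 'rV[R]_d R).
Hypothesis theta0 : 0 < theta.
Hypothesis I_up : forall s t, I s -> s <= t -> I t.
Hypothesis bdis : dissipative_drift I theta b.
Hypothesis hcoef : holder_coefficients I theta Q b.
Hypothesis Qell : uniformly_elliptic I Q.
Hypothesis G_evol : evolution_operator I theta Q b G.
Hypothesis g_kernel : evolution_kernel I G g.
Hypothesis mu_tight : tight_evolution_system I G mu.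

Let leb := lebesgue_rV R d.

(** The essential supremum is only meaningful on a space of positive measure;
here Lebesgue measure has a probability density. *)
Lemma lebesgue_setT_gt0 s : I s -> (0 < leb setT)%E.
Proof.
move=> Is; have It : I (s + 1) by apply: I_up Is _; rewrite lerDl.
have ss : s < s + 1 by rewrite ltrDl.
have [mg g0 g1 _] := g_kernel 0 Is It ss.
rewrite lt0e measure_ge0 andbT; apply/eqP => leb0.
have mgE : measurable_fun setT (fun y => (g (s + 1) s 0 y)%:E) by exact/measurable_EFinP.
have := null_set_integral measurableT mgE leb0.
by rewrite g1 => /eqP; rewrite onee_eq0.
Qed.

Lemma Linfty_norm_leP s (u : 'rV[R]_d -> \bar R) (K : \bar R) : I s ->
  (Linfty_norm u <= K)%E <-> {ae leb, forall x, (`|u x| <= K)%E}.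
Proof.
move=> Is; rewrite /Linfty_norm unlock /Lnorm (lebesgue_setT_gt0 Is).
split; first by move/ess_supP.
by move=> h; apply/ess_supP.
Qed.

(** A bound almost everywhere becomes a bound everywhere after one more step of
the evolution, because [G t r] integrates against a density. *)
Lemma evolution_ae_le r t f (K : R) x : I r -> r < t -> Cb f -> (forall y, 0 <= f y) ->
  0 <= K -> {ae leb, forall y, f y <= K} -> G t r f x <= K.
Proof.
move=> Ir rt cf f0 K0 fK; have It := I_up Ir (ltW rt).
have [mg g0 g1 _] := g_kernel x Ir It rt.
rewrite -lee_fin (evolution_kernelE g_kernel)//.
have mK : measurable_fun setT (fun y => K%:E * (g t r x y)%:E)%E.
  by apply: measurable_funeM; exact/measurable_EFinP.
apply: (@le_trans _ _ (\int[leb]_y (K%:E * (g t r x y)%:E))%E).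
  apply: ae_ge0_le_integral => //.
  - by move=> y _; rewrite lee_fin mulr_ge0// ltW.
  - apply/measurable_EFinP; apply: measurable_funM => //; exact: Cb_measurable.
  - by move=> y _; rewrite -EFinM lee_fin mulr_ge0// ltW.
  - apply: filterS fK => y fy _; rewrite -EFinM lee_fin mulrC.
    by rewrite ler_wpM2r// ltW.
rewrite ge0_integralZl_EFin//.
- by rewrite g1 mule1.
- by move=> y _; rewrite lee_fin ltW.
- exact/measurable_EFinP.
Qed.

Lemma measurable_phi_exp (lam : R) : measurable_fun setT (@phi_exp R d lam).
Proof.
apply: continuous_measurable_rV => x.
have h : (fun y : 'rV[R]_d => lam * enorm y ^+ 2) @ nbhs x --> lam * enorm x ^+ 2.
  under eq_fun do rewrite sqr_enorm; rewrite sqr_enorm.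
  by apply: cvgM; [exact: cvg_cst|exact: sqnorm_continuous].
exact: (cvg_comp _ _ h (@continuous_expR R _)).
Qed.

Lemma kernel_integral_le_scale r t f (C lam : R) x : I r -> r < t -> Cb f ->
  (forall y, 0 <= f y) -> 0 <= C -> (forall y, f y <= C * phi_exp lam y) ->
  ((G t r f x)%:E <= C%:E * kernel_integral g t r (phi_exp lam) x)%E.
Proof.
move=> Ir rt cf f0 C0 fC; have It := I_up Ir (ltW rt).
have [mg g0 _ _] := g_kernel x Ir It rt.
have mphi := measurable_phi_exp lam.
rewrite (evolution_kernelE g_kernel)// /kernel_integral -ge0_integralZl_EFin//; last 2 first.
- by move=> y _; rewrite lee_fin mulr_ge0 ?expR_ge0// ltW.
- by apply/measurable_EFinP; exact: measurable_funM.
apply: ge0_le_integral => //.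
- by move=> y _; rewrite lee_fin mulr_ge0// ltW.
- apply/measurable_EFinP; apply: measurable_funM => //; exact: Cb_measurable.
- by apply: measurable_funeM; apply/measurable_EFinP; exact: measurable_funM.
- by move=> y _; rewrite -EFinM lee_fin mulrCA ler_wpM2l// ltW.
Qed.

Definition phi_uniform_bound := forall delta lam : R, 0 < delta -> 0 < lam ->
  exists K : R, 0 < K /\ forall s t : R, I s -> I t -> delta <= t - s ->
    (Linfty_norm (kernel_integral g t s (phi_exp lam)) <= K%:E)%E.

(** Three steps of length at least [delta / 3]: the first yields a Gaussian
bound, the second turns it into a bound almost everywhere by hypothesis, the
third into a bound everywhere. *)
Theorem evolution_Lp_sup_bound (p delta : R) : phi_uniform_bound ->
  1 < p -> 0 < delta -> exists K : R, 0 < K /\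
  forall s t f x, I s -> delta <= t - s -> Cb f ->
    (`|G t s f x|%:E <= K%:E * 'N[mu s]_p%:E[EFin \o f])%E.
Proof.
move=> hphi p1 delta0; have p0 : 0 < p by exact: lt_trans p1.
pose tau := delta / 3; have tau0 : 0 < tau by rewrite divr_gt0.
have [lam [A [lam0 A0 growth]]] := evolution_gaussian_growth theta0 I_up bdis
  hcoef Qell G_evol g_kernel mu_tight p1 tau0.
have [K [K0 hK]] := hphi tau lam tau0 lam0.
exists (A * K); split; first exact: mulr_gt0.
move=> s t f x Is dts cf.
pose r1 := s + tau; pose r2 := r1 + tau.
have sr1 : s < r1 by rewrite ltrDl.
have r12 : r1 < r2 by rewrite ltrDl.
have r2t : r2 < t.
  by rewrite /r2 /r1 -addrA -ltrBrDl (lt_le_trans _ dts)// /tau; lra.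
have Ir1 := I_up Is (ltW sr1); have Ir2 := I_up Ir1 (ltW r12).
have sr2 := lt_trans sr1 r12; have st := lt_trans sr2 r2t.
have mf := Cb_measurable cf.
(* [|f| + eps] replaces [f], because the Harnack inequality needs a positive lower bound. *)
have key (eps : R) : 0 < eps ->
    (`|G t s f x|%:E <= (A * K)%:E * ('N[mu s]_p%:E[EFin \o f] + eps%:E))%E.
  move=> eps0; pose F y := `|f y| + eps.
  have cF : Cb F by apply: CbD; [exact: Cb_norm|exact: Cb_cst].
  have epsF y : eps <= F y by rewrite lerDr.
  have F0 y : 0 <= F y by rewrite (le_trans (ltW eps0)).
  have [_ [M hM]] := cF.
  have NF : ('N[mu s]_p%:E[EFin \o F] <= M%:E)%E.
    by apply: Lnorm_bounded_le => //; [exact: ltW|exact: Cb_measurable].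
  have NFfin : ('N[mu s]_p%:E[EFin \o F])%E \is a fin_num.
    by rewrite ge0_fin_numE ?Lnorm_ge0// (le_lt_trans NF)// ltry.
  pose n := fine ('N[mu s]_p%:E[EFin \o F])%E.
  have nE : n%:E = ('N[mu s]_p%:E[EFin \o F])%E by rewrite fineK.
  have n0 : 0 <= n by rewrite fine_ge0// Lnorm_ge0.
  have cG1 := evolution_Cb G_evol Is (ltW sr1) cF.
  have cG2 := evolution_Cb G_evol Is (ltW sr2) cF.
  have G10 y : 0 <= G r1 s F y by exact: (evolution_ge0 I_up G_evol g_kernel _ Is (ltW sr1) cF).
  have G20 y : 0 <= G r2 s F y by exact: (evolution_ge0 I_up G_evol g_kernel _ Is (ltW sr2) cF).
  have G1le y : G r1 s F y <= A * n * phi_exp lam y.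
    have := growth s F eps Is cF eps0 epsF y.
    by rewrite -nE -EFinM lee_fin mulrAC.
  have G2le : {ae leb, forall y, G r2 s F y <= A * n * K}.
    have tr : tau <= r2 - r1 by rewrite /r2 addrC addKr.
    have := hK r1 r2 Ir1 Ir2 tr; move/(Linfty_norm_leP _ _ Is).1.
    apply: filterS => y hy.
    have An0 : 0 <= A * n by rewrite mulr_ge0// ltW.
    rewrite -lee_fin (evolution_comp I_up G_evol _ Is (ltW sr1) (ltW r12) cF).
    apply: (le_trans (kernel_integral_le_scale _ Ir1 r12 cG1 G10 An0 G1le)).
    rewrite [(A * n * K)%:E]EFinM lee_wpmul2l ?lee_fin//.
    by apply: le_trans hy; exact: lee_abs.
  have AnK : 0 <= A * n * K by rewrite !mulr_ge0// ltW.
  have Gle : G t s F x <= A * n * K.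
    rewrite (evolution_comp I_up G_evol _ Is (ltW sr2) (ltW r2t) cF).
    exact: (evolution_ae_le _ Ir2 r2t cG2 G20 AnK G2le).
  apply: (@le_trans _ _ (A * n * K)%:E).
    rewrite lee_fin (le_trans _ Gle)//.
    apply: (le_trans (evolution_norm_le I_up G_evol g_kernel _ Is (ltW st) cf)).
    apply: (evolution_le I_up G_evol g_kernel _ Is (ltW st)) => //.
      exact: Cb_norm.
    by move=> y; rewrite /F lerDl ltW.
  rewrite mulrAC EFinM nE lee_wpmul2l ?lee_fin ?mulr_ge0 ?(ltW A0) ?(ltW K0)//.
  apply: (le_trans (Lnorm_add_le _ (ltW p1) _ _)).
  - exact: measurableT_comp.
  - exact: measurable_cst.
  rewrite Lnorm_norm leeD2l//.
  by apply: Lnorm_bounded_le => //; [exact: ltW|move=> y; rewrite gtr0_norm].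
have [Noo|Nfin] := eqVneq ('N[mu s]_p%:E[EFin \o f])%E +oo%E.
  by rewrite Noo gt0_muley ?leey// lte_fin mulr_gt0.
have Nf : ('N[mu s]_p%:E[EFin \o f])%E \is a fin_num.
  by rewrite ge0_fin_numE ?Lnorm_ge0// ltey.
rewrite -(fineK Nf) -EFinM lee_fin.
apply: (@le_vanishing_slope R _ _ (A * K)) => e /andP[e0 _].
have := key e e0; rewrite -(fineK Nf) -EFinD -EFinM lee_fin mulrDr.
by rewrite [e * _]mulrC.
Qed.

End ultrabounded_estimate.

(** * Extension of the bound from continuous functions to Lp *)

Section ultraboundedness.
Context {R : realType} {d : nat}.
Variables (I : set R) (theta : R) (Q : R -> 'M[R]_d) (b : R -> 'rV[R]_d -> 'rV[R]_d).
Variables (G : R -> R -> ('rV[R]_d -> R) -> 'rV[R]_d -> R)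
          (g : R -> R -> 'rV[R]_d -> 'rV[R]_d -> R)
          (mu : R -> probability 'rV[R]_d R).
Hypothesis I_up : forall s t, I s -> s <= t -> I t.
Hypothesis G_evol : evolution_operator I theta Q b G.
Hypothesis g_kernel : evolution_kernel I G g.

Let leb := lebesgue_rV R d.

Lemma kernel_integral_monotone s t x (f_ : nat -> 'rV[R]_d -> R) (f : 'rV[R]_d -> R) :
  I s -> I t -> s < t -> (forall n, measurable_fun setT (f_ n)) ->
  (forall n y, 0 <= f_ n y) -> (forall y, nondecreasing_seq (f_ ^~ y)) ->
  (forall y, f_ ^~ y @ \oo --> f y) ->
  (fun n => kernel_integral g t s (f_ n) x) @ \oo --> kernel_integral g t s f x.
Proof.
move=> Is It st mf f0 ndf cf; have [mg g0 _ _] := g_kernel x Is It st.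
have := @cvg_monotone_convergence _ _ R leb setT measurableT
  (fun n y => (g t s x y * f_ n y)%:E) _ _ _.
have -> : (fun y => limn (fun n => (g t s x y * f_ n y)%:E)) =
    (fun y => (g t s x y * f y)%:E).
  apply/funext => y; apply/cvg_lim => //; apply: cvg_EFin; first exact: nearW.
  by apply: cvgM; [exact: cvg_cst|exact: cf].
apply.
- by move=> n; apply/measurable_EFinP; exact: measurable_funM.
- by move=> n y _; rewrite lee_fin mulr_ge0// ltW.
- by move=> y _ m n mn; rewrite lee_fin ler_wpM2l ?(ltW (g0 y))//; exact: ndf.
Qed.

Variable p : R.
Hypothesis p1 : 1 < p.

Let p0 : 0 < p. Proof. exact: lt_trans p1. Qed.

(** The bound at every point, for continuous functions only and without sign. *)
Definition Lp_sup_bound (delta K : R) := 0 < K /\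
  forall s t f x, I s -> delta <= t - s -> Cb f ->
    (`|G t s f x|%:E <= K%:E * 'N[mu s]_p%:E[EFin \o f])%E.

(** The bound applied to the cutoffs of [U], whose [L^p] norms are controlled by
the mass of [U]. *)
Lemma kernel_open_le (t K e x : _) (U : set 'rV[R]_d) : I t -> Lp_sup_bound 1 K ->
  open U -> 0 <= e -> (mu t U <= (e `^ p)%:E)%E ->
  (kernel_integral g (t + 1) t (\1_U) x <= (K * e)%:E)%E.
Proof.
move=> It [K0 hK] oU e0 mU.
have tt : t < t + 1 by rewrite ltrDl.
have It1 := I_up It (ltW tt).
have cv : (fun n => kernel_integral g (t + 1) t (cutoff U n) x) @ \oo -->
    kernel_integral g (t + 1) t (\1_U) x.
  apply: kernel_integral_monotone => //.
  - by move=> n; apply: Cb_measurable; exact: Cb_cutoff.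
  - by move=> n y; exact: cutoff_ge0.
  - by move=> y; exact: cutoff_nondecreasing.
  - by move=> y; exact: cutoff_cvg.
have <- := cvg_lim (@ereal_hausdorff R) cv.
apply: lime_le; first by apply/cvg_ex; eexists; exact: cv.
apply: nearW => n; have cU := @Cb_cutoff R d U n.
rewrite -(evolution_kernelE g_kernel)// EFinM.
apply: (@le_trans _ _ (`|G (t + 1) t (cutoff U n) x|%:E)).
  by rewrite lee_fin ler_norm.
have tt1 : 1 <= t + 1 - t by rewrite addrC addKr.
apply: (le_trans (hK t (t + 1) _ x It tt1 cU)).
rewrite lee_wpmul2l ?lee_fin ?(ltW K0)//.
apply: (@Lnorm_indic_le _ _ _ (mu t) p (ltW p1) _ U) => //.
- exact: Cb_measurable.
- exact: open_measurable_rV.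
- move=> y; rewrite ger0_norm ?cutoff_ge0// indicE.
  have [yU|yU] := boolP (y \in U); first exact: cutoff_le1.
  by rewrite cutoff_out// => Uy; move: yU; rewrite mem_set.
Qed.

(** By outer regularity of [mu t] and the smoothing bound, the transition
probabilities from time [t] to [t + 1], whose densities are positive, give no mass
to a [mu t]-null set. *)
Lemma lebesgue_abs_continuous t K (A : set 'rV[R]_d) : I t -> Lp_sup_bound 1 K ->
  measurable A -> mu t A = 0%E -> leb A = 0%E.
Proof.
move=> It hK mA A0.
have tt : t < t + 1 by rewrite ltrDl.
have It1 := I_up It (ltW tt).
have [mg g0 _ _] := g_kernel 0 It It1 tt.
have m1 (B : set 'rV[R]_d) : measurable B -> measurable_fun setT
    (fun y => (g (t + 1) t 0 y * \1_B y)%:E).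
  by move=> mB; apply/measurable_EFinP; apply: measurable_funM => //; exact: measurable_indic.
have small (e : R) : 0 < e -> (kernel_integral g (t + 1) t (\1_A) 0 <= (K * e)%:E)%E.
  move=> e0; have ep : 0 < e `^ p by exact: powR_gt0.
  have [U [V [oU oV AU AV UV]]] := measurable_regular (mu t) mA ep.
  have mU := open_measurable_rV oU.
  have mUV : measurable (U `&` V) by apply: open_measurable_rV; exact: openI.
  apply: (@le_trans _ _ (kernel_integral g (t + 1) t (\1_U) 0)).
    apply: ge0_le_integral => //.
    - by move=> y _; rewrite lee_fin mulr_ge0// ltW.
    - exact: m1.
    - exact: m1.
    - move=> y _; rewrite lee_fin ler_wpM2l ?(ltW (g0 y))// !indicE.
      have [yA|//] := boolP (y \in A).
      by rewrite mem_set//; exact: AU (set_mem yA).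
  apply: kernel_open_le => //; first exact: ltW.
  apply: (@le_trans _ _ (mu t (A `|` (U `&` V)))).
    apply: le_measure; rewrite ?inE//; first exact: measurableU.
    move=> y Uy; have [Ay|nA] := pselect (A y); [by left|right].
    by split => //; exact: AV.
  apply: (le_trans (measureU2 _ mA mUV)).
  apply: (@le_trans _ _ (0 + (e `^ p)%:E)%E); last by rewrite add0e.
  by apply: leeD => //; exact: (eq_ind_r (fun z => (z <= 0)%E) (lexx 0%E) A0).
have k0 : (\int[leb]_y `|(g (t + 1) t 0 y * \1_A y)%:E|)%E = 0%E.
  rewrite (eq_integral (fun y => (g (t + 1) t 0 y * \1_A y)%:E)); last first.
    by move=> y _; rewrite gee0_abs// lee_fin mulr_ge0// ltW.
  apply/eqP; rewrite eq_le integral_ge0 ?andbT; last first.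
    by move=> y _; rewrite lee_fin mulr_ge0// ltW.
  case: hK => K0 _; apply/lee_addgt0Pr => e e0; rewrite add0e.
  have := small (e / K) (divr_gt0 e0 K0).
  by rewrite mulrC divfK// lt0r_neq0.
have /(ae_eq_integral_abs leb measurableT (m1 A mA)) ae0 := k0.
apply: measure_negligible => //.
apply: negligibleS ae0 => y Ay /= /(_ Logic.I) [].
rewrite indicE mem_set// mulr1 => h.
by have := g0 y; rewrite h ltxx.
Qed.

Lemma ae_lebesgue_of_ae t K (A : set 'rV[R]_d) : I t -> Lp_sup_bound 1 K ->
  {ae mu t, forall x, A x} -> {ae leb, forall x, A x}.
Proof.
move=> It hK [N [mN N0 AN]]; exists N; split => //.
exact: (lebesgue_abs_continuous It hK).
Qed.

Lemma Cb_Lfun s f : Cb f -> f \in Lfun (mu s) p%:E.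
Proof.
move=> cf; have mf := Cb_measurable cf; have [_ [M fM]] := cf.
apply/Lfun_normP; split => //.
by rewrite (le_lt_trans (Lnorm_bounded_le _ (ltW p1) mf fM))// ltry.
Qed.

Lemma uniform_cauchy_limit (T : Type) (F : nat -> T -> R) (a : nat -> R) :
  a @ \oo --> 0 -> (forall n m x, `|F n x - F m x| <= a n + a m) ->
  exists u : T -> R, (forall x, F ^~ x @ \oo --> u x) /\
    forall n x, `|F n x - u x| <= a n.
Proof.
move=> a0 hF.
have cv x : cvg (F ^~ x @ \oo).
  apply/cauchy_cvgP/cauchyP => e e0.
  have e2 : 0 < e / 2 by rewrite divr_gt0.
  have /cvgrPdist_lt /(_ _ e2) [N _ hN] := a0.
  exists (F N x); exists N => //= n Nn; rewrite /ball /=.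
  apply: le_lt_trans (hF _ _ _) _; rewrite [e]splitr.
  have h1 := hN n Nn; have h2 := hN N (leqnn N).
  move: h1 h2; rewrite /= !sub0r !normrN => h1 h2.
  by apply: ltrD; apply: le_lt_trans (ler_norm _) _.
exists (fun x => lim (F ^~ x @ \oo)); split => // n x.
have h : (fun m => `|F n x - F m x| - a m) @ \oo -->
    `|F n x - lim (F ^~ x @ \oo)| - 0.
  apply: cvgB => //; apply: cvg_norm; apply: cvgB; first exact: cvg_cst.
  exact: cv.
rewrite subr0 in h; have <- := cvg_lim (@Rhausdorff R) h.
apply: limr_le; first by apply/cvg_ex; eexists; exact: h.
by apply: nearW => m; rewrite lerBlDr.
Qed.

Lemma squeeze_cvge0 (x_ : nat -> \bar R) (a : nat -> R) : a @ \oo --> 0 ->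
  (forall n, (0 <= x_ n <= (a n)%:E)%E) -> x_ @ \oo --> 0%E.
Proof.
move=> a0 h; apply: (@squeeze_cvge _ _ _ _ (fun=> 0%E) _ (EFin \o a)).
- exact: nearW.
- exact: cvg_cst.
- by apply: cvg_EFin a0; exact: nearW.
Qed.

(** The images of approximating continuous functions are Cauchy uniformly, and
their uniform limit is the image of [f]. *)
Lemma Lp_sup_bound_maps s t K : I s -> s < t -> Lp_sup_bound (t - s) K ->
  maps_Lp_Linfty G mu p t s.
Proof.
move=> Is st [K0 hK] f Lf; have It := I_up Is (ltW st).
have [mf Nf] := (Lfun_normP (mu s) p f).1 Lf.
pose a (n : nat) : R := n.+1%:R^-1.
have a0 n : 0 < a n by rewrite invr_gt0 ltr0n.
have /choice[fn hfn] n : exists h, Cb h /\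
    ('N[mu s]_p%:E[EFin \o (h \- f)%R] <= (a n)%:E)%E.
  by have [h ch hh] := Cb_dense_Lp (ltW p1) Lf (a0 n); exists h.
have cfn n : Cb (fn n) by case: (hfn n).
have mfn n := Cb_measurable (cfn n).
pose F n := G t s (fn n).
have cF n : Cb (F n) := evolution_Cb G_evol Is (ltW st) (cfn n).
have acv : a @ \oo --> 0 by exact: cvg_harmonic.
have Kacv : (fun n => K * a n) @ \oo --> 0.
  by rewrite -(mulr0 K); apply: cvgM => //; exact: cvg_cst.
have cauchyF n m x : `|F n x - F m x| <= K * a n + K * a m.
  rewrite -mulrDr -lee_fin EFinM.
  rewrite /F -(evolutionB I_up G_evol g_kernel _ Is (ltW st) (cfn n) (cfn m)).
  apply: (le_trans (hK s t _ x Is (lexx _) (CbB (cfn n) (cfn m)))).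
  rewrite lee_wpmul2l ?lee_fin ?(ltW K0)//.
  have m1 : measurable_fun setT (fn n \- f) by exact: measurable_funB.
  have m2 : measurable_fun setT (fn m \- f) by exact: measurable_funB.
  have m3 : measurable_fun setT (fun x => -1 * (fn m \- f) x).
    exact: measurable_funM.
  have -> : (fun y => fn n y - fn m y) =
      (fun y => (fn n \- f) y + (-1 * (fn m \- f) y)).
    by apply/funext => y /=; ring.
  apply: (le_trans (Lnorm_add_le _ (ltW p1) m1 m3)).
  rewrite (Lnorm_scale _ (ltW p1) _ m2) normrN1 mul1e EFinD.
  by apply: leeD; [case: (hfn n)|case: (hfn m)].
have [u [uF ua]] := uniform_cauchy_limit Kacv cauchyF.
have mu_ : measurable_fun setT u.
  apply: (@measurable_fun_cvg _ _ _ setT (fun n => F n)) => // n.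
  exact: Cb_measurable.
have [M hM] : exists M, forall x, `|u x| <= M.
  have [_ [M hM]] := cF 0%N; exists (M + K * a 0%N) => x.
  rewrite (_ : u x = F 0%N x - (F 0%N x - u x)); last by ring.
  by rewrite (le_trans (ler_normB _ _))// lerD.
exists u; split; first split => //.
- apply/Lfun_normP; split => //.
  by rewrite (le_lt_trans (Lnorm_bounded_le _ (ltW p1) mu_ hM))// ltry.
- exists fn; split => //.
    by apply: (squeeze_cvge0 acv) => n; rewrite Lnorm_ge0; case: (hfn n).
  apply: (squeeze_cvge0 Kacv) => n; rewrite Lnorm_ge0/=.
  apply: (Lnorm_bounded_le _ (ltW p1)); last by move=> x; exact: ua.
  by apply: measurable_funB => //; exact: Cb_measurable (cF n).
- split; first exact/measurable_EFinP.
  apply: (@le_lt_trans _ _ M%:E); last exact: ltry.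
  apply/(Linfty_norm_leP I_up g_kernel _ _ Is); apply: aeW => x.
  by rewrite lee_fin.
Qed.

(** The image of [f] is determined up to a [mu t]-null set, whereas its norm refers
to Lebesgue measure: the second is absolutely continuous with respect to the
first. The bound on [u] itself follows because an approximation exceeds
[K + 1/2] nowhere, so that it stays away from [u] where [|u| > K + 1]. *)
Lemma Lp_sup_bound_norm s t K1 r K : I s -> s < t -> Lp_sup_bound 1 K1 ->
  Lp_sup_bound r K -> r <= t - s ->
  (norm_Lp_Linfty G mu p t s <= (K + 1)%:E)%E.
Proof.
move=> Is st hK1 [K0 hK] rts; have It := I_up Is (ltW st).
apply: ge_ereal_sup => _ [f [u [[Lf Lu [fn [cfn fcv Gcv]]] Nf1 ->]]].
have [mf Nf] := (Lfun_normP (mu s) p f).1 Lf.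
have [mu_ Nu] := (Lfun_normP (mu t) p u).1 Lu.
apply/(Linfty_norm_leP I_up g_kernel _ _ Is).
apply: (ae_lebesgue_of_ae It hK1).
pose A := [set x | K + 1 < `|u x|].
have mA : measurable A.
  have m1 : measurable_fun setT (fun x => `|u x|) by exact: measurableT_comp.
  have := m1 measurableT _ (measurable_itv `]K + 1, +oo[); rewrite setTI.
  by congr measurable; apply/seteqP; split => x /=; rewrite in_itv/= andbT.
have mh : measurable_fun setT (fun x => 1 / 2 * \1_A x : R).
  by apply: measurable_funM => //; exact: measurable_indic.
have hle : \forall n \near \oo,
    ('N[mu t]_p%:E[EFin \o (fun x => 1 / 2 * \1_A x)%R] <=
     'N[mu t]_p%:E[EFin \o (G t s (fn n) \- u)%R])%E.
  have e0 : 0 < 1 / 2 / K by rewrite !divr_gt0.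
  have : \forall n \near \oo, ('N[mu s]_p%:E[EFin \o (fn n \- f)%R] <= (1 / 2 / K)%:E)%E.
    move/fine_cvgP : fcv => [ffin /cvgrPdist_le /(_ _ e0)].
    apply: filterS2 ffin => n fn_; rewrite /= sub0r normrN.
    rewrite ger0_norm ?fine_ge0 ?Lnorm_ge0// => h.
    by rewrite -(fineK fn_) lee_fin.
  apply: filterS => n hn.
  have cG := evolution_Cb G_evol Is (ltW st) (cfn n).
  apply: (Lnorm_le _ (ltW p1)) => //.
    by apply: measurable_funB => //; exact: Cb_measurable cG.
  move=> x; rewrite indicE; have [xA|xA] := boolP (x \in A); last first.
    by rewrite mulr0 normr0.
  have /= uA := set_mem xA.
  have mfn := Cb_measurable (cfn n).
  have Gx : `|G t s (fn n) x| <= K + 1 / 2.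
    rewrite -lee_fin; apply: (le_trans (hK s t _ x Is rts (cfn n))).
    have m1 : measurable_fun setT (fn n \- f) by exact: measurable_funB.
    have Nfn : ('N[mu s]_p%:E[EFin \o fn n] <= (1 / 2 / K)%:E + 1)%E.
      have -> : fn n = (fun y => (fn n \- f) y + f y).
        by apply/funext => y /=; rewrite subrK.
      by apply: (le_trans (Lnorm_add_le _ (ltW p1) m1 mf)); exact: leeD.
    apply: (le_trans (lee_wpmul2l _ Nfn)); first by rewrite lee_fin ltW.
    rewrite -EFinD -EFinM lee_fin mulrDr mulr1 addrC lerD2l.
    by rewrite mulrC divfK// lt0r_neq0.
  rewrite mulr1 ger0_norm; last by rewrite divr_ge0.
  have hd : `|u x| - `|G t s (fn n) x| <= `|(G t s (fn n) \- u) x|.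
    by rewrite /= distrC; exact: lerB_dist.
  apply: le_trans hd; rewrite lerBrDr (le_trans _ (ltW uA))//.
  by apply: (le_trans (lerD (lexx _) Gx)); lra.
have N0 : 'N[mu t]_p%:E[EFin \o (fun x => 1 / 2 * \1_A x)%R]%E = 0%E.
  apply/eqP; rewrite eq_le Lnorm_ge0 andbT.
  have <- := cvg_lim (@ereal_hausdorff R) Gcv.
  by apply: lime_ge => //; apply/cvg_ex; eexists; exact: Gcv.
have mhE : measurable_fun setT (EFin \o (fun x => 1 / 2 * \1_A x : R)).
  by apply/measurable_EFinP; exact: mh.
have p0' : (0 < p%:E)%E by rewrite lte_fin.
have := Lnorm_eq0_eq0 mhE p0' N0.
apply: filterS => x /= /(_ Logic.I) [] h; rewrite lee_fin leNgt; apply/negP => xA.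
by move: h; rewrite indicE mem_set// mulr1; lra.
Qed.

End ultraboundedness.

(** * The two implications *)

Section rate.
Context {R : realType}.

(** The smallest admissible constant need not be strictly decreasing nor
unbounded at the origin; adding [r^-1] makes it both, and also makes room above
the infimum. *)
Lemma decreasing_rate (P : R -> set R) :
  (forall r, 0 < r -> P r !=set0) -> (forall r K, P r K -> 0 < K) ->
  (forall r1 r2, 0 < r1 -> r1 < r2 -> P r1 `<=` P r2) ->
  exists C : R -> R,
    [/\ forall r : R, 0 < r -> 0 < C r,
        forall r1 r2 : R, 0 < r1 -> r1 < r2 -> C r2 < C r1,
        C r @[r --> (0:R)^'+] --> +oo &
        forall r, 0 < r -> exists2 K, P r K & K <= C r].
Proof.
move=> Pn P0 Pm.
have lb r : lbound (P r) 0 by move=> K /P0 /ltW.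
have hlb r : has_lbound (P r) by exists 0; exact: lb.
have inf0 r : 0 < r -> 0 <= inf (P r) by move=> r0; apply: lb_le_inf; [exact: Pn|exact: lb].
have invlt (r1 r2 : R) : 0 < r1 -> r1 < r2 -> r2^-1 < r1^-1.
  by move=> h1 h2; rewrite ltf_pV2// posrE//; exact: lt_trans h2.
exists (fun r => inf (P r) + r^-1); split.
- by move=> r r0; rewrite ltr_wpDl ?inf0// invr_gt0.
- move=> r1 r2 h1 h2; rewrite ler_ltD ?invlt//.
  by apply: lb_le_inf; [exact: Pn|move=> K /(Pm _ _ h1 h2); exact: ge_inf].
- apply/cvgryPge => A.
  have A0 : 0 < (`|A| + 1)^-1 by rewrite invr_gt0 ltr_wpDl.
  near=> r; have r0 : 0 < r by near: r; exact: nbhs_right_gt.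
  have rA : r < (`|A| + 1)^-1 by near: r; exact: nbhs_right_lt.
  have := invlt _ _ r0 rA; rewrite invrK => h.
  by have := ler_norm A; have := inf0 r r0; lra.
- move=> r r0; have ri0 : 0 < r^-1 by rewrite invr_gt0.
  have [K PK KC] := inf_adherent ri0 (conj (Pn r r0) (hlb r)).
  by exists K => //; exact: ltW.
Unshelve. all: by end_near. Qed.

End rate.

Section equivalence.
Context {R : realType} {d : nat}.
Variables (I : set R) (theta : R) (Q : R -> 'M[R]_d) (b : R -> 'rV[R]_d -> 'rV[R]_d).
Variables (G : R -> R -> ('rV[R]_d -> R) -> 'rV[R]_d -> R)
          (g : R -> R -> 'rV[R]_d -> 'rV[R]_d -> R)
          (mu : R -> probability 'rV[R]_d R).
Hypothesis theta0 : 0 < theta.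
Hypothesis I_up : forall s t, I s -> s <= t -> I t.
Hypothesis bdis : dissipative_drift I theta b.
Hypothesis hcoef : holder_coefficients I theta Q b.
Hypothesis Qell : uniformly_elliptic I Q.
Hypothesis G_evol : evolution_operator I theta Q b G.
Hypothesis g_kernel : evolution_kernel I G g.
Hypothesis mu_tight : tight_evolution_system I G mu.

Let leb := lebesgue_rV R d.

Theorem ultrabounded_of_phi_bound : phi_uniform_bound I g -> ultrabounded I G mu.
Proof.
move=> hphi p p1.
have bnd delta : 0 < delta -> exists K, Lp_sup_bound I G mu p delta K.
  move=> delta0; have [K [K0 hK]] := evolution_Lp_sup_bound theta0 I_up bdis
    hcoef Qell G_evol g_kernel mu_tight hphi p1 delta0.
  by exists K.
split.
  move=> s t Is It st; have [K hK] := bnd (t - s) ltac:(by rewrite subr_gt0).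
  exact: (Lp_sup_bound_maps I_up G_evol g_kernel p1 Is st hK).
have [K1 hK1] := bnd 1 ltr01.
pose P r := [set K | 0 < K /\ forall s t, I s -> s < t -> r <= t - s ->
  (norm_Lp_Linfty G mu p t s <= K%:E)%E].
have [||| C [C0 Cd Coo CP]] := @decreasing_rate R P.
- move=> r r0; have [K hK] := bnd r r0; exists (K + 1); split.
    by case: hK => K0 _; exact: addr_gt0.
  by move=> s t Is st; exact: (Lp_sup_bound_norm I_up G_evol g_kernel p1 Is st hK1 hK).
- by move=> r K [].
- by move=> r1 r2 _ r12 K [K0 hK]; split=> // s t Is st /(le_trans (ltW r12)); exact: hK.
exists C; split => // s t Is _ st.
have [K [_ hK] KC] := CP (t - s) ltac:(by rewrite subr_gt0).
by apply: (le_trans (hK s t Is st (lexx _))); rewrite lee_fin.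
Qed.

(** On [C_b] functions the extension is [G t s] itself, so an operator norm bound
is an almost everywhere bound. *)
Lemma norm_Lp_Linfty_ae (p s t C e : R) f : 1 < p -> I s -> s < t ->
  (norm_Lp_Linfty G mu p t s <= C%:E)%E -> Cb f -> 0 < e ->
  ('N[mu s]_p%:E[EFin \o f] <= e%:E)%E ->
  {ae leb, forall x, `|G t s f x| <= C * e}.
Proof.
move=> p1 Is st hC cf e0 Nf; have It := I_up Is (ltW st).
have mf := Cb_measurable cf; have cF := CbZ e^-1 cf.
have cG := evolution_Cb G_evol Is (ltW st) cF.
have cst_cvg r h : (fun _ : nat => 'N[mu r]_p%:E[EFin \o (h \- h)%R]%E) @ \oo --> 0%E.
  have -> : (h \- h)%R = (fun=> 0) by apply/funext => x /=; rewrite subrr.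
  rewrite (_ : (fun _ : nat => _) = fun=> 0%E); first exact: cvg_cst.
  apply/funext => _; apply/eqP; rewrite eq_le Lnorm_ge0 andbT.
  by apply: (Lnorm_bounded_le _ (ltW p1)) => // x; rewrite normr0.
have ext : Lp_extension G mu p t s (fun x => e^-1 * f x) (G t s (fun x => e^-1 * f x)).
  split; [exact: Cb_Lfun|exact: Cb_Lfun|].
  by exists (fun=> fun x => e^-1 * f x); split => //; exact: cst_cvg.
have N1 : ('N[mu s]_p%:E[EFin \o (fun x => e^-1 * f x)%R] <= 1)%E.
  rewrite (Lnorm_scale _ (ltW p1) _ mf) ger0_norm ?invr_ge0 ?(ltW e0)//.
  apply: (@le_trans _ _ (e^-1%:E * e%:E)%E); last by rewrite -EFinM mulVf ?lt0r_neq0.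
  by rewrite lee_wpmul2l// lee_fin invr_ge0 ltW.
have : (Linfty_norm (EFin \o G t s (fun x => e^-1 * f x)%R) <= C%:E)%E.
  apply: le_trans hC; apply: ereal_sup_ubound; exists (fun x => e^-1 * f x).
  by exists (G t s (fun x => e^-1 * f x)); split.
move/(Linfty_norm_leP I_up g_kernel _ _ Is).1; apply: filterS => x /=.
rewrite (evolutionZ I_up G_evol g_kernel _ _ Is (ltW st) cf) lee_fin normrM.
by rewrite ger0_norm ?invr_ge0 ?(ltW e0)// mulrC ler_pdivrMr.
Qed.

Lemma Cb_clamp (k : 'rV[R]_d -> R) (m M : R) : continuous k ->
  Cb (fun x => Num.min M (Num.max m (k x))).
Proof.
move=> ck; split.
  move=> x; apply: (@continuous_min _ _ (fun=> M) (fun x => Num.max m (k x))).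
    exact: cst_continuous.
  by apply: (@continuous_max _ _ (fun=> m) k); [exact: cst_continuous|exact: ck].
exists (`|m| + `|M|) => x.
have [h1|h1] := leP M (Num.max m (k x)); first by rewrite lerDr.
move: h1; rewrite /Num.max; case: ifP => h2 h1; last by rewrite lerDl.
rewrite ler_norml; have := ler_norm M; have := ler_norm (- m); rewrite normrN.
have := normr_ge0 m; have := normr_ge0 M; move: h1 h2; set u := k x; lra.
Qed.

(** By tightness, uniformly in [s]. *)
Lemma tail_indicator (C : R) : 0 < C -> exists rad : R, 0 < rad /\
  exists f : 'rV[R]_d -> R, [/\ Cb f, forall x, 0 <= f x <= 1,
    forall x, rad + 1 <= enorm x -> f x = 1 &
    forall s, I s -> ('N[mu s]_2%:E[EFin \o f] <= C%:E)%E].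
Proof.
move=> C0; have C20 : 0 < C `^ 2 by exact: powR_gt0.
have [rad [rad0 hrad]] := uniform_mass_radius mu_tight C20.
exists rad; split => //.
pose f (x : 'rV[R]_d) := Num.min 1 (Num.max 0 (enorm x - rad)).
have cf : Cb f.
  apply: Cb_clamp => x; apply: (cvgB (@enorm_continuous R d x)); exact: cvg_cst.
have f01 x : 0 <= f x <= 1.
  by rewrite /f le_min ler01 le_max lexx ge_min lexx.
exists f; split => //.
  move=> x hx; rewrite /f; apply/min_idPl; rewrite le_max; apply/orP; right.
  by rewrite lerBrDl.
move=> s Is; pose B := [set x : 'rV[R]_d | enorm x < rad].
have mB : measurable B by exact: enorm_ball_measurable.
apply: (@Lnorm_indic_le _ _ _ (mu s) 2 (ler1n _ 2) f (~` B)) => //.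
- exact: Cb_measurable.
- exact: measurableC.
- move=> x; have /andP[f0 f1] := f01 x; rewrite ger0_norm// indicE.
  have [//|xB] := boolP (x \in _); rewrite /f.
  have /ltW hB : enorm x < rad.
    by move: xB; rewrite notin_setE /= => /contrapT.
  by rewrite /Num.max ifF ?min_r// ltNge subr_le0 hB.
- exact: ltW.
- have hC := probability_setC (mu s) mB.
  apply: (eq_ind_r (fun z => (z <= (C `^ 2)%:E)%E) _ hC).
  have := hrad s Is; rewrite -/B.
  have Bfin : mu s B \is a fin_num by exact: fin_num_measure.
  by rewrite leeBlDr// -leeBlDl// -EFinB.
Qed.

Lemma enorm_triangle (x y : 'rV[R]_d) : enorm x <= enorm y + enorm (x - y).
Proof. by have := enormD y (x - y); rewrite addrC subrK. Qed.

(** If [y] is in the tail then the second factor is [N^-1], which the truncation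
at [N] absorbs; otherwise [enorm y] is below [rad + 1], and the excess of [enorm x]
over [rad + 1] is at most the distance. *)
Lemma gaussian_tail_cost (f : 'rV[R]_d -> R) (rad lam N : R) : 0 <= rad -> 0 < lam ->
  1 <= N -> (forall x, 0 <= f x <= 1) -> (forall x, rad + 1 <= enorm x -> f x = 1) ->
  forall x y : 'rV[R]_d,
  Num.min (expR (lam * (Num.max 0 (enorm x - (rad + 1))) ^+ 2)) N * (1 - f y + N^-1) <=
    2 * expR (lam * dotp (x - y) (x - y)).
Proof.
move=> rad0 lam0 N1 f01 f1 x y; have N0 : 0 < N := lt_le_trans ltr01 N1.
have /andP[fy0 fy1] := f01 y.
have Ni : N^-1 <= 1 by rewrite invf_le1.
have E1 : 1 <= expR (lam * dotp (x - y) (x - y)).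
  by rewrite -expR0 ler_expR mulr_ge0 ?dotp_ge0 ?ltW.
have [yr|yr] := leP (rad + 1) (enorm y).
  rewrite f1// subrr add0r (@le_trans _ _ 1)//; last by lra.
  by rewrite ler_pdivrMr// mul1r ge_min lexx orbT.
rewrite mulrC; apply: ler_pM => //.
- by rewrite addr_ge0 ?subr_ge0 ?invr_ge0 ?(ltW N0).
- by rewrite le_min expR_ge0 ltW.
- by rewrite (natrD _ 1 1) lerD// gerBl.
rewrite ge_min ler_expR ler_wpM2l ?(ltW lam0)//.
rewrite -sqr_enorm lerXn2r ?nnegrE ?enorm_ge0 ?le_max ?lexx//.
by rewrite ge_max enorm_ge0 lerBlDr addrC (le_trans (enorm_triangle x y))// lerD2r ltW.
Qed.

Lemma gaussian_excess_le (lam q : R) (y : 'rV[R]_d) : 0 <= lam -> 0 <= q ->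
  phi_exp lam y <= expR (2 * lam * q ^+ 2) *
    expR (2 * lam * Num.max 0 (enorm y - q) ^+ 2).
Proof.
move=> lam0 q0; rewrite -expRD ler_expR; set h := Num.max _ _.
rewrite (_ : _ + _ = lam * (2 * (q ^+ 2 + h ^+ 2))); last by ring.
rewrite ler_wpM2l//; have h0 : 0 <= h by rewrite le_max lexx.
have hy : enorm y <= q + h by rewrite -lerBlDl le_max lexx orbT.
apply: (@le_trans _ _ ((q + h) ^+ 2)).
  by rewrite lerXn2r ?nnegrE ?enorm_ge0 ?addr_ge0.
by have := sqr_ge0 (q - h); rewrite !expr2; lra.
Qed.

Lemma Cb_min_cst (k : 'rV[R]_d -> R) (M : R) : continuous k -> (forall x, 0 <= k x) ->
  Cb (fun x => Num.min (k x) M).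
Proof.
move=> ck k0; have := Cb_clamp 0 M ck; congr Cb; apply/funext => x.
by rewrite (max_r (k0 x)) minC.
Qed.

Lemma gaussian_excess_continuous (lam q : R) :
  continuous (fun x : 'rV[R]_d => expR (lam * Num.max 0 (enorm x - q) ^+ 2)).
Proof.
have ch : continuous (fun x : 'rV[R]_d => Num.max 0 (enorm x - q)).
  move=> x; apply: (@continuous_max _ _ (fun=> 0) (fun x : 'rV[R]_d => enorm x - q)).
    exact: cst_continuous.
  by apply: (cvgB (@enorm_continuous R d x)); exact: cvg_cst.
move=> x.
have h : (fun x : 'rV[R]_d => lam * Num.max 0 (enorm x - q) ^+ 2) @ nbhs x -->
    lam * Num.max 0 (enorm x - q) ^+ 2.
  by apply: cvgM; [exact: cvg_cst|rewrite expr2; exact: (cvgM (ch x) (ch x))].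
exact: (cvg_comp _ _ h (@continuous_expR R _)).
Qed.

Definition phi_trunc (lam : R) (n : nat) (x : 'rV[R]_d) := Num.min (phi_exp lam x) n.+1%:R.

Lemma Cb_phi_trunc lam n : Cb (phi_trunc lam n).
Proof.
apply: Cb_min_cst => [|x]; last exact: expR_ge0.
suff -> : phi_exp lam = (fun x : 'rV[R]_d => expR (lam * Num.max 0 (enorm x - 0) ^+ 2)).
  exact: gaussian_excess_continuous.
by apply/funext => x; rewrite subr0 max_r// enorm_ge0.
Qed.

Lemma phi_trunc_ge0 lam n x : 0 <= phi_trunc lam n x.
Proof. by rewrite le_min expR_ge0 ler0n. Qed.

(** The [L^2] bound applied to the tail function [f] leaves mass [3/4] of the
transition kernel in one ball, for almost every starting point. Concentration, applied to
[1 - f] and a Gaussian of the distance to this ball, then bounds the Gaussian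
integral after a short time [tau]; the evolution law propagates the bound. *)
Lemma evolution_phi_trunc_le (lam delta : R) : ultrabounded I G mu ->
  0 < lam -> 0 < delta -> exists M : R, 0 < M /\
  forall s t n x, I s -> delta <= t - s -> G t s (phi_trunc lam n) x <= M.
Proof.
move=> ultra lam0 delta0.
have [kap [kap0 conc]] := gaussian_concentration theta0 I_up bdis hcoef Qell G_evol g_kernel.
(* The rate is doubled to pass from the distance to the ball to [enorm] itself. *)
have lam20 : 0 < 2 * lam by rewrite mulr_gt0.
have kl0 : 0 < kap * (2 * lam) by rewrite mulr_gt0.
pose tau := Num.min (delta / 2) (2 * (kap * (2 * lam)))^-1.
have tau0 : 0 < tau by rewrite lt_min divr_gt0// invr_gt0 mulr_gt0.
have taud : tau < delta.
  by apply: (@le_lt_trans _ _ (delta / 2)); [rewrite ge_min lexx|lra].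
have taukap : kap * (2 * lam) * tau < 1.
  apply: (@le_lt_trans _ _ (kap * (2 * lam) * (2 * (kap * (2 * lam)))^-1)).
    by rewrite ler_wpM2l ?(ltW kl0)// ge_min lexx orbT.
  by rewrite invfM mulrCA divff ?lt0r_neq0// mulr1 invf_lt1// ltr1n.
have two1 : (1 : R) < 2 by rewrite ltr1n.
have [_ [C [C0 _ _ hC]]] := ultra 2 two1.
have Ct0 := C0 tau tau0; pose e := (4 * C tau)^-1.
have e0 : 0 < e by rewrite invr_gt0 mulr_gt0.
have Ce : C tau * e = 4^-1.
  by rewrite /e invfM mulrCA divff ?mulr1// lt0r_neq0.
have [rad [rad0 [f [cf f01 f1 Nf]]]] := tail_indicator e0.
have q0 : 0 <= rad + 1 by rewrite addr_ge0// ltW.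
pose E := expR (2 * lam * (rad + 1) ^+ 2).
have E1 : 1 <= E.
  by rewrite -expR0 ler_expR mulr_ge0 ?sqr_ge0// ltW.
have E0 : 0 < E by exact: expR_gt0.
exists (3 * E); split; first by rewrite mulr_gt0.
move=> s t n x Is dst; pose r := s + tau.
have sr : s < r by rewrite ltrDl.
have rt : r < t by rewrite /r -ltrBrDl (lt_le_trans taud).
have Ir := I_up Is (ltW sr).
have rs : r - s = tau by rewrite /r addrC addKr.
pose N : R := n.+1%:R; have N1 : 1 <= N by rewrite ler1n.
have N0 : 0 < N by exact: lt_le_trans N1.
have Ni0 : 0 < N^-1 by rewrite invr_gt0.
have Ni1 : N^-1 <= 1 by rewrite invf_le1.
(* Truncation and the term [N^-1] keep both functions bounded and bounded below. *)
pose k := fun y : 'rV[R]_d => expR (2 * lam * Num.max 0 (enorm y - (rad + 1)) ^+ 2).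
pose F y := Num.min (k y) N; pose H y := 1 + N^-1 - f y.
have k1 y : 1 <= k y.
  by rewrite -expR0 ler_expR mulr_ge0 ?sqr_ge0// ltW.
have F1 y : 1 <= F y by rewrite le_min k1 N1.
have cF : Cb F.
  by apply: Cb_min_cst => [|y]; [exact: gaussian_excess_continuous|exact: expR_ge0].
have cH : Cb H by apply: CbB => //; exact: Cb_cst.
have prod y : G r s F y * G r s H y <= 2.
  apply: (conc s r F H (2 * lam) 2 N^-1) => //.
  - by rewrite rs.
  - by move=> z; exact: le_trans (F1 z).
  - by move=> z; rewrite /H addrAC lerDr subr_ge0; case/andP: (f01 z).
  - move=> z w; rewrite /H addrAC.
    exact: (gaussian_tail_cost (ltW rad0) lam20 N1 f01 f1).
have GF0 y : 0 <= G r s F y.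
  apply: (evolution_ge0 I_up G_evol g_kernel _ Is (ltW sr) cF) => z.
  exact: le_trans (F1 z).
have quarter (u v : R) : 0 < u -> v <= 4^-1 -> 3 / 4 <= 1 + u - v.
  by move=> u0 v4; lra.
have aeF : {ae leb, forall y, G r s F y <= 3}.
  have nC : (norm_Lp_Linfty G mu 2 r s <= (C tau)%:E)%E.
    by have := hC s r Is Ir sr; rewrite rs.
  have := norm_Lp_Linfty_ae two1 Is sr nC cf e0 (Nf s Is).
  apply: filterS => y; rewrite Ce => /(le_trans (ler_norm _)) Gf.
  have GH : 3 / 4 <= G r s H y.
    rewrite (evolutionB I_up G_evol g_kernel _ Is (ltW sr) (Cb_cst _) cf).
    rewrite (evolution_cst I_up G_evol g_kernel _ _ Is (ltW sr)).
    exact: quarter.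
  have := le_trans (ler_wpM2l (GF0 y) GH) (prod y); lra.
(* Almost everywhere at time [r], hence everywhere at the later time [t]. *)
have aephi : {ae leb, forall y, G r s (phi_trunc lam n) y <= 3 * E}.
  apply: filterS aeF => y GF3.
  apply: (@le_trans _ _ (E * G r s F y)); last by rewrite mulrC ler_wpM2r// ltW.
  rewrite -(evolutionZ I_up G_evol g_kernel _ _ Is (ltW sr) cF).
  apply: (evolution_le I_up G_evol g_kernel _ Is (ltW sr) (Cb_phi_trunc lam n) (CbZ E cF)).
  move=> z; rewrite minr_pMr ?(ltW E0)// le_min; apply/andP; split.
    apply: (@le_trans _ _ (phi_exp lam z)); first by rewrite ge_min lexx.
    exact: gaussian_excess_le (ltW lam0) q0.
  by apply: (@le_trans _ _ N); [rewrite ge_min lexx orbT|rewrite ler_peMl// ltW].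
rewrite (evolution_comp I_up G_evol _ Is (ltW sr) (ltW rt) (Cb_phi_trunc lam n)).
apply: (evolution_ae_le I_up g_kernel _ Ir rt _ _ _ aephi).
- exact: (evolution_Cb G_evol Is (ltW sr) (Cb_phi_trunc lam n)).
- move=> y; apply: (evolution_ge0 I_up G_evol g_kernel _ Is (ltW sr) (Cb_phi_trunc lam n)).
  by move=> z; exact: phi_trunc_ge0.
- by rewrite mulr_ge0// ltW.
Qed.

Lemma kernel_integral_phi_cvg (s t lam : R) x : I s -> I t -> s < t ->
  (fun n => (G t s (phi_trunc lam n) x)%:E) @ \oo --> kernel_integral g t s (phi_exp lam) x.
Proof.
move=> Is It st.
have cv : (fun n => kernel_integral g t s (phi_trunc lam n) x) @ \oo -->
    kernel_integral g t s (phi_exp lam) x.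
  apply: (kernel_integral_monotone g_kernel) => //.
  - by move=> n; exact: Cb_measurable (Cb_phi_trunc lam n).
  - by move=> n y; exact: phi_trunc_ge0.
  - move=> y m n mn; rewrite /phi_trunc le_min !ge_min lexx/=.
    by rewrite ler_nat ltnS mn orbT.
  - move=> y; apply: cvg_near_cst; exists (Num.truncn (phi_exp lam y)) => // n /= hn.
    rewrite /phi_trunc min_l//; apply: le_trans (ltW (truncnS_gt _)) _.
    by rewrite ler_nat ltnS.
rewrite (_ : (fun n => (G t s _ x)%:E) =
  (fun n => kernel_integral g t s (phi_trunc lam n) x))//; apply/funext => n.
by rewrite (evolution_kernelE g_kernel _ Is It st (Cb_phi_trunc lam n)).
Qed.

Theorem phi_bound_of_ultrabounded (lam delta : R) : ultrabounded I G mu ->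
  0 < lam -> 0 < delta -> exists K : R, 0 < K /\
  forall s t x, I s -> delta <= t - s ->
    (`|kernel_integral g t s (phi_exp lam) x| <= K%:E)%E.
Proof.
move=> ultra lam0 delta0; have [M [M0 hM]] := evolution_phi_trunc_le ultra lam0 delta0.
exists M; split => // s t x Is dst.
have st : s < t by rewrite -subr_gt0 (lt_le_trans delta0).
have It := I_up Is (ltW st); have cv := @kernel_integral_phi_cvg s t lam x Is It st.
have [_ g0 _ _] := g_kernel x Is It st.
rewrite gee0_abs; last first.
  by apply: integral_ge0 => y _; rewrite lee_fin mulr_ge0 ?expR_ge0// ltW.
have <- := cvg_lim (@ereal_hausdorff R) cv.
apply: lime_le; first by apply/cvg_ex; eexists; exact: cv.
by apply: nearW => n; rewrite lee_fin; exact: hM.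
Qed.

Lemma measurable_kernel_integral_phi (lam s t : R) : I s -> I t -> s < t ->
  measurable_fun setT (kernel_integral g t s (phi_exp lam)).
Proof.
move=> Is It st; apply: (@emeasurable_fun_cvg _ _ _ setT
  (fun n x => (G t s (phi_trunc lam n) x)%:E)); last first.
  by move=> x _; exact: kernel_integral_phi_cvg.
move=> n; apply/measurable_EFinP.
exact: Cb_measurable (evolution_Cb G_evol Is (ltW st) (Cb_phi_trunc lam n)).
Qed.

End equivalence.

Theorem theorem4p5 (R : realType) (d : nat) (I : set R) (theta : R)
    (Q : R -> 'M[R]_d) (b : R -> 'rV[R]_d -> 'rV[R]_d)
    (G : R -> R -> ('rV[R]_d -> R) -> 'rV[R]_d -> R)
    (g : R -> R -> 'rV[R]_d -> 'rV[R]_d -> R)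
    (mu : R -> probability 'rV[R]_d R)
    (d_gt0 : (0 < d)%N)
    (I_halfline : open_right_halfline I)
    (theta01 : 0 < theta < 1)
    (coef_holder : holder_coefficients I theta Q b)
    (Q_elliptic : uniformly_elliptic I Q)
    (lyap : lyapunov I Q b)
    (b_dissip : dissipative_drift I theta b)
    (G_evol : evolution_operator I theta Q b G)
    (g_kernel : evolution_kernel I G g)
    (mu_tight : tight_evolution_system I G mu) :
  ultrabounded I G mu <->
  (forall lam s t : R, 0 < lam -> I s -> I t -> s < t ->
     in_Linfty (kernel_integral g t s (phi_exp lam))) /\
  (forall delta lam : R, 0 < delta -> 0 < lam ->
     exists K : R, 0 < K /\
       forall s t : R, I s -> I t -> delta <= t - s ->
         (Linfty_norm (kernel_integral g t s (phi_exp lam)) <= K%:E)%E).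
Proof.
have theta0 : 0 < theta by case/andP: theta01.
have I_up s t : I s -> s <= t -> I t.
  case: I_halfline => a -> /=; rewrite !in_itv/= !andbT => sa st.
  exact: lt_le_trans st.
split=> [ultra|[_ hphi]]; last first.
  exact: (ultrabounded_of_phi_bound theta0 I_up b_dissip coef_holder Q_elliptic
    G_evol g_kernel mu_tight hphi).
have bound delta lam : 0 < delta -> 0 < lam -> exists K : R, 0 < K /\
    forall s t : R, I s -> I t -> delta <= t - s ->
      (Linfty_norm (kernel_integral g t s (phi_exp lam)) <= K%:E)%E.
  move=> delta0 lam0; have [K [K0 hK]] := phi_bound_of_ultrabounded theta0 I_up
    b_dissip coef_holder Q_elliptic G_evol g_kernel mu_tight ultra lam0 delta0.
  exists K; split => // s t Is _ dst.
  by apply/(Linfty_norm_leP I_up g_kernel _ _ Is); apply: aeW => x; exact: hK.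
split=> // lam s t lam0 Is It st.
split; first exact: (measurable_kernel_integral_phi G_evol g_kernel lam Is It st).
have [K [_ hK]] := bound (t - s) lam ltac:(by rewrite subr_gt0) lam0.
by rewrite (le_lt_trans (hK s t Is It (lexx _)))// ltry.
Qed.
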